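(* Let $u_h\in W_h$ be the unique solution of the Galerkin problem $t(u_h,v_h)=s(u_h,v_h)+\ell(v_h)$ for all $v_h\in W_h$. For any $u_{h,0}\in W_h$, let the sequence $\{u_{h,k}\}\subset W_h$ be defined for $k\ge0$ as follows: $u_{h,k+1/2}\in W_h$ solves $$t(u_{h,k+1/2},v_h)=s(u_{h,k},v_h)+\ell(v_h)\qquad\text{for all } v_h\in W_h,$$ and $$u_{h,k+1}:=u_{h,k+1/2}+u^c_{h,k+1/2},\qquad u^c_{h,k+1/2}:=\operatorname*{argmin}_{w_h\in W_{h,N}}\|\mathcal R_h(u_{h,k+1/2}+w_h)\|_{\sigma_t}^2,$$ where $W_{h,N}\subset W_h$ is a linear subspace (which may be chosen differently in each step $k$). Then $\{u_{h,k}\}$ converges linearly to $u_h$, i.e. for all $k\ge0$ $$\|u_h-u_{h,k}\|_{\sigma_t}\le\frac{\rho^k}{1-\rho}\,\|\mathcal R_h(u_{h,0})\|_{\sigma_t}.$$ Moreover, the residuals converge monotonically, i.e. $\|\mathcal R_h(u_{h,k+1})\|_{\sigma_t}\le\rho\,\|\mathcal R_h(u_{h,k})\|_{\sigma_t}$ for all $k\ge 0$.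
   Context: Setting. Let $R\subset\mathbb R^d$ be a domain with Lipschitz boundary and outward unit normal $\mathbf n(\mathbf r)$, $S=S^{d-1}$ the unit sphere, $D:=R\times S^{d-1}$, $\partial D:=\partial R\times S^{d-1}$ and $\partial D_-:=\{(\mathbf r,\mathbf s)\in\partial R\times S^{d-1}:\mathbf n(\mathbf r)\cdot\mathbf s<0\}$. The gradient $\nabla$ acts in $\mathbf r$ only. Data. $\sigma_s,\sigma_t:R\to\mathbb R$ are positive and essentially bounded, $\sigma_t=\sigma_a+\sigma_s$, and there is $c_0>0$ with $\sigma_a\ge c_0$ a.e. in $R$; $\rho:=\|\sigma_s/\sigma_t\|_\infty<1$. The phase function $\theta:[-1,1]\to\mathbb R$ is non-negative with $\int_{S^{d-1}}\theta(\mathbf s\cdot\mathbf s')\,d\mathbf s'=1$ for a.e. $\mathbf s$. Sources: $q\in L^2(D)$ and $q_\partial\in L^2(\partial D_-;|\mathbf s\cdot\mathbf n|)$. Put $(\mathcal S v)(\mathbf r,\mathbf s):=\sigma_s(\mathbf r)\int_{S^{d-1}}\theta(\mathbf s\cdot\mathbf s')v(\mathbf r,\mathbf s')\,d\mathbf s'$ for $v\in L^2(D)$. Spaces. $V_0:=L^2(D)$ with inner product $(\cdot,\cdot)$; $V_1:=\{v\in V_0:\mathbf s\cdot\nabla v\in V_0,\ v|_{\partial D_-}\in L^2(\partial D_-;|\mathbf s\cdot\mathbf n|)\}$, the completion of $C^\infty(\overline D)$ under the norm induced by $(v,w)+(\mathbf s\cdot\nabla v,\mathbf s\cdot\nabla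 w)+\int_{\partial D_-}|\mathbf s\cdot\mathbf n|\,v\,w$. Even/odd parts: $v^\pm(\mathbf r,\mathbf s):=\tfrac12(v(\mathbf r,\mathbf s)\pm v(\mathbf r,-\mathbf s))$; $V^\pm:=\{v^\pm:v\in V\}$. $W:=V_1^+\oplus V_0^-$. Weighted norm: $\|v\|_{\sigma_t}:=\|\sqrt{\sigma_t}\,v\|_{L^2(D)}$. Forms on $W$: $t(u,v):=(\mathbf s\cdot\nabla u^+,v^-)-(u^-,\mathbf s\cdot\nabla v^+)+(\sigma_t u,v)+\int_{\partial D}|\mathbf s\cdot\mathbf n|\,u^+v^+$, $\ s(u,v):=(\mathcal S u,v)$, $\ \ell(v):=(q,v)-2\int_{\partial D_-}\mathbf s\cdot\mathbf n\,q_\partial\,v^+$. Discretization. $\mathcal T_h^R$ and $\mathcal T_h^S$ are (finite) shape regular, quasi-uniform, conforming triangulations of $R$ and $S$ with mesh-size parameter $h>0$, and $-K\in\mathcal T_h^S$ for every $K\in\mathcal T_h^S$. $S_h^+$ is the space of even piecewise constant functions and $S_h^-$ the space of odd piecewise linear functions (not required to be continuous across elements) associated with $\mathcal T_h^S$. $X_h^+$ is the space of continuous piecewise linear functions and $X_h^-$ the space of piecewise constant functions associated with $\mathcal T_h^R$. The approximation space is the finite-dimensional space $W_h:=S_h^+\otimes X_h^+ + S_h^-\otimes X_h^-\subset W$. The discrete preconditioned residual operator $\mathcal R_h:W_h\to W_h$ is defined by $t(\mathcal R_h(w_h),v_h)=\ell(v_h)-t(w_h,v_h)+s(w_h,v_h)$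 for all $v_h\in W_h$. The Galerkin problem, the half-step problem and the minimization problem are uniquely solvable. *)

(* Defs.v *)
From HB Require Import structures.
From mathcomp Require Import all_boot all_order all_algebra.
From mathcomp Require Import all_classical all_reals all_analysis.
From mathcomp Require Import measurable_realfun.

Set Implicit Arguments.
Unset Strict Implicit.
Unset Printing Implicit Defensive.
Import Order.TTheory GRing.Theory Num.Def Num.Theory.
Import numFieldNormedType.Exports.
Local Open Scope classical_set_scope.
Local Open Scope ring_scope.

(* 'rV[R]_n gets the sigma-algebra generated by the coordinates, i.e. the Borel
   one, as for n.-tuple *)
Definition rV_display : measure_display. Proof. exact. Qed.

Section rV_measurable.
Context {R : realType} (n : nat).

Let coord (i : 'I_n) (x : 'rV[R]_n) : R := x ord0 i.
Let M : set (set 'rV[R]_n) := g_sigma_preimage coord.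

Let M0 : M set0. Proof. exact: sigma_algebra0. Qed.
Let MC A : M A -> M (~` A). Proof. exact: sigma_algebraC. Qed.
Let MU (F : (set 'rV[R]_n)^nat) : (forall i, M (F i)) -> M (\bigcup_i F i).
Proof. exact: sigma_algebra_bigcup. Qed.

HB.instance Definition _ := @isMeasurable.Build rV_display 'rV[R]_n M M0 MC MU.

Lemma measurable_coord (i : 'I_n) :
  measurable_fun [set: 'rV[R]_n] (fun x : 'rV[R]_n => x ord0 i).
Proof.
move=> _ Y mY; rewrite setTI; apply: sub_sigma_algebra => /=.
rewrite -bigcup_seq/=; exists i => /=; first by rewrite mem_index_enum.
by exists Y => //; rewrite setTI.
Qed.

Lemma measurable_fun_coordP d (T : measurableType d) (f : T -> 'rV[R]_n) :
  (forall i, measurable_fun [set: T] (fun t => f t ord0 i)) ->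
  measurable_fun [set: T] f.
Proof.
move=> mf _ A mA; rewrite setTI.
have : g_sigma_preimage (fun i => coord i \o f) (f @^-1` A).
  by rewrite g_sigma_preimage_comp; exists A => //; rewrite setTI.
apply: smallest_sub; first exact: sigma_algebra_measurable.
rewrite -bigcup_seq; apply: bigcup_sub => i _ B [C mC <-].
exact: mf.
Qed.

End rV_measurable.

Definition image_measure d1 d2 (T1 : measurableType d1) (T2 : measurableType d2)
    (R : realType) (m : set T1 -> \bar R) (f : T1 -> T2)
    (mf : measurable_fun [set: T1] f) (A : set T2) : \bar R :=
  pushforward m f A.

Section image_measure.
Context d1 d2 (T1 : measurableType d1) (T2 : measurableType d2) (R : realType).
Variables (m : {measure set T1 -> \bar R}) (f : T1 -> T2).
Variable mf : measurable_fun [set: T1] f.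

Local Notation im := (image_measure m mf).

Let im0 : im set0 = 0%E.
Proof. by rewrite /image_measure /pushforward preimage_set0 measure0. Qed.

Let im_ge0 A : (0 <= im A)%E.
Proof. exact: measure_ge0. Qed.

Let im_sigma_additive : semi_sigma_additive im.
Proof.
move=> F mF tF mUF; rewrite /image_measure /pushforward preimage_bigcup.
apply: measure_semi_sigma_additive.
- by move=> n; rewrite -[X in measurable X]setTI; exact: mf.
- apply/trivIsetP => /= i j _ _ ij; rewrite -preimage_setI.
  by move/trivIsetP : tF => /(_ _ _ _ _ ij) ->//; rewrite preimage_set0.
- by rewrite -preimage_bigcup -[X in measurable X]setTI; exact: mf.
Qed.

HB.instance Definition _ := isMeasure.Build _ _ _
  im im0 im_ge0 im_sigma_additive.

End image_measure.

Section lebesgue.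
Context {R : realType}.

Definition rV_snoc n (p : 'rV[R]_n * R) : 'rV[R]_n.+1 :=
  \row_i oapp (fun j => p.1 ord0 j) p.2 (unlift ord_max i).

Lemma measurable_rV_snoc n : measurable_fun [set: 'rV[R]_n * R] (@rV_snoc n).
Proof.
apply: measurable_fun_coordP => i.
case: (unliftP ord_max i) => [j ->|->].
- rewrite (_ : (fun _ => _) = (fun p : 'rV[R]_n * R => p.1 ord0 j)).
    by apply: (measurableT_comp (measurable_coord j)); exact: measurable_fst.
  by apply/funext => p; rewrite mxE liftK.
- rewrite (_ : (fun _ => _) = snd); first exact: measurable_snd.
  by apply/funext => p; rewrite mxE unlift_none.
Qed.

Fixpoint lebesgue_rV n : {measure set 'rV[R]_n -> \bar R} :=
  match n with
  | 0 => \d_(0 : 'rV[R]_0)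
  | n'.+1 => image_measure (lebesgue_rV n' \x lebesgue_measure)%E
               (@measurable_rV_snoc n')
  end.

End lebesgue.

Section sphere.
Context {R : realType} (d : nat).
Notation E := 'rV[R]_d.

Definition dot (x y : E) : R := \sum_i x ord0 i * y ord0 i.
Definition enorm (x : E) : R := Num.sqrt (dot x x).
Definition sphere : set E := [set x | enorm x = 1].
Definition uball : set E := [set x | enorm x <= 1].
Definition normalize (x : E) : E := (enorm x)^-1 *: x.

Lemma measurable_dot : measurable_fun [set: E] (fun x => dot x x).
Proof.
rewrite /dot; apply: measurable_sum => i.
by apply: measurable_funM; exact: measurable_coord.
Qed.

Lemma dot_ge0 (x : E) : 0 <= dot x x.
Proof. by apply: sumr_ge0 => i _; rewrite -expr2 sqr_ge0. Qed.

Lemma enorm_powR (x : E) : enorm x = dot x x `^ 2^-1.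
Proof. by rewrite powR12_sqrt// dot_ge0. Qed.

Lemma measurable_enorm : measurable_fun [set: E] enorm.
Proof.
rewrite (_ : enorm = (@powR R)^~ 2^-1 \o (fun x => dot x x)); last first.
  by apply/funext => x /=; rewrite enorm_powR.
apply: measurableT_comp; [exact: measurable_powR|exact: measurable_dot].
Qed.

Lemma measurable_uball : measurable uball.
Proof.
rewrite (_ : uball = enorm @^-1` `]-oo, 1]); last first.
  by apply/seteqP; split=> x /=; rewrite in_itv.
by rewrite -[X in measurable X]setTI; exact: measurable_enorm.
Qed.

Lemma measurable_normalize : measurable_fun [set: E] normalize.
Proof.
apply: measurable_fun_coordP => i.
rewrite (_ : (fun _ => _) =
  (fun x => (dot x x `^ (- 2^-1)) * x ord0 i)); last first.
  by apply/funext => x; rewrite mxE enorm_powR powRN.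
apply: measurable_funM; last exact: measurable_coord.
apply: (measurableT_comp (measurable_powR _)); exact: measurable_dot.
Qed.

(* Polar coordinates: the surface measure of A is d times the Lebesgue measure
   of the part of the unit ball lying over A (the origin, sent to 0, is off the
   sphere). It is carried by the sphere. *)
Definition sphere_measure : set E -> \bar R :=
  mscale d%:R%:nng
    (image_measure (mrestr (lebesgue_rV d) measurable_uball)
       measurable_normalize).

HB.instance Definition _ := Measure.on sphere_measure.

End sphere.

Section sphere_finite.
Context {R : realType}.

Let box n : set 'rV[R]_n := [set x | forall i, `|x ord0 i| <= 1].

Let measurable_box n : measurable (@box n).
Proof.
rewrite (_ : @box n = \bigcap_(i in [set: 'I_n])
  ((fun x : 'rV[R]_n => x ord0 i) @^-1` `[-1, 1])).
  apply: fin_bigcap_measurable => // i _.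
  by rewrite -[X in measurable X]setTI; exact: measurable_coord.
apply/seteqP; split=> x /= h i; first by move=> _; rewrite /= in_itv/= -ler_norml.
by have := h i Logic.I; rewrite /= in_itv/= -ler_norml.
Qed.

Let lebesgue_box n : (lebesgue_rV n (@box n) < +oo)%E.
Proof.
elim: n => [|n ih] /=; first by rewrite diracE ltry.
rewrite /image_measure /pushforward.
apply: (@le_lt_trans _ _
  ((lebesgue_rV n \x lebesgue_measure)%E (@box n `*` `[(-1 : R), 1]))).
  apply: le_measure; rewrite ?inE.
  - rewrite -[X in measurable X]setTI.
    by apply: measurable_rV_snoc => //; exact: (@measurable_box n.+1).
  - by apply: measurableX; [exact: (@measurable_box n)|exact: measurable_itv].
  - move=> [x t] /= h; split => [i|] /=.
      by have := h (lift ord_max i); rewrite mxE liftK.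
    by have := h ord_max; rewrite mxE unlift_none/= in_itv/= -ler_norml.
rewrite product_measure1E//; last exact: (@measurable_box n).
have h : lebesgue_measure `[(-1 : R), 1]%classic = 2%:E.
  by rewrite lebesgue_measure_itv/= lte_fin gtrN// -EFinB opprK.
apply: (@le_lt_trans _ _ (lebesgue_rV n (@box n) * 2%:E)%E).
  by rewrite -h.
by rewrite muleC lte_mul_pinfty// lee_fin.
Qed.

Let sphere_measure_fin d : fin_num_fun (@sphere_measure R d).
Proof.
move=> A mA; rewrite ge0_fin_numE//; apply: lte_mul_pinfty => //.
apply: (@le_lt_trans _ _ (lebesgue_rV d (@box d))); last exact: (@lebesgue_box d).
apply: le_measure; rewrite ?inE; last 1 first.
- move=> x [_ /= x1] i.
  rewrite -(@ler_pXn2r _ 2)// ?nnegrE// expr1n real_normK ?num_real//.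
  apply: (@le_trans _ _ (dot x x)).
    rewrite /dot (bigD1 i)//= -expr2 lerDl; apply: sumr_ge0 => j _.
    by rewrite -expr2 sqr_ge0.
  by rewrite -(sqr_sqrtr (dot_ge0 x)) expr_le1// sqrtr_ge0.
- apply: measurableI; last exact: measurable_uball.
  by rewrite -[X in measurable X]setTI; exact: measurable_normalize.
- exact: (@measurable_box d).
Qed.

HB.instance Definition _ d :=
  @Measure_isFinite.Build _ _ R (@sphere_measure R d) (@sphere_measure_fin d).

End sphere_finite.

Section hausdorff.
Context {R : realType} (d : nat).
Notation E := 'rV[R]_d.
Local Open Scope ereal_scope.

Definition ediam (A : set E) : \bar R :=
  ereal_sup [set (enorm (p.1 - p.2))%:E | p in A `*` A].

(* mu_ext covers by countably many Borel sets; replacing a covering set by its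
   closure keeps its diameter, so this is the usual Hausdorff measure. The
   factor, the volume of the unit ball of R^m, makes it agree with Lebesgue
   measure on m-planes. *)
Definition hausdorff_gauge (m : nat) (e : R) (A : set E) : \bar R :=
  if `[< A = set0 >] then 0
  else if ediam A <= e%:E then
    (fine (lebesgue_rV m (@uball R m)) * (fine (ediam A) / 2) ^+ m)%:E
  else +oo.

Definition hausdorff (m : nat) (A : set E) : \bar R :=
  ereal_sup [set mu_ext (hausdorff_gauge m e) A | e in [set e : R | (0 < e)%R]].

Lemma ediam_ge0 A : A !=set0 -> 0 <= ediam A.
Proof.
move=> [x Ax]; apply: ereal_sup_ubound; exists (x, x) => //=.
rewrite subrr /enorm /dot big1 ?sqrtr0// => i _.
by rewrite mxE mul0r.
Qed.

Let gauge0 m e : hausdorff_gauge m e set0 = 0.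
Proof. by rewrite /hausdorff_gauge asboolT. Qed.

Let gauge_ge0 m e A : 0 <= hausdorff_gauge m e A.
Proof.
rewrite /hausdorff_gauge; case: asboolP => // /eqP/set0P A0.
case: ifPn => // _; rewrite lee_fin mulr_ge0 ?fine_ge0//.
by rewrite exprn_ge0// divr_ge0// fine_ge0// ediam_ge0.
Qed.

Section outer.
Variable m : nat.

Let hausdorff0 : hausdorff m set0 = 0.
Proof.
apply/eqP; rewrite eq_le; apply/andP; split.
  by apply: ge_ereal_sup => _ [e _ <-]; rewrite (mu_ext0 (gauge0 m e)).
apply: ereal_sup_ubound; exists 1%R => //=.
by rewrite (mu_ext0 (gauge0 m 1)).
Qed.

Let hausdorff_ge0 A : 0 <= hausdorff m A.
Proof.
apply: (@le_trans _ _ (mu_ext (hausdorff_gauge m 1) A)).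
  exact: mu_ext_ge0.
by apply: ereal_sup_ubound; exists 1%R => /=.
Qed.

Let le_hausdorff : {homo hausdorff m : A B / A `<=` B >-> A <= B}.
Proof.
move=> A B AB; apply: ge_ereal_sup => _ [e e0 <-].
apply: le_trans (le_mu_ext _ AB) _.
by apply: ereal_sup_ubound; exists e.
Qed.

Let hausdorff_sigma_subadditive : sigma_subadditive (hausdorff m).
Proof.
move=> F; apply: ge_ereal_sup => _ [e e0 <-].
apply: le_trans (mu_ext_sigma_subadditive (gauge_ge0 m e) F) _.
apply: lee_nneseries => [k _ _|k _]; first exact: mu_ext_ge0.
by apply: ereal_sup_ubound; exists e.
Qed.

HB.instance Definition _ := isOuterMeasure.Build R E (hausdorff m)
  hausdorff0 hausdorff_ge0 le_hausdorff hausdorff_sigma_subadditive.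

End outer.
End hausdorff.

Section phase_space.
Context {R : realType} (d : nat).
Notation E := 'rV[R]_d.

(* H^(d-1) on its Caratheodory sigma-algebra, which contains the Borel sets *)
Let H : {outer_measure set E -> \bar R} := hausdorff d.-1.
Definition surface_type := caratheodory_type H.
Definition surface : {measure set surface_type -> \bar R} :=
  H : set (caratheodory_type H) -> \bar R.

Definition boundary (Om : set E) : set E := closure Om `\` interior Om.

(* Near each boundary point, Om is the strict epigraph, in some unit direction
   e, of a Lipschitz function g of the component orthogonal to e *)
Definition lipschitz_domain (Om : set E) : Prop :=
  [/\ open Om, connected Om, Om !=set0 &
    forall x, boundary Om x -> exists (e : E) (g : E -> R) (L eps : R),
      [/\ enorm e = 1, 0 < eps,
        forall y z, `|g y - g z| <= L * enorm (y - z) &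
        forall y, enorm (y - x) < eps ->
          (Om y <-> g (y - dot y e *: e) < dot y e)]].

(* The half-space {v . n < 0} consists of inward directions, {v . n > 0} of
   outward ones; at points where the boundary has a tangent plane, this
   determines n *)
Definition outward_normal (Om : set E) (r n : E) : Prop :=
  enorm n = 1 /\ forall v : E,
    (dot v n < 0 -> \forall h \near (0 : R)^'+, Om (r + h *: v)) /\
    (0 < dot v n -> \forall h \near (0 : R)^'+, ~ closure Om (r + h *: v)).

Definition outward_normal_field (Om : set E) (n : E -> E) : Prop :=
  measurable_fun (boundary Om : set surface_type) (n : surface_type -> E) /\
  {ae surface, forall r, boundary Om r -> outward_normal Om r (n r)}.

Definition phase_measure : {measure set (E * E) -> \bar R} :=
  (lebesgue_rV d \x @sphere_measure R d)%E.

Definition phase_surface : {measure set (surface_type * E) -> \bar R} :=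
  (surface \x @sphere_measure R d)%E.

Definition phase (Om : set E) : set (E * E) := Om `*` @sphere R d.

Definition phase_boundary (Om : set E) : set (E * E) :=
  boundary Om `*` @sphere R d.

Definition inflow (Om : set E) (n : E -> E) : set (E * E) :=
  [set z | phase_boundary Om z /\ dot z.2 (n z.1) < 0].

Definition square_integrable d' (T : measurableType d')
    (mu : {measure set T -> \bar R}) (D : set T) (w f : T -> R) : Prop :=
  measurable_fun D f /\ (\int[mu]_(z in D) (w z * f z ^+ 2)%:E < +oo)%E.

End phase_space.

Section transport.
Context {R : realType} (d : nat).
Notation E := 'rV[R]_d.
Variables (Om : set E) (n : E -> E).
Implicit Types u v w : E * E -> R.

Definition even_part v : E * E -> R := fun z => (v z + v (z.1, - z.2)) / 2.
Definition odd_part v : E * E -> R := fun z => (v z - v (z.1, - z.2)) / 2.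

(* derivative at z in direction e, in the space variable only *)
Definition space_derive v (e : E) (z : E * E) : R :=
  'D_e (fun r => v (r, z.2)) z.1.

(* C^1 instead of C^oo: the same weak derivatives, by mollification *)
Definition test_function (xi : E * E -> R) : Prop :=
  [/\ continuous xi,
    forall z, differentiable (fun r => xi (r, z.2)) z.1,
    forall e, continuous (space_derive xi e) &
    exists2 K, compact K /\ K `<=` Om & forall z, ~ K z.1 -> xi z = 0].

(* g is the weak derivative s . nabla v, and v, g are in L^2(D) *)
Definition weak_streaming v (g : E * E -> R) : Prop :=
  [/\ square_integrable (phase_measure d) (phase Om) (cst 1) v,
    square_integrable (phase_measure d) (phase Om) (cst 1) g &
    forall xi, test_function xi ->
      \int[phase_measure d]_(z in phase Om) (v z * space_derive xi z.2 z) =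
      - \int[phase_measure d]_(z in phase Om) (g z * xi z)].

(* determined up to a null set; 0 if v has no weak derivative in L^2(D) *)
Definition streaming v : E * E -> R := xget (cst 0) [set g | weak_streaming v g].

Definition ip u v : R := \int[phase_measure d]_(z in phase Om) (u z * v z).

Variables (sigma_s sigma_t : E -> R) (theta : R -> R).
Variables (q qb : E * E -> R).

Definition scatter v : E * E -> R := fun z =>
  sigma_s z.1 *
  \int[@sphere_measure R d]_(s' in @sphere R d) (theta (dot z.2 s') * v (z.1, s')).

(* The even parts of discrete functions are continuous in r up to the boundary,
   so that their traces are restrictions. *)
Definition form_t u v : R :=
  ip (streaming (even_part u)) (odd_part v)
  - ip (odd_part u) (streaming (even_part v))
  + ip (fun z => sigma_t z.1 * u z) v
  + \int[phase_surface d]_(z in phase_boundary Om)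
      (`|dot z.2 (n z.1)| * (even_part u z * even_part v z)).

Definition form_s u v : R := ip (scatter u) v.

Definition form_l v : R :=
  ip q v - 2 * \int[phase_surface d]_(z in inflow Om n)
                 (dot z.2 (n z.1) * qb z * even_part v z).

Definition norm_t v : R :=
  Num.sqrt (\int[phase_measure d]_(z in phase Om)
              (Num.sqrt (sigma_t z.1) * v z) ^+ 2).

Definition Linfty_norm (f : E -> R) : \bar R :=
  Lnorm (lebesgue_rV d) +oo%E (fun r => (f r * \1_Om r)%:E).

Definition scattering_ratio : R :=
  fine (Linfty_norm (fun r => sigma_s r / sigma_t r)).

Definition optical_data (sigma_a : E -> R) : Prop :=
  [/\ measurable_fun Om sigma_s /\ measurable_fun Om sigma_t,
    {ae lebesgue_rV d, forall r, Om r -> 0 < sigma_s r /\ 0 < sigma_t r},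
    (Linfty_norm sigma_s < +oo)%E /\ (Linfty_norm sigma_t < +oo)%E,
    (forall r, Om r -> sigma_t r = sigma_a r + sigma_s r) &
    exists2 c0 : R, 0 < c0 &
      {ae lebesgue_rV d, forall r, Om r -> c0 <= sigma_a r}].

Definition phase_function : Prop :=
  [/\ measurable_fun (`[-1, 1] : set R) theta,
    forall x, -1 <= x <= 1 -> 0 <= theta x &
    {ae @sphere_measure R d, forall s, sphere s ->
      (\int[@sphere_measure R d]_(s' in @sphere R d) (theta (dot s s'))%:E
       = 1)%E}].

Definition sources : Prop :=
  square_integrable (phase_measure d) (phase Om) (cst 1) q /\
  square_integrable (phase_surface d) (inflow Om n : set (surface_type d * E))
    (fun z => `|dot z.2 (n z.1)|) qb.

(* w = u: Galerkin problem; w the previous iterate: half-step problem. *)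
Definition solves (Wh : set (E * E -> R)) u w : Prop :=
  Wh u /\ forall v, Wh v -> form_t u v = form_s w v + form_l v.

Definition residual_operator (Wh : set (E * E -> R))
    (Rh : (E * E -> R) -> (E * E -> R)) : Prop :=
  forall w, Wh w -> Wh (Rh w) /\
    forall v, Wh v -> form_t (Rh w) v = form_l v - form_t w v + form_s w v.

End transport.

Section discretization.
Context {R : realType} (d : nat).
Notation E := 'rV[R]_d.

Definition diam (A : set E) : R := fine (ediam A).

(* The vertices of the simplex are the rows of V; J selects those of the face. *)
Definition simplex_face (V : 'M[R]_(d.+1, d)) (J : {set 'I_d.+1}) : set E :=
  [set x | exists l : 'rV[R]_d.+1, [/\ forall i, 0 <= l ord0 i,
    forall i, i \notin J -> l ord0 i = 0, \sum_i l ord0 i = 1 & x = l *m V]].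

(* Geodesic simplex: the sphere intersected with the cone over the rows of V. *)
Definition spherical_face (V : 'M[R]_d) (J : {set 'I_d}) : set E :=
  [set x | sphere x /\ exists l : 'rV[R]_d, [/\ forall i, 0 <= l ord0 i,
    forall i, i \notin J -> l ord0 i = 0 & x = l *m V]].

Definition simplex (V : 'M[R]_(d.+1, d)) := simplex_face V [set: 'I_d.+1]%SET.
Definition spherical_simplex (V : 'M[R]_d) := spherical_face V [set: 'I_d]%SET.

(* The first two conditions are quasi-uniformity, the third (a ball of X of
   radius diam / kappa fits in each element) is shape regularity. *)
Definition regular_mesh (X : set E) (kappa h : R) N (K : 'I_N -> set E) : Prop :=
  forall i, [/\ diam (K i) <= h, h <= kappa * diam (K i) &
    exists2 c, X c & forall x, X x ->
      enorm (x - c) <= diam (K i) / kappa -> K i x].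

Definition space_mesh (Om : set E) (kappa h : R) N
    (T : 'I_N -> 'M[R]_(d.+1, d)) : Prop :=
  [/\ forall i, row_free (row_mx (T i) (const_mx 1 : 'cV_d.+1)),
    closure Om = \bigcup_(i in [set: 'I_N]) simplex (T i),
    forall i j, simplex (T i) = simplex (T j) -> i = j,
    forall i j, exists J J', simplex (T i) `&` simplex (T j) = simplex_face (T i) J
      /\ simplex_face (T i) J = simplex_face (T j) J' &
    regular_mesh setT kappa h (fun i => simplex (T i))].

Definition sphere_mesh (kappa h : R) N (T : 'I_N -> 'M[R]_d) : Prop :=
  [/\ forall i, row_free (T i),
    @sphere R d = \bigcup_(i in [set: 'I_N]) spherical_simplex (T i),
    forall i j, spherical_simplex (T i) = spherical_simplex (T j) -> i = j,
    forall i j, exists J J',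
      spherical_simplex (T i) `&` spherical_simplex (T j) = spherical_face (T i) J
      /\ spherical_face (T i) J = spherical_face (T j) J' &
    regular_mesh (@sphere R d) kappa h (fun i => spherical_simplex (T i))].

Definition symmetric_mesh N (T : 'I_N -> 'M[R]_d) : Prop :=
  forall i, exists j, spherical_simplex (T j) = -%R @` spherical_simplex (T i).

(* Elements are closed and overlap on null sets, where the contributions add up;
   this fixes one representative of each a.e.-class. *)
Definition piecewise_constant N (K : 'I_N -> set E) : set (E -> R) :=
  [set f | exists c : 'I_N -> R, forall x, f x = \sum_i c i * \1_(K i) x].

(* affine in the ambient coordinates on each element, so that s_i c(s) is
   piecewise linear for c piecewise constant *)
Definition piecewise_linear N (K : 'I_N -> set E) : set (E -> R) :=
  [set f | exists (a : 'I_N -> E) (b : 'I_N -> R),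
     forall x, f x = \sum_i (dot (a i) x + b i) * \1_(K i) x].

Definition S_plus N (T : 'I_N -> 'M[R]_d) : set (E -> R) :=
  [set f | piecewise_constant (fun i => spherical_simplex (T i)) f /\
           forall s, f (- s) = f s].

Definition S_minus N (T : 'I_N -> 'M[R]_d) : set (E -> R) :=
  [set f | piecewise_linear (fun i => spherical_simplex (T i)) f /\
           forall s, f (- s) = - f s].

(* Functions on closure Om, extended by 0. *)
Definition X_plus (Om : set E) N (T : 'I_N -> 'M[R]_(d.+1, d)) : set (E -> R) :=
  [set f | [/\ {within closure Om, continuous f},
    forall i, exists (a : E) (b : R), forall x, simplex (T i) x -> f x = dot a x + b
    & forall x, ~ closure Om x -> f x = 0]].

Definition X_minus N (T : 'I_N -> 'M[R]_(d.+1, d)) : set (E -> R) :=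
  piecewise_constant (fun i => simplex (T i)).

Definition tensor (S X : set (E -> R)) : set (E * E -> R) :=
  [set w | exists m (f g : 'I_m -> E -> R),
    (forall j, S (f j) /\ X (g j)) /\
    forall z, w z = \sum_j f j z.2 * g j z.1].

Definition W_h (Om : set E) NR (TR : 'I_NR -> 'M[R]_(d.+1, d))
    NS (TS : 'I_NS -> 'M[R]_d) : set (E * E -> R) :=
  [set w | exists wp wm, [/\ tensor (S_plus TS) (X_plus Om TR) wp,
    tensor (S_minus TS) (X_minus TR) wm & w = wp \+ wm]].

Definition linear_subspace (W U : set (E * E -> R)) : Prop :=
  [/\ U `<=` W, U (cst 0) &
    forall (a : R) u v, U u -> U v -> U (fun z => a * u z + v z)].

End discretization.

(* Main.v *)
(** The form [t] is coercive, [|w|^2 <= t(w, w)] for the weighted norm, since its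
    streaming terms cancel on the diagonal; the scattering form satisfies
    [s(v, w) <= (rho^2 |v|^2 + |w|^2) / 2], by Jensen's inequality, Tonelli and the
    symmetry of the phase function. Hence [t(u, .) = s(w, .)] implies
    [|u| <= rho |w|]. Up to a function of norm zero, the half step is
    [u_half - u k = Rh (u k)], and [t(Rh u_half, .) = s(u_half - u k, .)], which gives
    the decay of the residuals (the zero correction is admissible). The error
    [e = uh - u k] satisfies [t(e - Rh (u k), .) = s(e, .)], so
    [(1 - rho) |e| <= |Rh (u k)|].

    This uses that [t] is additive in its first argument, although the streaming
    derivative is only a chosen weak derivative. For a continuous piecewise affine
    function the piecewise gradient is a weak derivative: the integral of a
    difference quotient along the flow [(r, s) |-> (r + h s, s)] vanishes, the
    quotients are uniformly bounded, and one passes to the limit. Two weak derivatives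
    agree when tested against the discrete odd functions, which are limits of test
    functions. The boundary integral is additive because Borel sets are measurable
    for the Hausdorff measure and the boundary, contained in finitely many faces of
    simplices, has finite measure. *)

From HB Require Import structures.
Require Import Defs.
From mathcomp Require Import all_boot all_order all_algebra.
From mathcomp Require Import all_classical all_reals all_analysis.
From mathcomp Require Import measurable_realfun ess_sup_inf.
From mathcomp Require Import ring lra.
Import Order.TTheory GRing.Theory Num.Def Num.Theory numFieldNormedType.Exports.

Set Implicit Arguments.
Unset Strict Implicit.
Unset Printing Implicit Defensive.
Local Open Scope classical_set_scope.
Local Open Scope ring_scope.

(** * Lebesgue measure on row vectors *)

Section lebesgue_rV_theory.
Context {R : realType}.
Local Open Scope ereal_scope.

(** The obstacle is that functions are pointwise representatives and that [streaming] is a choice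
    among weak derivatives, with default 0. The values chosen for [u], [v] and [u - v] are related
    only through integrals against test functions, so the additivity of [t] is proved on the
    discrete space, where the derivative of an even part is paired only with an odd part. Existence
    of a weak derivative has to be shown for the discrete even functions, since otherwise the form
    would silently use the default.

    Closed cells overlap on faces, and the mesh is only known to cover [closure Om]. Hence the
    recurring null sets of faces, and the need for [Om] to be the interior of its closure.

    Real integrals are additive only for integrable functions, so each term of the forms needs a
    bound: everywhere for discrete functions, almost everywhere for coefficients, angular averages
    and the normal flux.

    The bound on [s] is a Young inequality: coercivity absorbs half of the weighted norm, which
    leaves exactly the factor [rho]. *)

Definition cube n (r : R) : set 'rV[R]_n :=
  [set x | forall i, (`|x ord0 i| <= r)%R].
Arguments cube : clear implicits.

Lemma measurable_cube n r : measurable (cube n r).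
Proof.
rewrite (_ : cube n r = \bigcap_(i in [set: 'I_n])
  ((fun x : 'rV[R]_n => x ord0 i) @^-1` `[(- r)%R, r]%classic)).
  apply: fin_bigcap_measurable => // i _.
  by rewrite -[X in measurable X]setTI; exact: measurable_coord.
apply/seteqP; split=> x /= h i; first by move=> _; rewrite /= in_itv/= -ler_norml.
by have := h i Logic.I; rewrite /= in_itv/= -ler_norml.
Qed.

Lemma lebesgue_cube n r : lebesgue_rV n (cube n r) < +oo.
Proof.
elim: n => [|n ih] /=; first by rewrite diracE ltry.
rewrite /image_measure /pushforward.
apply: (@le_lt_trans _ _
  ((lebesgue_rV n \x lebesgue_measure)%E (cube n r `*` `[(- r)%R, r]%classic))).
  apply: le_measure; rewrite ?inE.
  - rewrite -[X in measurable X]setTI.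
    by apply: measurable_rV_snoc => //; exact: measurable_cube.
  - by apply: measurableX; [exact: measurable_cube|exact: measurable_itv].
  - move=> [x t] /= h; split => [i|] /=.
      by have := h (lift ord_max i); rewrite mxE liftK.
    by have := h ord_max; rewrite mxE unlift_none/= in_itv/= -ler_norml.
rewrite product_measure1E//; last exact: measurable_cube.
have h : lebesgue_measure `[(- r)%R, r]%classic < +oo.
  by rewrite lebesgue_measure_itv/=; case: ifP => // _; rewrite -EFinB ltry.
by rewrite lte_mul_pinfty// ge0_fin_numE.
Qed.

(** A head constant on which the sigma-finite structure, required by Tonelli, can be declared;
    [lebesgue_rV n] is a recursively computed bundle. *)
Definition leb n : set 'rV[R]_n -> \bar R := lebesgue_rV n.

HB.instance Definition _ n := Measure.on (@leb n).

Lemma bigcup_cube n : [set: 'rV[R]_n] = \bigcup_k (cube n k%:R).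
Proof.
apply/seteqP; split=> // x _; exists (truncn (\sum_i `|x ord0 i|)%R).+1 => //= i.
apply: le_trans (ltW (truncnS_gt _)).
by rewrite (bigD1 i)//= lerDl; apply: sumr_ge0 => j _.
Qed.

Lemma leb_sigma_finite n : sigma_finite setT (@leb n).
Proof.
exists (fun k => cube n k%:R); first exact: bigcup_cube.
by move=> k; split; [exact: measurable_cube|exact: lebesgue_cube].
Qed.

HB.instance Definition _ n :=
  @Measure_isSigmaFinite.Build _ _ R (@leb n) (@leb_sigma_finite n).

Lemma integral_lebS n (f : 'rV[R]_n.+1 -> \bar R) :
  measurable_fun setT f -> (forall x, 0 <= f x) ->
  \int[@leb n.+1]_x f x =
  \int[@leb n]_x \int[@lebesgue_measure R]_t f (rV_snoc (x, t)).
Proof.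
move=> mf f0.
transitivity (\int[pushforward (@leb n \x @lebesgue_measure R) (@rV_snoc R n)]_x f x) => //.
rewrite ge0_integral_pushforward//.
  rewrite preimage_setT fubini_tonelli1//.
    by apply: (measurableT_comp mf); exact: measurable_rV_snoc.
  by move=> z; exact: f0.
exact: measurable_rV_snoc.
Qed.

(** The translated measure agrees with Lebesgue measure on half-open intervals, and these determine
    it. *)
Lemma lebesgue_measure_shift (t : R) (A : set R) : measurable A ->
  lebesgue_measure ((fun x => x + t)%R @^-1` A) = lebesgue_measure A.
Proof.
move=> mA.
have mt : measurable_fun [set: R] (fun x => x + t)%R.
  by apply: measurable_funD; [exact: measurable_id|exact: measurable_cst].
have H : forall X : set (measurableTypeR R), ocitv X ->
    lebesgue_measure X = image_measure (@lebesgue_measure R)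
      (mt : measurable_fun [set: measurableTypeR R]
        (fun x : measurableTypeR R => (x + t)%R : measurableTypeR R)) X.
  move=> X [[a b] /= ab <-].
  rewrite /image_measure /pushforward.
  rewrite (_ : _ @^-1` _ = `](a - t)%R, (b - t)%R]%classic); last first.
    by apply/seteqP; split=> x /=; rewrite !in_itv/= ltrBlDr lerBrDr.
  by rewrite !lebesgue_measure_itv/= !lte_fin ltrD2r -!EFinB opprB addrA subrK.
by apply/esym; exact: (lebesgue_measure_unique H mA).
Qed.

Lemma integral_lebesgue_shift (t : R) (f : R -> \bar R) :
  measurable_fun setT f -> (forall x, 0 <= f x) ->
  \int[@lebesgue_measure R]_x f (x + t)%R = \int[@lebesgue_measure R]_x f x.
Proof.
move=> mf f0.
have mt : measurable_fun [set: R] (fun x => x + t)%R.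
  by apply: measurable_funD; [exact: measurable_id|exact: measurable_cst].
transitivity (\int[pushforward (@lebesgue_measure R)
  (fun x : measurableTypeR R => (x + t)%R : measurableTypeR R)]_x f x).
  by rewrite ge0_integral_pushforward.
apply: eq_measure_integral => A mA _.
exact: lebesgue_measure_shift.
Qed.

Lemma measurable_rV_shift n (v : 'rV[R]_n) :
  measurable_fun [set: 'rV[R]_n] (fun x => x + v)%R.
Proof.
apply: measurable_fun_coordP => i.
rewrite (_ : (fun _ => _) = (fun t : 'rV[R]_n => t ord0 i + v ord0 i)%R).
  by apply: measurable_funD => //; exact: measurable_coord.
by apply/funext => x; rewrite mxE.
Qed.

Lemma rV_snocE n (v : 'rV[R]_n.+1) :
  v = rV_snoc (\row_j v ord0 (lift ord_max j), v ord0 ord_max).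
Proof.
apply/rowP => i; rewrite mxE; case: (unliftP ord_max i) => [j ->|->] /=.
  by rewrite mxE.
by [].
Qed.

Lemma rV_snocD n (x y : 'rV[R]_n) (s t : R) :
  rV_snoc ((x + y)%R, (s + t)%R) = (rV_snoc (x, s) + rV_snoc (y, t))%R.
Proof.
apply/rowP => i; rewrite !mxE; case: (unliftP ord_max i) => [j _|_] /=.
  by rewrite mxE.
by [].
Qed.

(** Induction on the dimension: the inner integral absorbs the last coordinate of [v], the induction
    hypothesis the others. *)
Lemma integral_leb_shift n (v : 'rV[R]_n) (f : 'rV[R]_n -> \bar R) :
  measurable_fun setT f -> (forall x, 0 <= f x) ->
  \int[@leb n]_x f (x + v)%R = \int[@leb n]_x f x.
Proof.
elim: n v f => [|n ih] v f mf f0.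
  by apply: eq_integral => x _; congr f; apply/rowP; case.
rewrite integral_lebS//; last first.
  by apply: (measurableT_comp mf); exact: measurable_rV_shift.
rewrite integral_lebS// (rV_snocE v).
set w := (\row_j _)%R; set t := v _ _.
have mfs : measurable_fun setT (f \o @rV_snoc R n).
  by apply: (measurableT_comp mf); exact: measurable_rV_snoc.
rewrite -[RHS](ih w); first 1 last.
- have h0 z : 0 <= (f \o @rV_snoc R n) z by exact: f0.
  exact: (measurable_fun_fubini_tonelli_F (m2 := @lebesgue_measure R) _ mfs h0).
- by move=> x; apply: integral_ge0.
apply: eq_integral => x _.
rewrite -(integral_lebesgue_shift t (f := fun s => f (rV_snoc ((x + w)%R, s)))).
- by apply: eq_integral => s _; rewrite rV_snocD.
- exact: (measurableT_comp mfs (measurable_pair1 _)).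
- by [].
Qed.

Lemma measurable_dotl n (a : 'rV[R]_n) :
  measurable_fun [set: 'rV[R]_n] (fun x => dot a x).
Proof.
apply: measurable_sum => i.
by apply: measurable_funM => //; exact: measurable_coord.
Qed.

Lemma measurable_affine n (a : 'rV[R]_n) (b : R) :
  measurable_fun [set: 'rV[R]_n] (fun x => dot a x + b)%R.
Proof.
apply: measurable_funD; [exact: measurable_dotl|exact: measurable_cst].
Qed.

Lemma dot_snoc n (a : 'rV[R]_n.+1) (x : 'rV[R]_n) (t : R) :
  dot a (rV_snoc (x, t)) =
  (dot (\row_j a ord0 (lift ord_max j)) x + a ord0 ord_max * t)%R.
Proof.
rewrite /dot big_ord_recr /=; congr (_ + _)%R.
  apply: eq_bigr => i _; rewrite !mxE.
  rewrite (_ : widen_ord _ i = lift ord_max i); first by rewrite liftK.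
  by apply/val_inj; rewrite /= /bump leqNgt ltn_ord.
by rewrite mxE unlift_none.
Qed.

(** If the last coefficient is nonzero, each line in the last direction meets the hyperplane in one
    point. Otherwise the set is a cylinder over a hyperplane of one dimension less. *)
Lemma leb_hyperplane n (a : 'rV[R]_n) (b : R) : a != 0%R ->
  leb [set x | dot a x + b = 0]%R = 0.
Proof.
elim: n a b => [|n ih] a b a0.
  by case/eqP: a0; apply/rowP; case.
set H := [set x | _].
have mH : measurable H.
  rewrite (_ : H = (fun x => dot a x + b)%R @^-1` [set 0%R]); last by [].
  by rewrite -[X in measurable X]setTI; exact: measurable_affine.
have -> : leb H = \int[@leb n.+1]_x (\1_H x)%:E by rewrite integral_indic// setIT.
rewrite integral_lebS//; last 1 first.
  by apply/measurable_EFinP; exact: measurable_indic.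
have [an0|an0] := eqVneq (a ord0 ord_max) 0%R; last first.
  apply: integral0_eq => x _.
  rewrite (_ : (fun _ => _) = (fun t => (\1_[set
    - (dot (\row_j a ord0 (lift ord_max j)) x + b) / a ord0 ord_max]%R t)%:E)).
    by rewrite integral_indic//= setIT lebesgue_measure_set1.
  apply/funext => t; congr (_%:E); rewrite !indicE; congr ((nat_of_bool _)%:R).
  apply/idP/idP; rewrite !inE /H/= dot_snoc.
    move=> h; apply: (mulIf an0); rewrite mulfVK//.
    by move/eqP: h; rewrite addrAC addr_eq0 => /eqP ->; rewrite opprK mulrC.
  by move=> ->; rewrite mulrC mulfVK// addrAC subrr.
have a'0 : (\row_j a ord0 (lift ord_max j) != 0 :> 'rV[R]_n)%R.
  apply: contraNneq a0 => h; apply/eqP/rowP => i; rewrite mxE.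
  case: (unliftP ord_max i) => [j ->|->] //.
  by move/rowP: h => /(_ j); rewrite !mxE.
have := ih _ b a'0; set H' := [set x | _] => lH'.
have mH' : measurable H'.
  rewrite (_ : H' = (fun x => dot (\row_j a ord0 (lift ord_max j)) x + b)%R @^-1` [set 0%R]); last by [].
  by rewrite -[X in measurable X]setTI; exact: measurable_affine.
(* The section is a whole line over [H'] and empty elsewhere; its infinite length is harmless since
   [0 * +oo = 0]. *)
rewrite (eq_integral (fun x => (\1_H' x)%:E * +oo)); last first.
  move=> x _; rewrite (eq_integral (fun=> (\1_H' x)%:E)); last first.
    move=> t _; rewrite !indicE; congr ((nat_of_bool _)%:R%:E).
    by apply/idP/idP; rewrite !inE /H /H' /= dot_snoc an0 mul0r addr0.
  by rewrite integral_cst//= -set_itvNyy lebesgue_measure_itv.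
rewrite ge0_integralZr//.
- by rewrite integral_indic//= setIT [X in X * _]lH' mul0e.
- by apply/measurable_EFinP; exact: measurable_indic.
Qed.

End lebesgue_rV_theory.

(** * Euclidean norm and Borel sets of row vectors *)

Section borel_rV.
Context {R : realType} (d : nat).
Notation E := 'rV[R]_d.

Lemma dotC (x y : E) : dot x y = dot y x.
Proof. by apply: eq_bigr => i _; rewrite mulrC. Qed.

Lemma dotDl (x y z : E) : dot (x + y) z = dot x z + dot y z.
Proof. by rewrite /dot -big_split; apply: eq_bigr => i _ /=; rewrite mxE mulrDl. Qed.

Lemma dotZl (c : R) (x y : E) : dot (c *: x) y = c * dot x y.
Proof. by rewrite /dot mulr_sumr; apply: eq_bigr => i _ /=; rewrite mxE mulrA. Qed.

Lemma dotDr (x y z : E) : dot z (x + y) = dot z x + dot z y.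
Proof. by rewrite !(dotC z) dotDl. Qed.

Lemma dotZr (c : R) (x y : E) : dot x (c *: y) = c * dot x y.
Proof. by rewrite !(dotC x) dotZl. Qed.

Lemma dotNl (x y : E) : dot (- x) y = - dot x y.
Proof. by rewrite -scaleN1r dotZl mulN1r. Qed.

Lemma dotBr (x y z : E) : dot z (x - y) = dot z x - dot z y.
Proof. by rewrite dotDr -(scaleN1r y) dotZr mulN1r. Qed.

Lemma enorm_ge0 (x : E) : 0 <= enorm x.
Proof. exact: sqrtr_ge0. Qed.

Lemma sqr_enorm (x : E) : enorm x ^+ 2 = dot x x.
Proof. by rewrite sqr_sqrtr// dot_ge0. Qed.

Lemma CauchySchwarz_dot (x y : E) : `|dot x y| <= enorm x * enorm y.
Proof.
rewrite -(@ler_pXn2r _ 2)// ?nnegrE ?mulr_ge0 ?enorm_ge0//.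
rewrite real_normK ?num_real// exprMn !sqr_enorm.
have [y0|y0] := eqVneq (dot y y) 0.
  have yi i : y ord0 i = 0.
    move/eqP: y0; rewrite psumr_eq0; last by move=> j _; rewrite -expr2 sqr_ge0.
    move/allP => /(_ i); rewrite mem_index_enum => /(_ isT)/eqP.
    by move/eqP; rewrite mulf_eq0 orbb => /eqP.
  rewrite y0 mulr0 /dot big1 ?expr0n// => i _; by rewrite yi mulr0.
(* The squared length of this vector is [y.y] times [(x.x)(y.y) - (x.y)^2]. *)
have := dot_ge0 (dot y y *: x - dot x y *: y).
rewrite -scaleNr !(dotDl, dotDr) !(dotZl, dotZr) (dotC y x).
have y1 : 0 < dot y y by rewrite lt_neqAle eq_sym y0 dot_ge0.
move=> h; rewrite -subr_ge0 -(pmulr_rge0 _ y1).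
by apply: le_trans h _; rewrite le_eqVlt; apply/orP; left; apply/eqP; ring.
Qed.

Lemma ler_coord_enorm (x : E) i : `|x ord0 i| <= enorm x.
Proof.
rewrite -(@ler_pXn2r _ 2)// ?nnegrE ?enorm_ge0//.
rewrite real_normK ?num_real// sqr_enorm /dot (bigD1 i)//= -expr2 lerDl.
by apply: sumr_ge0 => j _; rewrite -expr2 sqr_ge0.
Qed.

Lemma enorm_le (x : E) (c : R) : (forall i, `|x ord0 i| <= c) ->
  enorm x <= d%:R * c.
Proof.
case: (posnP d) => [d0 _|d0 xc].
  rewrite [in leRHS]d0 mul0r /enorm /dot big1 ?sqrtr0// => i _.
  by exfalso; case: i => i; rewrite d0.
have c0 : 0 <= c by apply: le_trans (xc (Ordinal d0)).
rewrite -(@ler_pXn2r _ 2)// ?nnegrE ?enorm_ge0 ?mulr_ge0//.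
rewrite sqr_enorm exprMn /dot.
apply: (@le_trans _ _ (\sum_(i < d) c ^+ 2)).
  apply: ler_sum => i _; rewrite -expr2 -(real_normK (num_real _)).
  by rewrite ler_pXn2r// ?nnegrE.
rewrite sumr_const card_ord -[leLHS]mulr_natl ler_wpM2r ?sqr_ge0//.
by rewrite expr2 ler_peMr// ler1n.
Qed.

Lemma enormN (x : E) : enorm (- x) = enorm x.
Proof. by rewrite /enorm dotNl dotC dotNl opprK. Qed.

Lemma enormZ (c : R) (x : E) : enorm (c *: x) = `|c| * enorm x.
Proof.
by rewrite /enorm dotZl dotZr mulrA -expr2 sqrtrM ?sqr_ge0// sqrtr_sqr.
Qed.

Lemma measurable_sphere : measurable (@sphere R d).
Proof.
rewrite (_ : @sphere R d = @enorm R d @^-1` [set 1])//.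
by rewrite -[X in measurable X]setTI; exact: measurable_enorm.
Qed.

Lemma dot_sphere (x y : E) : sphere x -> sphere y -> -1 <= dot x y <= 1.
Proof.
move=> sx sy; rewrite -ler_norml; apply: le_trans (CauchySchwarz_dot _ _) _.
by rewrite sx sy mulr1.
Qed.

(** Half-open grid cubes of side [1/(k+1)]: a countable family, measurable by its coordinates, which
    links the topology to a sigma-algebra generated by coordinates. *)
Definition cell (k : nat) (p : 'rV[int]_d) : set E :=
  [set x | forall i, Num.floor (k.+1%:R * x ord0 i) = p ord0 i].

Lemma measurable_cell k p : measurable (cell k p).
Proof.
rewrite (_ : cell k p = \bigcap_(i in [set: 'I_d])
  ((fun x : E => k.+1%:R * x ord0 i) @^-1`
     `[(p ord0 i)%:~R, (p ord0 i + 1)%:~R[%classic)).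
  apply: fin_bigcap_measurable => // i _.
  rewrite -[X in measurable X]setTI; apply: measurable_funM => //.
  exact: measurable_coord.
apply/seteqP; split=> x /= h i.
  by move=> _ /=; rewrite in_itv/= -floor_eq; exact/eqP.
by have := h i Logic.I; rewrite /= in_itv/= -floor_eq => /eqP.
Qed.

Lemma cell_dist k p x y i : cell k p x -> cell k p y ->
  `|x ord0 i - y ord0 i| < k.+1%:R^-1.
Proof.
move=> /(_ i) /eqP + /(_ i) /eqP; rewrite !floor_eq => /andP[x1 x2] /andP[y1 y2].
rewrite -(ltr_pM2l (ltr0Sn R k)) mulfV ?pnatr_eq0//.
rewrite -{1}(normr_nat _ k.+1) -normrM ltr_norml mulrBr.
move: x1 x2 y1 y2; rewrite intrD; set a := _ * _; set b := _ * _; set c := _%:~R.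
by move=> *; apply/andP; split; lra.
Qed.

(** An open set is the union of the countably many products of grid cubes that it contains. *)
Lemma measurable_open_rV2 (U : set (E * E)) : open U -> measurable U.
Proof.
move=> oU.
pose P (t : nat * ('rV[int]_d * 'rV[int]_d)) :=
  cell t.1 t.2.1 `*` cell t.1 t.2.2.
rewrite (_ : U = \bigcup_(t : nat * ('rV[int]_d * 'rV[int]_d))
    if `[< P t `<=` U >] then P t else set0).
  apply: countable_bigcupT_measurable; first exact: countableP.
  move=> t; case: ifP => // _; apply: measurableX; exact: measurable_cell.
apply/seteqP; split=> [z Uz|z [t _]]; last by case: asboolP => // h /h.
have := oU; rewrite openE => /(_ z Uz) /nbhs_ballP[e /= e0 he].
have [k ke] : exists k : nat, k.+1%:R^-1 < e.
  exists (truncn e^-1); rewrite invf_plt ?posrE//; exact: truncnS_gt.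
pose p (x : E) : 'rV[int]_d := \row_i Num.floor (k.+1%:R * x ord0 i).
have cp x : cell k (p x) x by move=> i; rewrite mxE.
exists (k, (p z.1, p z.2)) => //; case: asboolP => [_|[]]; first by split; exact: cp.
move=> [x y] [/= xz yz]; apply: he; split; split=> // i j;
  rewrite !ord1; apply: lt_trans ke.
- exact: (cell_dist j (cp z.1) xz).
- exact: (cell_dist j (cp z.2) yz).
Qed.

Lemma measurable_continuous_rV2 (f : E * E -> R) :
  continuous f -> measurable_fun setT f.
Proof.
move=> /continuousP cf; apply: (measurability _ (RGenOInfty.measurableE R)).
move=> _ [_ [a ->] <-]; rewrite setTI; apply: measurable_open_rV2.
apply: cf; exact: interval_open.
Qed.

Lemma measurable_open_rV (U : set E) : open U -> measurable U.
Proof.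
move=> oU.
rewrite (_ : U = (fun x : E => (x, 0 : E)) @^-1` (fst @^-1` U)); last by [].
rewrite -[X in measurable X]setTI; apply: measurable_pair2 => //.
apply: measurable_open_rV2; apply: open_comp => // z _; exact: cvg_fst.
Qed.

End borel_rV.

(** * Integration over phase space *)

Section phase_measure_theory.
Context {R : realType} (d : nat).
Notation E := 'rV[R]_d.
Notation mu := (@phase_measure R d).
Notation sm := (@sphere_measure R d).
Local Open Scope ereal_scope.

Lemma tonelli_phase1 (f : E * E -> \bar R) :
  measurable_fun setT f -> (forall x, 0 <= f x) ->
  \int[mu]_z f z = \int[@leb R d]_r \int[sm]_s f (r, s).
Proof. by move=> mf f0; rewrite -(fubini_tonelli1 (m1 := @leb R d) f). Qed.

Lemma tonelli_phase2 (f : E * E -> \bar R) :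
  measurable_fun setT f -> (forall x, 0 <= f x) ->
  \int[mu]_z f z = \int[sm]_s \int[@leb R d]_r f (r, s).
Proof. by move=> mf f0; rewrite -(fubini_tonelli2 (m1 := @leb R d) f). Qed.

Definition shear (h : R) (z : E * E) : E * E := (z.1 + h *: z.2, z.2)%R.

Lemma measurable_shear h : measurable_fun setT (shear h).
Proof.
apply/measurable_fun_pairP; split; last exact: measurable_snd.
apply: measurable_fun_coordP => i.
rewrite (_ : (fun _ => _) = (fun z : E * E => z.1 ord0 i + h * z.2 ord0 i)%R).
  apply: measurable_funD; last apply: measurable_funM => //.
    by apply: (measurableT_comp (measurable_coord i)); exact: measurable_fst.
  by apply: (measurableT_comp (measurable_coord i)); exact: measurable_snd.
by apply/funext => z; rewrite !mxE.
Qed.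

(** For a fixed direction the flow is a translation in space, so Tonelli with the space integral
    inside reduces the claim to translation invariance. *)
Lemma ge0_integral_shear h (f : E * E -> \bar R) :
  measurable_fun setT f -> (forall x, 0 <= f x) ->
  \int[mu]_z f (shear h z) = \int[mu]_z f z.
Proof.
move=> mf f0.
rewrite tonelli_phase2//; last exact: (measurableT_comp mf (measurable_shear h)).
rewrite tonelli_phase2//; apply: eq_integral => s _.
rewrite -[RHS](integral_leb_shift (h *: s)%R)//.
exact: (measurableT_comp mf (measurable_pair2 s)).
Qed.

Lemma integral_shear h (f : E * E -> \bar R) : measurable_fun setT f ->
  \int[mu]_z f (shear h z) = \int[mu]_z f z.
Proof.
move=> mf; rewrite integralE [RHS]integralE.
rewrite -(ge0_integral_shear h (measurable_funepos mf) (funepos_ge0 f)).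
rewrite -(ge0_integral_shear h (measurable_funeneg mf) (funeneg_ge0 f)).
by congr (_ - _); apply: eq_integral => z _; rewrite ?funeposE ?funenegE.
Qed.

Lemma phase_measureX (A B : set E) : measurable A -> measurable B ->
  mu (A `*` B) = leb A * sm B.
Proof. by move=> mA mB; exact: product_measure1E. Qed.

Lemma sphere_measure_lty (A : set E) : measurable A -> sm A < +oo.
Proof. by move=> mA; rewrite -ge0_fin_numE//; exact: fin_num_measure. Qed.

Lemma phase_measure_cube_lty r (B : set E) : measurable B ->
  mu (@cube R d r `*` B) < +oo.
Proof.
move=> mB; rewrite phase_measureX//; last exact: measurable_cube.
apply: lte_mul_pinfty => //; last exact: sphere_measure_lty.
by rewrite ge0_fin_numE//; exact: lebesgue_cube.
Qed.

Lemma phase_measure_fst0 (A : set E) : measurable A -> leb A = 0 ->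
  mu (fst @^-1` A) = 0.
Proof.
move=> mA A0; rewrite (_ : _ @^-1` _ = A `*` setT).
  by rewrite phase_measureX// A0 mul0e.
by apply/seteqP; split=> // z [].
Qed.

Lemma phase_ae_fst (P : E -> Prop) : {ae @lebesgue_rV R d, forall r, P r} ->
  {ae mu, forall z, P z.1}.
Proof.
move=> [A [mA A0 PA]]; exists (fst @^-1` A); split.
- by rewrite -[X in measurable X]setTI; exact: measurable_fst.
- exact: phase_measure_fst0.
- by move=> z /= /PA.
Qed.

End phase_measure_theory.

(** * Simplices and Lipschitz domains *)

Section affine.
Context {R : realType} (d : nat).
Notation E := 'rV[R]_d.

Lemma differentiable_affine (a : E) b x :
  differentiable (fun y : E => dot a y + b) x.
Proof.
apply: differentiableD; last exact: differentiable_cst.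
rewrite /dot.
rewrite (_ : (fun _ => _) = \sum_i (fun y : E => a ord0 i * y ord0 i)); last first.
  by apply/funext => y; rewrite fct_sumE.
apply: differentiable_sum => i.
by apply: differentiableM; [exact: differentiable_cst|exact: differentiable_coord].
Qed.

Lemma continuous_affine (a : E) b : continuous (fun y : E => dot a y + b).
Proof. by move=> x; exact/differentiable_continuous/differentiable_affine. Qed.

Lemma derive_affine (a : E) b x e : 'D_e (fun y : E => dot a y + b) x = dot a e.
Proof.
rewrite /derive; apply: cvg_lim => //.
apply: cvg_near_cst; near=> h.
rewrite /= dotDr dotZr (_ : _ - _ = h * dot a e); last by ring.
by rewrite /GRing.scale /= mulKf//; near: h; exact: nbhs_dnbhs_neq.
Unshelve. all: by end_near. Qed.

Lemma open_affine_gt0 (a : E) b : open [set x : E | 0 < dot a x + b].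
Proof.
have /continuousP/(_ [set y | 0 < y]) := @continuous_affine a b.
by apply; exact: open_gt.
Qed.

Lemma closed_affine_ge0 (a : E) b : closed [set x : E | 0 <= dot a x + b].
Proof.
have /continuous_closedP/(_ [set y | 0 <= y]) := @continuous_affine a b.
by apply; exact: closed_ge.
Qed.

(** Barycentric coordinates are affine: [row_mx V (const_mx 1)] is square of full rank, and its
    inverse maps [(x, 1)] to the coordinates of [x]. On a face, those outside [J] vanish. *)
Lemma simplex_halfspaces (V : 'M[R]_(d.+1, d)) : (0 < d)%N ->
  row_free (row_mx V (const_mx 1 : 'cV_d.+1)) ->
  exists (a : 'I_d.+1 -> E) (b : 'I_d.+1 -> R), [/\ forall i, a i != 0,
   simplex V = [set x | forall i, 0 <= dot (a i) x + b i] &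
   forall J, simplex_face V J = [set x | (forall i, 0 <= dot (a i) x + b i) /\
      forall i, i \notin J -> dot (a i) x + b i = 0]].
Proof.
move=> d0; set M := row_mx V _ => Mfree.
have Mfull : row_full M by rewrite /row_full (eqP Mfree) addn1.
pose P := pinvmx M.
pose a i : E := \row_j P (lshift 1 j) i.
pose b i : R := P (rshift d ord0) i.
have lamE x i : dot (a i) x + b i = (row_mx x (1%:M : 'M[R]_1) *m P) ord0 i.
  rewrite mxE big_split_ord /= big_ord1 row_mxEr mxE mul1r; congr (_ + _).
  by apply: eq_bigr => j _; rewrite row_mxEl mxE mulrC.
have mulM (l : 'rV_d.+1) : l *m M = row_mx (l *m V) ((\sum_i l ord0 i)%:M).
  rewrite mul_mx_row; congr row_mx; apply/matrixP => i j; rewrite !ord1 !mxE mulr1n.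
  by apply: eq_bigr => k _; rewrite mxE mulr1.
have lamV (l : 'rV[R]_d.+1) i : \sum_k l ord0 k = 1 -> dot (a i) (l *m V) + b i = l ord0 i.
  move=> l1; rewrite lamE (_ : row_mx _ _ = l *m M); first by rewrite mulmxKp.
  by rewrite mulM l1.
have lamK x : exists l : 'rV_d.+1, [/\ \sum_k l ord0 k = 1, x = l *m V &
     forall i, l ord0 i = dot (a i) x + b i].
  pose l := row_mx x (1%:M : 'M[R]_1) *m P.
  have lM : l *m M = row_mx x (1%:M : 'M[R]_1) by rewrite -mulmxA mulVpmx// mulmx1.
  move: (lM); rewrite mulM => /eq_row_mx[lx l1].
  exists l; split; [|by []|by move=> i; rewrite lamE].
  by move/matrixP: l1 => /(_ ord0 ord0); rewrite [LHS]mxE [RHS]mxE eqxx !mulr1n.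
have faceE J : simplex_face V J = [set x | (forall i, 0 <= dot (a i) x + b i) /\
      forall i, i \notin J -> dot (a i) x + b i = 0].
  apply/seteqP; split=> [x [l [l0 lJ l1 ->]]|x [x0 xJ]].
    by split=> i; [rewrite lamV|move=> iJ; rewrite lamV// lJ].
  have [l [l1 lx lE]] := lamK x.
  by exists l; split=> // i; rewrite lE//; exact: xJ.
exists a, b; split=> //.
(* A constant coordinate could not be 1 at its own vertex and 0 at another one; [0 < d] provides a
   second vertex. *)
- move=> i; apply/eqP => ai0.
  have dl k : \sum_j (delta_mx ord0 k : 'rV[R]_d.+1) ord0 j = 1.
    rewrite (bigD1 k)//= mxE !eqxx big1 ?addr0// => j jk.
    by rewrite mxE eqxx (negbTE jk).
  have bi k : b i = (k == i)%:R.
    have := lamV (delta_mx ord0 k) i (dl k); rewrite ai0 !mxE eqxx/=.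
    rewrite (_ : dot 0 _ = 0) ?add0r 1?eq_sym //.
    by rewrite /dot big1// => j _; rewrite mxE mul0r.
  have [k ki] : exists k : 'I_d.+1, k != i.
    case: (unliftP ord0 i) => [j ->|->].
      by exists ord0; rewrite neq_lift.
    by exists (lift ord0 (Ordinal d0)); rewrite eq_sym neq_lift.
  have := bi k; rewrite (bi i) eqxx (negbTE ki) => /eqP.
  by rewrite oner_eq0.
- rewrite /simplex faceE; apply/seteqP; split=> [x []//|x x0]; split=> // i.
  by rewrite inE.
Qed.

Lemma simplex_bounded (V : 'M[R]_(d.+1, d)) J :
  exists r, simplex_face V J `<=` @cube R d r.
Proof.
exists (\sum_i \sum_j `|V i j|) => x [l [l0 _ l1 ->]] j.
rewrite mxE; apply: le_trans (ler_norm_sum _ _ _) _.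
apply: ler_sum => i _.
rewrite normrM ger0_norm//.
have li : l ord0 i <= 1.
  by rewrite -l1 (bigD1 i)//= lerDl; apply: sumr_ge0.
apply: le_trans (ler_piMl _ li) _ => //.
by rewrite (bigD1 j)//= lerDl; apply: sumr_ge0.
Qed.

(** The coordinates in the basis of the rows of [V] are linear functionals, given by the columns of
    the inverse matrix. *)
Lemma spherical_halfspaces (V : 'M[R]_d) : row_free V ->
  exists c : 'I_d -> E, spherical_simplex V =
    [set x | sphere x /\ forall i, 0 <= dot (c i) x].
Proof.
rewrite row_free_unit => Vu.
exists (fun i => \row_j invmx V j i).
have cE x i : dot (\row_j invmx V j i) x = (x *m invmx V) ord0 i.
  by rewrite mxE; apply: eq_bigr => j _; rewrite mxE mulrC.
apply/seteqP; split=> x [sx].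
  by move=> [l [l0 _ xE]]; split=> // i; rewrite cE xE mulmxK.
move=> x0; split=> //; exists (x *m invmx V); split.
- by move=> i; rewrite -cE.
- by move=> i; rewrite inE.
- by rewrite mulmxKV.
Qed.

End affine.

Section lipschitz_domain.
Context {R : realType} (d : nat).
Notation E := 'rV[R]_d.

Lemma dot_self_sphere (e : E) : enorm e = 1 -> dot e e = 1.
Proof. by move=> e1; rewrite -sqr_enorm e1 expr1n. Qed.

Lemma enormD (x y : E) : enorm (x + y) <= enorm x + enorm y.
Proof.
rewrite -(@ler_pXn2r _ 2)// ?nnegrE ?addr_ge0 ?enorm_ge0//.
rewrite sqrrD !sqr_enorm dotDl !dotDr (dotC y x).
have := CauchySchwarz_dot x y; have := ler_norm (dot x y) => h1 h2.
by rewrite mulr2n; lra.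
Qed.

(* Just below a boundary point, in the direction of the local graph, one is
   outside of [closure Om]. *)
Lemma lipschitz_domain_regular (Om : set E) : lipschitz_domain Om ->
  interior (closure Om) `<=` Om.
Proof.
move=> [oOm _ _ HL] x Hx; apply: contrapT => nOx.
have clx : closure Om x by exact: interior_subset Hx.
have intE : interior Om = Om.
  apply/seteqP; split=> [|y Oy]; first exact: interior_subset.
  by move: oOm; rewrite openE; apply.
have bx : boundary Om x by split=> //; rewrite intE.
have [e [g [L [eps [e1 eps0 gL HO]]]]] := HL _ bx.
have enorm0 : enorm (x - x) = 0 :> R.
  by rewrite subrr /enorm /dot big1 ?sqrtr0// => i _; rewrite mxE mul0r.
have gx : dot x e <= g (x - dot x e *: e).
  by rewrite leNgt; apply/negP => /(HO x _).2; apply: contra_not nOx => //; apply;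
     rewrite enorm0.
pose y h : E := x - h *: e.
have [h [h0 heps cly]] : exists h : R, [/\ 0 < h, h < eps & closure Om (y h)].
  move: Hx; rewrite /interior => /nbhs_ballP[r /= r0 hr].
  have [mr me] : Num.min r eps <= r /\ Num.min r eps <= eps.
    by rewrite !ge_min !lexx orbT.
  have m0 : 0 < Num.min r eps by rewrite lt_min r0.
  exists (Num.min r eps / 2); split; [lra|lra|].
  apply: hr; split=> // i j; rewrite !ord1 /y !mxE.
  rewrite /ball /= opprB addrC subrK normrM gtr0_norm; last lra.
  apply: (@le_lt_trans _ _ (Num.min r eps / 2)); last lra.
  by rewrite ler_piMr; [|lra|rewrite -e1 ler_coord_enorm].
(* The point [y h] lies at least [h] below the graph. From [y h] to a nearby [z] the height grows by
   at most [|z - y h|] and the graph drops by at most [2 |L| |z - y h|]; the first width keeps the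
   total within [h], the second keeps [z] in the chart. The factor [d.+1] converts coordinate bounds
   to Euclidean ones. *)
move: cly => /(_ [set z | forall i,
  `|y h ord0 i - z ord0 i| < h / (d.+1%:R * (2 * `|L| + 2)) /\
  `|y h ord0 i - z ord0 i| < (eps - h) / d.+1%:R]).
set del := h / _; set del' := (eps - h) / _.
have L0 : 0 < 2 * `|L| + 2 :> R by rewrite ltr_wpDl// mulr_ge0.
have del0 : 0 < del by rewrite divr_gt0// mulr_gt0.
have del'0 : 0 < del' by rewrite divr_gt0// subr_gt0.
case.
  apply/nbhs_ballP; exists (Num.min del del'); first by rewrite /= lt_min del0.
  by move=> z [_ hz] i; have := hz ord0 i; rewrite /ball /= lt_min => /andP.
move=> z [Oz zy].
have zy1 : enorm (z - y h) <= d%:R * del.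
  apply: enorm_le => i; rewrite !mxE distrC.
  by have [/ltW + _] := zy i; rewrite !mxE.
have zy2 : enorm (z - y h) <= d%:R * del'.
  apply: enorm_le => i; rewrite !mxE distrC.
  by have [_ /ltW +] := zy i; rewrite !mxE.
have zx : enorm (z - x) < eps.
  rewrite (_ : z - x = (z - y h) + (- h) *: e); last first.
    by apply/rowP => i; rewrite !mxE; ring.
  apply: le_lt_trans (enormD _ _) _; rewrite enormZ e1 mulr1 normrN gtr0_norm//.
  rewrite -ltrBrDr; apply: le_lt_trans zy2 _.
  rewrite /del' mulrCA gtr_pMr ?subr_gt0// ltr_pdivrMr// mul1r.
  by rewrite ltr_nat.
have := (HO z zx).1 Oz; apply/negP; rewrite -leNgt.
have ye : dot (y h) e = dot x e - h.
  by rewrite /y -scaleNr dotDl dotZl dot_self_sphere// mulr1.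
have yp : y h - dot (y h) e *: e = x - dot x e *: e.
  by rewrite ye /y scalerBl opprB addrA subrK.
have := gL (y h - dot (y h) e *: e) (z - dot z e *: e).
rewrite yp => hL.
have h1 : enorm ((x - dot x e *: e) - (z - dot z e *: e)) <= 2 * enorm (z - y h).
  rewrite -yp.
  rewrite (_ : _ - _ = - (z - y h) + dot (z - y h) e *: e); last first.
    rewrite [dot (z - y h) e]dotC dotBr !(dotC e).
    by apply/rowP => i; rewrite !mxE; ring.
  apply: le_trans (enormD _ _) _; rewrite enormN enormZ e1 mulr1.
  rewrite mulrDl mul1r lerD2l.
  by apply: le_trans (CauchySchwarz_dot _ _) _; rewrite e1 mulr1.
have h2 : dot z e <= dot (y h) e + enorm (z - y h).
  rewrite -lerBlDl (dotC z) (dotC (y h)) -dotBr.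
  apply: le_trans (ler_norm _) _; apply: le_trans (CauchySchwarz_dot _ _) _.
  by rewrite e1 mul1r.
have h3 : (2 * `|L| + 1) * enorm (z - y h) <= h.
  apply: (@le_trans _ _ ((2 * `|L| + 2) * (d.+1%:R * del))).
    apply: ler_pM.
    - by rewrite addr_ge0// mulr_ge0.
    - exact: enorm_ge0.
    - by rewrite lerD2l ler1n.
    - apply: le_trans zy1 _; rewrite ler_wpM2r//; first exact: ltW.
      by rewrite ler_nat.
  have key (c l : R) : c != 0 -> l != 0 -> l * (c * (h / (c * l))) <= h.
    move=> c0 l0; rewrite le_eqVlt; apply/orP; left; apply/eqP; field.
    by rewrite c0 l0.
  by apply: key; rewrite ?pnatr_eq0// gt_eqF.
have h4 : g (x - dot x e *: e) - g (z - dot z e *: e) <= `|L| * (2 * enorm (z - y h)).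
  apply: le_trans (ler_norm _) _; apply: le_trans hL _.
  apply: (@le_trans _ _ (`|L| * enorm ((x - dot x e *: e) - (z - dot z e *: e)))).
    by rewrite ler_wpM2r ?enorm_ge0// ler_norm.
  by rewrite ler_wpM2l.
move: gx h2 h3 h4; rewrite ye.
set A := g _; set B := g _; set C := enorm _; set X := dot x e; set Z := dot z e.
set AL := `|L|; move=> *; nra.
Qed.

End lipschitz_domain.

(** * Bounded and square integrable functions *)

Section bounded_measurable.
Context {R : realType} d (T : measurableType d).
Implicit Types (D : set T) (f g : T -> R).

(** Integrability in a form stable under products. Discrete functions satisfy it on the whole space,
    since their angular factors vanish off the sphere. *)
Definition bdd_meas D f := measurable_fun D f /\
  exists M : R, forall x, D x -> `|f x| <= M.

Lemma bdd_meas_cst D c : bdd_meas D (cst c).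
Proof. by split; [exact: measurable_cst|exists `|c|]. Qed.

Lemma bdd_measD D f g : bdd_meas D f -> bdd_meas D g ->
  bdd_meas D (fun x => f x + g x).
Proof.
move=> [mf [M fM]] [mg [N gN]]; split; first exact: measurable_funD.
exists (M + N) => x Dx; apply: le_trans (ler_normD _ _) _.
by apply: lerD; [exact: fM|exact: gN].
Qed.

Lemma bdd_measM D f g : bdd_meas D f -> bdd_meas D g ->
  bdd_meas D (fun x => f x * g x).
Proof.
move=> [mf [M fM]] [mg [N gN]]; split; first exact: measurable_funM.
exists (M * N) => x Dx; rewrite normrM.
by apply: ler_pM => //; [exact: fM|exact: gN].
Qed.

Lemma bdd_measZ D c f : bdd_meas D f -> bdd_meas D (fun x => c * f x).
Proof. by move=> fb; apply: bdd_measM => //; exact: bdd_meas_cst. Qed.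

Lemma bdd_measB D f g : bdd_meas D f -> bdd_meas D g ->
  bdd_meas D (fun x => f x - g x).
Proof.
move=> fb gb; rewrite (_ : (fun _ => _) = (fun x => f x + (-1) * g x)).
  by apply: bdd_measD => //; exact: bdd_measZ.
by apply/funext => x; rewrite mulN1r.
Qed.

Lemma bdd_meas_sum D I (s : seq I) (F : I -> T -> R) :
  (forall i, bdd_meas D (F i)) -> bdd_meas D (fun x => \sum_(i <- s) F i x).
Proof.
move=> Fb; elim: s => [|i s ih].
  under eq_fun do rewrite big_nil; exact: bdd_meas_cst.
by under eq_fun do rewrite big_cons; exact: bdd_measD.
Qed.

Lemma bdd_meas_indic D A : measurable A -> bdd_meas D \1_A.
Proof.
move=> mA; split; first exact/measurable_funTS/measurable_indic.
by exists 1 => x _; rewrite ger0_norm indicE//; case: (_ \in _).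
Qed.

Lemma bdd_measS D D' f : measurable D' -> D `<=` D' -> bdd_meas D' f -> bdd_meas D f.
Proof.
move=> mD' DD' [mf [M fM]]; split; first exact: measurable_funS mf.
by exists M => x /DD'; exact: fM.
Qed.

Variable mu : {measure set T -> \bar R}.

Lemma bdd_meas_integrable D f : measurable D -> (mu D < +oo)%E ->
  bdd_meas D f -> mu.-integrable D (EFin \o f).
Proof.
move=> mD muD [mf [M fM]]; apply: measurable_bounded_integrable => //.
exists M; split; first exact: num_real.
by move=> N MN x Dx; apply: le_trans (fM x Dx) (ltW MN).
Qed.

Lemma integrable_bddM D f g : measurable D -> mu.-integrable D (EFin \o f) -> bdd_meas D g ->
  mu.-integrable D (EFin \o (fun x => f x * g x)).
Proof.
move=> mD fi [mg [M gM]]; rewrite (_ : EFin \o _ = (EFin \o f) \* (EFin \o g))%E//.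
apply: integrableMl => //.
exists M; split; first exact: num_real.
by move=> N MN x Dx; apply: le_trans (gM x Dx) (ltW MN).
Qed.

(** On a set of finite measure [1 + f^2] is integrable, and it dominates [|f|]. *)
Lemma L2_integrable D f : measurable D -> (mu D < +oo)%E ->
  measurable_fun D f -> (\int[mu]_(x in D) (f x ^+ 2)%:E < +oo)%E ->
  mu.-integrable D (EFin \o f).
Proof.
move=> mD muD mf f2.
have i2 : mu.-integrable D (EFin \o (fun x => f x ^+ 2)).
  apply/integrableP; split; first by apply/measurable_EFinP; exact: measurable_funX.
  apply: le_lt_trans f2; apply: ge0_le_integral => //.
  - by apply: measurableT_comp => //; apply/measurable_EFinP; exact: measurable_funX.
  - by apply/measurable_EFinP; exact: measurable_funX.
  - by move=> x _ /=; rewrite lee_fin ger0_norm// sqr_ge0.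
have i1 : mu.-integrable D (EFin \o cst (1 : R)).
  by apply: bdd_meas_integrable => //; exact: bdd_meas_cst.
apply: (le_integrable mD _ _ (integrableD mD i1 i2)).
  by apply/measurable_EFinP.
move=> x Dx /=; rewrite lee_fin.
have h : 0 <= (1 - `|f x|) ^+ 2 by exact: sqr_ge0.
rewrite [leRHS]ger0_norm ?addr_ge0 ?sqr_ge0// -(real_normK (num_real (f x))).
have := normr_ge0 (f x); move: h; set y := `|f x| => h y0; nra.
Qed.

Lemma L2D D f g : measurable D -> measurable_fun D f -> measurable_fun D g ->
  (\int[mu]_(x in D) (f x ^+ 2)%:E < +oo)%E ->
  (\int[mu]_(x in D) (g x ^+ 2)%:E < +oo)%E ->
  (\int[mu]_(x in D) ((f x + g x) ^+ 2)%:E < +oo)%E.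
Proof.
move=> mD mf mg f2 g2.
apply: (@le_lt_trans _ _ (\int[mu]_(x in D)
   ((2%:E * (f x ^+ 2)%:E) + (2%:E * (g x ^+ 2)%:E)))%E).
  apply: ge0_le_integral => //.
  - by move=> x _; rewrite lee_fin sqr_ge0.
  - by apply/measurable_EFinP; apply: measurable_funX; exact: measurable_funD.
  - by apply: emeasurable_funD; apply: measurable_funeM; apply/measurable_EFinP;
      exact: measurable_funX.
  - move=> x _; rewrite -!EFinM -EFinD lee_fin.
    have := sqr_ge0 (f x - g x); rewrite !expr2; nra.
rewrite ge0_integralD//; first last.
- by apply: measurable_funeM; apply/measurable_EFinP; exact: measurable_funX.
- by move=> x _; rewrite -EFinM lee_fin mulr_ge0// sqr_ge0.
- by apply: measurable_funeM; apply/measurable_EFinP; exact: measurable_funX.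
- by move=> x _; rewrite -EFinM lee_fin mulr_ge0// sqr_ge0.
rewrite !ge0_integralZl//; first last.
- by move=> x _; rewrite lee_fin sqr_ge0.
- by apply/measurable_EFinP; exact: measurable_funX.
- by move=> x _; rewrite lee_fin sqr_ge0.
- by apply/measurable_EFinP; exact: measurable_funX.
by apply: lte_add_pinfty; apply: lte_mul_pinfty.
Qed.

Lemma bdd_meas_L2 D f : measurable D -> (mu D < +oo)%E -> bdd_meas D f ->
  (\int[mu]_(x in D) (f x ^+ 2)%:E < +oo)%E.
Proof.
move=> mD muD fb; have := bdd_meas_integrable mD muD (bdd_measM fb fb).
move/integrableP => [_]; apply: le_lt_trans.
apply: ge0_le_integral => //.
- by move=> x _; rewrite lee_fin sqr_ge0.
- by apply/measurable_EFinP; apply: measurable_funX; case: fb.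
- apply: measurableT_comp => //; apply/measurable_EFinP.
  by apply: measurable_funM; case: fb.
- by move=> x _ /=; rewrite lee_fin expr2 ler_norm.
Qed.

End bounded_measurable.

Section local_lipschitz.
Context {R : realType}.

(** The set of points up to which the bound holds contains its supremum [c], and the local bound at
    [c] carries it beyond [c] unless [c = b]. It is meant for functions along a line that crosses
    faces, where differentiability fails. *)
Lemma lipschitz_of_local (phi : R -> R) (C a b : R) : a <= b ->
  (forall t, \forall h \near 0, `|phi (t + h) - phi t| <= C * `|h|) ->
  `|phi b - phi a| <= C * (b - a).
Proof.
move=> ab loc.
pose S := [set t | a <= t <= b /\ `|phi t - phi a| <= C * (t - a)].
have Sa : S a by split; rewrite ?lexx ?ab// !subrr normr0 mulr0.
have Sub : ubound S b by move=> t [/andP[]].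
have hS : has_sup S by split; [exists a|exists b].
pose c := sup S.
have ac : a <= c by apply: ub_le_sup => //; exists b.
have cb : c <= b by apply: ge_sup => //; exists a.
have /nbhs_ballP[e /= e0 he] := loc c.
have hE h : `|h| < e -> `|phi (c + h) - phi c| <= C * `|h|.
  by move=> ?; apply: he; rewrite /ball/= sub0r normrN.
have [t [/andP[a_t tb] St] ct] := sup_adherent e0 hS.
have tc : t <= c by apply: ub_le_sup; [exists b|split; rewrite ?a_t].
have Sc : `|phi c - phi a| <= C * (c - a).
  have := hE (t - c); rewrite ler0_norm ?subr_le0// opprB.
  rewrite -/c in ct; rewrite ltrBlDr -ltrBlDl ct => /(_ isT).
  rewrite [c + _]addrC subrK distrC => h1.
  rewrite (_ : phi c - phi a = (phi c - phi t) + (phi t - phi a)); last by ring.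
  by apply: le_trans (ler_normD _ _) _; lra.
have [cb'|bc] := ltP c b; last first.
  by have -> : b = c by apply/eqP; rewrite eq_le bc.
pose h := Num.min (b - c) (e / 2).
have [hb he'] : h <= b - c /\ h <= e / 2 by rewrite !ge_min !lexx orbT.
have h0 : 0 < h by rewrite lt_min subr_gt0 cb' divr_gt0.
have : S (c + h).
  split; first by apply/andP; split; lra.
  have := hE h; rewrite gtr0_norm// => /(_ ltac:(lra)) h1.
  rewrite (_ : phi (c + h) - phi a = (phi (c + h) - phi c) + (phi c - phi a)); last by ring.
  by apply: le_trans (ler_normD _ _) _; lra.
have hub : has_ubound S by exists b.
by move/(ub_le_sup hub); rewrite -/c gerDl leNgt h0.
Qed.

End local_lipschitz.

(** * Piecewise affine functions *)

Section polytope.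
Context {R : realType} (d : nat).
Notation E := 'rV[R]_d.

Definition poly m (a : 'I_m -> E) (b : 'I_m -> R) : set E :=
  [set x | forall j, 0 <= dot (a j) x + b j].

Definition ipoly m (a : 'I_m -> E) (b : 'I_m -> R) : set E :=
  [set x | forall j, 0 < dot (a j) x + b j].

Lemma poly_bigcap m (a : 'I_m -> E) b : poly a b =
  \bigcap_(j in [set: 'I_m]) [set x | 0 <= dot (a j) x + b j].
Proof. by apply/seteqP; split=> x h j => [_|]; apply: h. Qed.

Lemma closed_poly m (a : 'I_m -> E) b : closed (poly a b).
Proof. by rewrite poly_bigcap; apply: closed_bigI => j _; exact: closed_affine_ge0. Qed.

Lemma measurable_poly m (a : 'I_m -> E) b : measurable (poly a b).
Proof.
rewrite -[poly a b]setCK; apply: measurableC; apply: measurable_open_rV.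
by apply: closed_openC; exact: closed_poly.
Qed.

Lemma continuous_line (r s : E) : continuous (fun h : R => r + h *: s).
Proof.
move=> h; apply: cvgD; first exact: cvg_cst.
by apply: cvgZr_tmp; exact: cvg_id.
Qed.

Lemma near_line (U : set E) (r s : E) : open U -> U r ->
  \forall h \near (0 : R), U (r + h *: s).
Proof.
move=> oU Ur.
have : nbhs (r + (0 : R) *: s) U.
  by rewrite scale0r addr0; move: oU; rewrite openE; apply.
exact: (@continuous_line r s 0).
Qed.

Lemma near_poly m (a : 'I_m -> E) b r s :
  \forall h \near (0 : R), poly a b (r + h *: s) -> poly a b r.
Proof.
have [pr|npr] := pselect (poly a b r); first by apply: (@nearW _ (nbhs (0 : R))) => h _.
have := @near_line (~` poly a b) r s (closed_openC (@closed_poly m a b)) npr.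
by apply: filterS => h nh /nh.
Qed.

Lemma near_ipoly m (a : 'I_m -> E) b r s : ipoly a b r ->
  \forall h \near (0 : R), ipoly a b (r + h *: s).
Proof.
move=> ir.
apply: (@filter_forall _ _ (fun j (h : R) => 0 < dot (a j) (r + h *: s) + b j) (nbhs (0 : R))) => j.
exact: (near_line s (@open_affine_gt0 _ _ (a j) (b j)) (ir j)).
Qed.

End polytope.

(** What the transport part uses of mesh and domain. Nonzero normals make the faces null sets; the
    inclusion of the open cells in [Om] makes functions supported inside a cell admissible as test
    functions. *)
Record polytopal (R : realType) d N m (Om : set 'rV[R]_d)
    (a : 'I_N -> 'I_m -> 'rV[R]_d) (b : 'I_N -> 'I_m -> R) (rad : R) : Prop :=
  Polytopal {
  polytopal_open : open Om;
  polytopal_neq0 : forall i j, a i j != 0;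
  polytopal_closure : closure Om = \bigcup_(i in [set: 'I_N]) poly (a i) (b i);
  polytopal_bounded : forall i, poly (a i) (b i) `<=` @cube R d rad;
  polytopal_interior : forall i, ipoly (a i) (b i) `<=` Om }.

Section piecewise.
Context {R : realType} (d N m : nat).
Notation E := 'rV[R]_d.
Variables (Om : set E) (a : 'I_N -> 'I_m -> E) (b : 'I_N -> 'I_m -> R).
Variables (rad : R) (HP : polytopal Om a b rad).
Notation K i := (poly (a i) (b i)).

(** Closed cells share faces; giving each point to the cell of least index yields a measurable
    partition of [closure Om]. *)
Definition first_cell (i : 'I_N) : set E :=
  K i `\` \bigcup_(j in [set j : 'I_N | (j < i)%N]) K j.

Lemma measurable_first_cell i : measurable (first_cell i).
Proof.
apply: measurableD; first exact: measurable_poly.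
by apply: fin_bigcup_measurable => // j _; exact: measurable_poly.
Qed.

Lemma first_cell_ex x : closure Om x -> exists i, first_cell i x.
Proof.
rewrite (polytopal_closure HP) => -[i0 _ Ki0].
have [i Ki imin] := @arg_minnP _ i0 (fun i => `[< K i x >]) (fun i => val i) (asboolT Ki0).
exists i; split; first exact/asboolP.
by move=> [j /= ji /asboolT Kj]; have := imin j Kj; rewrite leqNgt ji.
Qed.

Lemma first_cell_uniq i j x : first_cell i x -> first_cell j x -> i = j.
Proof.
move=> [Ki ni] [Kj nj]; apply/val_inj; case: (ltngtP i j) => // ij.
- by exfalso; apply: nj; exists i.
- by exfalso; apply: ni; exists j.
Qed.

Lemma sum_first_cell (h : 'I_N -> R) i x : first_cell i x ->
  \sum_j \1_(first_cell j) x * h j = h i.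
Proof.
move=> fi; rewrite (bigD1 i)//= indicE mem_set// mul1r big1 ?addr0// => j ji.
rewrite indicE memNset ?mul0r// => fj.
by move/eqP: ji; apply; exact: first_cell_uniq fj fi.
Qed.

Lemma sum_first_cell0 (h : 'I_N -> R) x : ~ closure Om x ->
  \sum_j \1_(first_cell j) x * h j = 0.
Proof.
move=> nx; apply: big1 => j _; rewrite indicE memNset ?mul0r// => -[Kj _].
by apply: nx; rewrite (polytopal_closure HP); exists j.
Qed.

Lemma closure_cube : closure Om `<=` @cube R d rad.
Proof.
by rewrite (polytopal_closure HP) => x [i _]; exact: (polytopal_bounded HP).
Qed.

Lemma domain_cube : Om `<=` @cube R d rad.
Proof. by apply: subset_trans closure_cube; exact: subset_closure. Qed.

Lemma measurable_domain : measurable Om.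
Proof. by apply: measurable_open_rV; exact: (polytopal_open HP). Qed.

Lemma measurable_phase : measurable (phase Om).
Proof. by apply: measurableX; [exact: measurable_domain|exact: measurable_sphere]. Qed.

Lemma phase_lty : (phase_measure d (phase Om) < +oo)%E.
Proof.
apply: le_lt_trans (phase_measure_cube_lty rad (@measurable_sphere R d)).
apply: le_measure; rewrite ?inE; first exact: measurable_phase.
- by apply: measurableX; [exact: measurable_cube|exact: measurable_sphere].
- by move=> z [Oz Sz]; split=> //; exact: domain_cube.
Qed.

Lemma ae_off_faces :
  {ae @lebesgue_rV R d, forall r, forall i j, dot (a i j) r + b i j != 0}.
Proof.
apply: filter_forall => i; apply: filter_forall => j.
exists [set x | dot (a i j) x + b i j = 0]; split.
- rewrite (_ : [set _ | _] = (fun x => dot (a i j) x + b i j) @^-1` [set 0])//.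
  by rewrite -[X in measurable X]setTI; exact: measurable_affine.
- exact/leb_hyperplane/(polytopal_neq0 HP).
- by move=> x /= /negP; rewrite negbK => /eqP.
Qed.

Lemma poly_off_faces i r : (forall j, dot (a i j) r + b i j != 0) ->
  K i r -> ipoly (a i) (b i) r.
Proof. by move=> n0 Kr j; rewrite lt_neqAle eq_sym n0 Kr. Qed.

Section affine_pieces.
Variables (alpha : 'I_N -> E) (beta : 'I_N -> R) (g : E -> R).
Hypothesis gK : forall i x, K i x -> g x = dot (alpha i) x + beta i.
Hypothesis g0 : forall x, ~ closure Om x -> g x = 0.

(** The candidate for [s . nabla g], cell by cell; on a face the least index decides. *)
Definition pgrad (z : E * E) : R :=
  \sum_i \1_(first_cell i) z.1 * dot (alpha i) z.2.

Lemma pieceE : g = fun x => \sum_i \1_(first_cell i) x * (dot (alpha i) x + beta i).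
Proof.
apply/funext => x; have [cx|ncx] := pselect (closure Om x).
  have [i fi] := first_cell_ex cx; rewrite (sum_first_cell _ fi).
  by rewrite (gK fi.1).
by rewrite (sum_first_cell0 _ ncx) g0.
Qed.

Lemma measurable_piece : measurable_fun setT g.
Proof.
rewrite pieceE; apply: measurable_sum => i; apply: measurable_funM.
  by apply: measurable_indic; exact: measurable_first_cell.
exact: measurable_affine.
Qed.

Lemma dot_cube (u x : E) c : @cube R d c x -> `|dot u x| <= \sum_i `|u ord0 i| * `|c|.
Proof.
move=> xc; apply: le_trans (ler_norm_sum _ _ _) _; apply: ler_sum => i _.
by rewrite normrM ler_wpM2l// (le_trans (xc i))// ler_norm.
Qed.

Lemma bdd_piece : bdd_meas setT g.
Proof.
split; first exact: measurable_piece.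
pose M i := (\sum_j `|alpha i ord0 j| * `|rad|) + `|beta i|.
have M0 i : 0 <= M i by rewrite addr_ge0// sumr_ge0// => j _; rewrite mulr_ge0.
exists (\sum_i M i) => x _.
have [cx|ncx] := pselect (closure Om x); last first.
  by rewrite g0// normr0 sumr_ge0.
have [i fi] := first_cell_ex cx.
rewrite (gK fi.1) (bigD1 i)//=.
apply: (@le_trans _ _ (M i)).
  apply: le_trans (ler_normD _ _) _; rewrite lerD2r.
  exact/dot_cube/closure_cube.
by rewrite lerDl; apply: sumr_ge0.
Qed.

Lemma measurable_pgrad : measurable_fun setT pgrad.
Proof.
apply: measurable_sum => i; apply: measurable_funM.
  apply: measurableT_comp; last exact: measurable_fst.
  by apply: measurable_indic; exact: measurable_first_cell.
by apply: measurableT_comp; [exact: measurable_dotl|exact: measurable_snd].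
Qed.

Lemma pgrad_bound z : sphere z.2 -> `|pgrad z| <= \sum_i enorm (alpha i).
Proof.
move=> sz; apply: le_trans (ler_norm_sum _ _ _) _; apply: ler_sum => i _.
rewrite normrM -[leRHS]mul1r; apply: ler_pM => //.
  by rewrite indicE ger0_norm//; case: (_ \in _).
by apply: le_trans (CauchySchwarz_dot _ _) _; rewrite sz mulr1.
Qed.

(** The cells are closed and finitely many, so a point close to [r] lies only in cells that also
    contain [r], and [g] is affine on each of them. This includes points [r] on faces. *)
Lemma piece_slope r s : Om r -> sphere s -> \forall h \near (0 : R),
  `|g (r + h *: s) - g r| <= (\sum_i enorm (alpha i)) * `|h|.
Proof.
move=> Or ss.
have := near_line s (polytopal_open HP) Or.
have : \forall h \near (0 : R), forall i, K i (r + h *: s) -> K i r.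
  apply: (@filter_forall _ _ (fun i (h : R) => K i (r + h *: s) -> K i r) (nbhs (0 : R))) => i.
  exact: near_poly.
apply: filterS2 => h Kh Oh.
have [i fi] := first_cell_ex (subset_closure Oh).
rewrite (gK fi.1) (gK (Kh _ fi.1)) dotDr dotZr.
rewrite (_ : _ - _ = h * dot (alpha i) s); last by ring.
rewrite normrM mulrC ler_wpM2r//.
apply: le_trans (CauchySchwarz_dot _ _) _; rewrite ss mulr1.
by rewrite (bigD1 i)//= lerDl sumr_ge0// => j _; exact: enorm_ge0.
Qed.

(** Off the faces [r] is interior to its cell, so the first-order expansion is exact for small
    [h]. *)
Lemma piece_derive r s : Om r -> (forall i j, dot (a i j) r + b i j != 0) ->
  \forall h \near (0 : R), g (r + h *: s) = g r + h * pgrad (r, s).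
Proof.
move=> Or noface.
have [i fi] := first_cell_ex (subset_closure Or).
have := near_ipoly s (poly_off_faces (noface i) fi.1).
apply: filterS => h ih.
have Kh : K i (r + h *: s) by move=> j; exact: ltW.
rewrite (gK Kh) (gK fi.1) /pgrad (sum_first_cell _ fi) dotDr dotZr.
by ring.
Qed.

End affine_pieces.
End piecewise.

(** * Weak derivatives of piecewise affine functions *)

Section difference_quotients.
Context {R : realType} (d : nat).
Notation E := 'rV[R]_d.

Lemma derivable_quotient_cvg (f : E -> R) r s : derivable f r s ->
  h^-1 * (f (r + h *: s) - f r) @[h --> 0^'] --> 'D_s f r.
Proof.
move=> df; have : h^-1 *: ((f \o shift r) (h *: s) - f r) @[h --> 0^'] --> 'D_s f r by exact: df.
apply: cvg_trans; apply: near_eq_cvg; apply: nearW => h /=.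
by rewrite [r + _]addrC.
Qed.

Lemma derivable_near_le (f : E -> R) r s M : derivable f r s -> `|'D_s f r| <= M ->
  \forall h \near (0 : R), `|f (r + h *: s) - f r| <= (M + 1) * `|h|.
Proof.
move=> /derivable_quotient_cvg df DM.
have M1 : `|'D_s f r| < M + 1 by rewrite (le_lt_trans DM)// ltrDl.
have : \forall h \near 0^', `|h^-1 * (f (r + h *: s) - f r)| <= M + 1.
  exact: (cvgr_norm_le _ df _ M1).
rewrite /dnbhs near_withinE; apply: filterS => h hM.
have [->|h0] := eqVneq h 0; first by rewrite scale0r addr0 subrr !normr0 mulr0.
have := hM h0; rewrite normrM normfV ler_pdivrMl ?normr_gt0//.
by rewrite mulrC.
Qed.

Lemma cvg_harmonic_dnbhs : @harmonic R @ \oo --> 0^'.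
Proof.
move=> A; rewrite /dnbhs /within /= => HA.
have : \forall n \near \oo, harmonic n != (0 : R) -> A (harmonic n) by exact: cvg_harmonic HA.
by apply: filterS => n; apply; rewrite gt_eqF// harmonic_gt0.
Qed.

(** Steps [1/(n+1)] turn the derivative into the limit of a sequence, the form in which dominated
    convergence applies. *)
Lemma derivable_harmonic_cvg (f : E -> R) r s : derivable f r s ->
  n.+1%:R * (f (r + n.+1%:R^-1 *: s) - f r) @[n --> \oo] --> 'D_s f r.
Proof.
move=> /derivable_quotient_cvg df.
have := cvg_comp _ _ cvg_harmonic_dnbhs df.
apply: cvg_trans; apply: near_eq_cvg; apply: nearW => n /=.
by rewrite /harmonic/= invrK.
Qed.

Lemma compact_sphere : compact (@sphere R d).
Proof.
apply: bounded_closed_compact.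
  exists 1; split; first exact: num_real.
  move=> M M1 x sx; apply/ltW; apply: le_lt_trans M1.
  rewrite -[`|x|]/(mx_norm x).
  have [->//|/mx_norm_neq0[i ->]] := eqVneq (mx_norm x) 0.
  by rewrite (ord1 i.1); apply: le_trans (ler_coord_enorm _ _) _; rewrite sx.
rewrite (_ : @sphere R d = (fun x => dot x x) @^-1` [set 1]); last first.
  apply/seteqP; split=> x; rewrite /sphere /=.
    by move=> x1; rewrite -sqr_enorm x1 expr1n.
  by move=> x1; rewrite /enorm x1 sqrtr1.
have : forall A : set R, closed A -> closed ((fun x : E => dot x x) @^-1` A); last by apply; exact: closed_eq.
apply/continuous_closedP.
move=> x; apply: differentiable_continuous; rewrite /dot.
rewrite (_ : (fun _ => _) = \sum_i (fun y : E => y ord0 i * y ord0 i)); last first.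
  by apply/funext => y; rewrite fct_sumE.
apply: differentiable_sum => i.
by apply: differentiableM; exact: differentiable_coord.
Qed.

Lemma continuous_bounded_compact (T : topologicalType) (f : T -> R) (A : set T) :
  continuous f -> compact A -> exists M, forall x, A x -> `|f x| <= M.
Proof.
move=> cf cA.
have : compact (f @` A) by apply: continuous_compact => //; exact: continuous_subspaceT.
move=> /(@compact_bounded R R^o) [M [_ HM]].
exists (M + 1) => x Ax; apply: (HM (M + 1)); first by rewrite ltrDl.
by exists x.
Qed.

Lemma derive_rowE (f : E -> R) r s : differentiable f r ->
  'D_s f r = \sum_i s ord0 i * 'D_(delta_mx ord0 i) f r.
Proof.
move=> df; rewrite deriveE// {1}[s]row_sum_delta linear_sum.
by apply: eq_bigr => i _; rewrite linearZ -deriveE.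
Qed.

End difference_quotients.

Section test_functions.
Context {R : realType} (d : nat).
Notation E := 'rV[R]_d.
Variables (Om : set E) (xi : E * E -> R).
Hypothesis txi : test_function Om xi.

Lemma test_derivable (z : E * E) e : derivable (fun r => xi (r, z.2)) z.1 e.
Proof. by apply: diff_derivable; case: txi => _ + _ _; apply. Qed.

Lemma test_continuous : continuous xi.
Proof. by case: txi. Qed.

Lemma measurable_test : measurable_fun setT xi.
Proof. by apply: measurable_continuous_rV2; exact: test_continuous. Qed.

Lemma test_quotient_cvg z :
  n.+1%:R * (xi (shear n.+1%:R^-1 z) - xi z) @[n --> \oo] --> space_derive xi z.2 z.
Proof.
have dz : derivable (fun r => xi (r, z.2)) z.1 z.2 by exact: test_derivable.
by have := derivable_harmonic_cvg dz; rewrite -surjective_pairing.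
Qed.

(** Continuity is given for a fixed direction, while here the direction is [z.2]; measurability is
    inherited from the difference quotients. *)
Lemma measurable_test_derive : measurable_fun setT (fun z => space_derive xi z.2 z).
Proof.
apply: (measurable_fun_cvg (h := fun n z => n.+1%:R * (xi (shear n.+1%:R^-1 z) - xi z))).
  move=> n; apply: measurable_funM => //; apply: measurable_funB.
    apply: measurableT_comp; [exact: measurable_test|exact: measurable_shear].
  exact: measurable_test.
by move=> z _; exact: test_quotient_cvg.
Qed.

Lemma test_bound : exists (K : set E) (M : R), [/\ compact K, K `<=` Om, 0 <= M,
  forall z, ~ K z.1 -> xi z = 0 &
  forall z, sphere z.2 -> K z.1 -> `|xi z| <= M /\ `|space_derive xi z.2 z| <= M].
Proof.
have [cxi dxi cdxi [K [cK KOm] K0]] := txi.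
have cKS := compact_setX cK (@compact_sphere R d).
have [M1 hM1] := continuous_bounded_compact cxi cKS.
have /choice [M2 hM2] : forall i : 'I_d, exists M, forall z, (K `*` @sphere R d) z ->
    `|space_derive xi (delta_mx ord0 i) z| <= M.
  by move=> i; exact: continuous_bounded_compact (cdxi _) cKS.
exists K, (`|M1| + \sum_i `|M2 i|); split=> //.
  by rewrite addr_ge0// sumr_ge0.
move=> z sz Kz; have KSz : (K `*` @sphere R d) z by [].
split.
  apply: le_trans (hM1 z KSz) _; apply: le_trans (ler_norm _) _.
  by rewrite lerDl sumr_ge0.
apply: (@le_trans _ _ (\sum_i `|M2 i|)); last by rewrite lerDr.
rewrite /space_derive derive_rowE; last exact: dxi.
apply: le_trans (ler_norm_sum _ _ _) _; apply: ler_sum => i _.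
rewrite normrM -[leRHS]mul1r; apply: ler_pM => //.
  by rewrite -sz ler_coord_enorm.
by apply: le_trans (hM2 i z KSz) (ler_norm _).
Qed.

End test_functions.

Section integration_by_parts.
Context {R : realType} (d N m : nat).
Notation E := 'rV[R]_d.
Notation mu := (@phase_measure R d).
Variables (Om : set E) (a : 'I_N -> 'I_m -> E) (b : 'I_N -> 'I_m -> R).
Variables (rad : R) (HP : polytopal Om a b rad).
Notation D := (phase Om).

Lemma bdd_meas_fst (D' : set (E * E)) (f : E -> R) : bdd_meas setT f ->
  bdd_meas D' (fun z => f z.1).
Proof.
move=> [mf [M fM]]; split; last by exists M => z _; exact: fM.
by apply: measurable_funTS; apply: measurableT_comp mf _; exact: measurable_fst.
Qed.

Lemma bdd_meas_snd (D' : set (E * E)) (f : E -> R) : bdd_meas setT f ->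
  bdd_meas D' (fun z => f z.2).
Proof.
move=> [mf [M fM]]; split; last by exists M => z _; exact: fM.
by apply: measurable_funTS; apply: measurableT_comp mf _; exact: measurable_snd.
Qed.

Lemma test_near0 (K : set E) (xi : E * E -> R) (r s : E) : compact K ->
  (forall z, ~ K z.1 -> xi z = 0) -> ~ K r ->
  \forall h \near (0 : R), xi (r + h *: s, s) = 0.
Proof.
move=> cK xi0 nKr.
have oK : open (~` K) by apply: closed_openC; exact: compact_closed.
have := near_line s oK nKr.
by apply: filterS => h nK; exact: xi0.
Qed.

Lemma near_harmonic (P : set R) : (\forall h \near (0 : R), P h) ->
  \forall n \near \oo, P (n.+1%:R^-1).
Proof. exact: cvg_harmonic. Qed.

Lemma test_derive0 (K : set E) (xi : E * E -> R) (z : E * E) : test_function Om xi ->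
  compact K -> (forall z, ~ K z.1 -> xi z = 0) -> ~ K z.1 -> space_derive xi z.2 z = 0.
Proof.
move=> txi cK xi0 nKz.
have /cvg_lim <- // := @test_quotient_cvg R d Om xi txi z.
apply: cvg_lim => //; apply: cvg_near_cst.
have := near_harmonic (test_near0 z.2 cK xi0 nKz).
by apply: filterS => n; rewrite /shear => ->; rewrite (xi0 z nKz) subrr mulr0.
Qed.

Lemma bdd_meas_test (xi : E * E -> R) : test_function Om xi -> bdd_meas D xi.
Proof.
move=> txi; split; first by apply: measurable_funTS; exact: (measurable_test txi).
have [K [M [_ _ M0 xi0 xiM]]] := test_bound txi.
exists M => z [_ sz]; have [Kz|nKz] := pselect (K z.1); first by case: (xiM z sz Kz).
by rewrite xi0// normr0.
Qed.

Lemma bdd_meas_test_derive (xi : E * E -> R) : test_function Om xi ->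
  bdd_meas D (fun z => space_derive xi z.2 z).
Proof.
move=> txi; split; first by apply: measurable_funTS; exact: (measurable_test_derive txi).
have [K [M [cK _ M0 xi0 xiM]]] := test_bound txi.
exists M => z [_ sz]; have [Kz|nKz] := pselect (K z.1); first by case: (xiM z sz Kz).
by rewrite (test_derive0 txi cK xi0 nKz) normr0.
Qed.

Variables (alpha : 'I_N -> E) (beta : 'I_N -> R) (g : E -> R).
Hypothesis gK : forall i x, poly (a i) (b i) x -> g x = dot (alpha i) x + beta i.
Hypothesis g0 : forall x, ~ closure Om x -> g x = 0.
Notation pg := (pgrad a b alpha).

Lemma bdd_pgrad : bdd_meas D pg.
Proof.
split; first by apply: measurable_funTS; exact: measurable_pgrad.
by exists (\sum_i enorm (alpha i)) => z [_ sz]; exact: pgrad_bound.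
Qed.

Variable f : E -> R.
Hypothesis bf : bdd_meas setT f.

Section with_test_function.
Variables (xi : E * E -> R) (txi : test_function Om xi).

Let G (z : E * E) := g z.1 * xi z.

(** Product rule for increments: [B] bounds [g], [M + 1] the slope of [xi], [M] bounds [xi], and [L]
    the slope of [g]. Off [K] the test function vanishes nearby, so the jump of [g] across the
    boundary of [Om] does no harm. *)
Let G_local : exists C, forall s, sphere s -> forall r,
  \forall h \near (0 : R), `|G (r + h *: s, s) - G (r, s)| <= C * `|h|.
Proof.
have [K [M [cK KOm M0 xi0 xiM]]] := test_bound txi.
have [_ [B gB]] := bdd_piece HP gK g0.
pose L := \sum_i enorm (alpha i).
exists (B * (M + 1) + M * L) => s ss r.
have B0 : 0 <= B by apply: le_trans (gB r Logic.I).
have L0 : 0 <= L by apply: sumr_ge0 => i _; exact: enorm_ge0.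
have [Kr|nKr] := pselect (K r); last first.
  have := test_near0 s cK xi0 nKr; apply: filterS => h xih.
  rewrite /G /= xih (xi0 (r, s) nKr) !mulr0 subrr normr0.
  by rewrite mulr_ge0// addr_ge0// mulr_ge0// addr_ge0.
have [xiM1 xiM2] := xiM (r, s) ss Kr.
have n1 := piece_slope HP gK (KOm _ Kr) ss.
have n2 := derivable_near_le (@test_derivable R d Om xi txi (r, s) s) xiM2.
apply: filterS2 n1 n2 => h /= h1 h2.
rewrite /G /= (_ : _ - _ = g (r + h *: s) * (xi (r + h *: s, s) - xi (r, s)) +
   xi (r, s) * (g (r + h *: s) - g r)); last by ring.
apply: le_trans (ler_normD _ _) _; rewrite !normrM mulrDl; apply: lerD.
  by rewrite -mulrA; apply: ler_pM => //; exact: gB.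
by rewrite -mulrA; apply: ler_pM.
Qed.

(** Extended to the whole space because the flow does not preserve [D]; the indicator confines the
    directions to the sphere, where the bounds hold. *)
Let F (z : E * E) := \1_(@sphere R d) z.2 * (f z.2 * G z).

Let mF : measurable_fun setT F.
Proof.
apply: measurable_funM.
  apply: measurableT_comp; last exact: measurable_snd.
  by apply: measurable_indic; exact: measurable_sphere.
apply: measurable_funM; first exact: (bdd_meas_snd setT bf).1.
apply: measurable_funM; last exact: measurable_test txi.
exact: (bdd_meas_fst setT (bdd_piece HP gK g0)).1.
Qed.

Let F0 z : ~ @cube R d rad z.1 -> F z = 0.
Proof.
move=> nz; rewrite /F /G g0 ?mul0r ?mulr0// => /(closure_cube HP).
exact: nz.
Qed.

Let Fbound : exists C, 0 <= C /\ forall z, `|F z| <= C * \1_(@cube R d rad `*` @sphere R d) z.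
Proof.
have [K [M [cK KOm M0 xi0 xiM]]] := test_bound txi.
have [_ [B gB]] := bdd_piece HP gK g0.
have [_ [C fC]] := bf.
have B0 : 0 <= B by apply: le_trans (gB 0 Logic.I).
have C0 : 0 <= C by apply: le_trans (fC 0 Logic.I).
exists (C * (B * M)); split; first by rewrite !mulr_ge0.
move=> z; have [cz|ncz] := pselect (@cube R d rad z.1); last first.
  by rewrite F0// normr0 !mulr_ge0.
have [sz|nsz] := pselect (sphere z.2); last first.
  by rewrite /F indicE memNset// mul0r normr0 !mulr_ge0.
rewrite indicE mem_set//= mulr1 /F indicE mem_set// mul1r /G !normrM.
apply: ler_pM => //; first exact: fC.
apply: ler_pM => //; first exact: gB.
have [Kz|nKz] := pselect (K z.1); first by case: (xiM z sz Kz).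
by rewrite xi0// normr0.
Qed.

Let integrable_box c (B : R) : mu.-integrable setT
  (EFin \o (fun z => B * \1_(@cube R d c `*` @sphere R d) z)).
Proof.
have mC : measurable (@cube R d c `*` @sphere R d).
  by apply: measurableX; [exact: measurable_cube|exact: measurable_sphere].
rewrite (_ : EFin \o _ = (fun z => B%:E * (\1_(@cube R d c `*` @sphere R d) z)%:E)%E)//.
apply: integrableZl => //; apply/integrableP; split.
  by apply/measurable_EFinP; exact: measurable_indic.
rewrite (eq_integral (EFin \o \1_(@cube R d c `*` @sphere R d))); last first.
  by move=> z _ /=; rewrite ger0_norm.
rewrite integral_indic// setIT.
by apply: phase_measure_cube_lty; exact: measurable_sphere.
Qed.

Let integrable_F : mu.-integrable setT (EFin \o F).
Proof.
have [C [C0 FC]] := Fbound.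
apply: (le_integrable _ _ _ (integrable_box rad C)) => //.
  exact/measurable_EFinP.
move=> z _ /=; rewrite lee_fin; apply: le_trans (FC z) _.
by rewrite ler_norm.
Qed.

Let integrable_Fshear h : mu.-integrable setT (EFin \o (F \o shear h)).
Proof.
apply/integrableP; split.
  apply/measurable_EFinP; apply: measurableT_comp => //; exact: measurable_shear.
have /integrableP[_] := integrable_F.
rewrite -(ge0_integral_shear h)//.
by apply: measurableT_comp => //; exact/measurable_EFinP.
Qed.

Let Q (n : nat) z := n.+1%:R * (F (shear n.+1%:R^-1 z) - F z).

Let integral_Q n : (\int[mu]_z (Q n z)%:E = 0)%E.
Proof.
rewrite (_ : (fun _ => _) = (fun z => n.+1%:R%:E * ((EFin \o (F \o shear n.+1%:R^-1)) \- (EFin \o F)) z)%E)//.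
rewrite integralZl//; last exact: integrableB.
rewrite integralB//.
rewrite (integral_shear n.+1%:R^-1 (f := EFin \o F)); last exact/measurable_EFinP.
by rewrite subee ?mule0//; exact: integrable_fin_num.
Qed.

(** Local slopes add up along the segment from [z] to its image, which gives a constant uniform in
    [n]. A unit direction moves each coordinate by at most 1 in time [1/(n+1)], so off the enlarged
    cube both values of [F] vanish. *)
Let Qbound : exists C, forall n z,
  `|Q n z| <= C * \1_(@cube R d (rad + 1) `*` @sphere R d) z.
Proof.
have [C GC] := G_local.
have [_ [B fB]] := bf.
have B0 : 0 <= B by apply: le_trans (fB 0 Logic.I).
exists (B * `|C|) => n z.
have hn0 : 0 < n.+1%:R^-1 :> R by rewrite invr_gt0.
have hn1 : n.+1%:R^-1 <= 1 :> R by rewrite invf_le1// ler1n.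
have [sz|nsz] := pselect (sphere z.2); last first.
  by rewrite /Q /F /shear /= !indicE memNset// !mul0r subrr mulr0 normr0 !mulr_ge0.
have [cz|ncz] := pselect (@cube R d (rad + 1) z.1); last first.
  rewrite /Q !F0 ?subrr ?mulr0 ?normr0 ?mulr_ge0//.
    move=> cz; apply: ncz => i; apply: le_trans (cz i) _; rewrite lerDl//.
  move=> cz; apply: ncz => i; have := cz i; rewrite /shear /= !mxE => cz'.
  rewrite (_ : z.1 ord0 i = (z.1 ord0 i + n.+1%:R^-1 * z.2 ord0 i) - n.+1%:R^-1 * z.2 ord0 i); last by ring.
  apply: le_trans (ler_normB _ _) _; apply: lerD => //.
  rewrite normrM gtr0_norm// -[leRHS]mul1r; apply: ler_pM => //.
  by rewrite -sz ler_coord_enorm.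
rewrite indicE mem_set//= mulr1.
pose phi t := G (z.1 + t *: z.2, z.2).
have loc t : \forall h \near (0 : R), `|phi (t + h) - phi t| <= `|C| * `|h|.
  have := GC z.2 sz (z.1 + t *: z.2).
  apply: filterS => h; rewrite /phi scalerDl addrA => /le_trans; apply.
  by rewrite ler_wpM2r// ler_norm.
have := lipschitz_of_local (ltW hn0) loc.
rewrite subr0 /phi scale0r addr0 -surjective_pairing => hC.
rewrite /Q /F /shear /= !indicE mem_set// !mul1r -mulrBr mulrCA normrM.
apply: ler_pM => //; first exact: fB.
rewrite normrM normr_nat -ler_pdivlMl//.
by rewrite mulrC.
Qed.

Let H (z : E * E) := f z.2 * (g z.1 * space_derive xi z.2 z + pg z * xi z).

Let Lm (z : E * E) := \1_D z * H z.

Let mLm : measurable_fun setT Lm.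
Proof.
apply: measurable_funM.
  by apply: measurable_indic; exact: measurable_phase HP.
apply: measurable_funM; first exact: (bdd_meas_snd setT bf).1.
apply: measurable_funD; apply: measurable_funM.
- exact: (bdd_meas_fst setT (bdd_piece HP gK g0)).1.
- exact: measurable_test_derive txi.
- exact: measurable_pgrad.
- exact: measurable_test txi.
Qed.

Let cvg_Q : {ae mu, forall z, Q n z @[n --> \oo] --> Lm z}.
Proof.
have [K [M [cK KOm M0 xi0 xiM]]] := test_bound txi.
apply: filterS (phase_ae_fst (ae_off_faces HP)) => z noface.
have [sz|nsz] := pselect (sphere z.2); last first.
  apply: cvg_near_cst; apply: nearW => n.
  rewrite /Q /F /Lm /shear /= !indicE !memNset ?mul0r ?subrr ?mulr0//.
  by case.
have [Oz|nOz] := pselect (Om z.1); last first.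
  have nKz : ~ K z.1 by apply: contra_not nOz; exact: KOm.
  apply: cvg_near_cst.
  have := near_harmonic (test_near0 z.2 cK xi0 nKz).
  apply: filterS => n xin; rewrite /Q /F /G /Lm /shear /= xin (xi0 z nKz).
  by rewrite !mulr0 subrr mulr0 !indicE memNset ?mul0r// => -[].
rewrite /Lm indicE mem_set//= mul1r.
have qc := @test_quotient_cvg R d Om xi txi z.
(* Continuity along the flow, read off from the convergent quotients multiplied by [1/(n+1)]. *)
have xc : xi (shear n.+1%:R^-1 z) @[n --> \oo] --> xi z.
  have : (xi z + n.+1%:R^-1 * (n.+1%:R * (xi (shear n.+1%:R^-1 z) - xi z))) @[n --> \oo] -->
     xi z + 0 * space_derive xi z.2 z.
    by apply: cvgD; [exact: cvg_cst|apply: cvgM => //; exact: cvg_harmonic].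
  rewrite mul0r addr0; apply: cvg_trans; apply: near_eq_cvg; apply: nearW => n /=.
  by rewrite mulKf// addrC subrK.
(* The increment of [g xi] is split as [g] times the increment of [xi] plus the increment of [g]
   times the shifted [xi]. *)
have : f z.2 * (g z.1 * (n.+1%:R * (xi (shear n.+1%:R^-1 z) - xi z)) +
    pg z * xi (shear n.+1%:R^-1 z)) @[n --> \oo] --> H z.
  apply: cvgM; first exact: cvg_cst.
  by apply: cvgD; apply: cvgM => //; exact: cvg_cst.
apply: cvg_trans; apply: near_eq_cvg.
have := near_harmonic (piece_derive HP gK z.2 Oz noface).
apply: filterS => n gn.
rewrite /Q /F /G /= !indicE mem_set// !mul1r {1}/shear /= gn -surjective_pairing.
have n0 : n.+1%:R != 0 :> R by [].
rewrite -mulrBr [RHS]mulrCA; congr (_ * _).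
rewrite /shear; move: n0; set k := n.+1%:R; set x := xi (_, _) => n0.
by field.
Qed.

Lemma integral_by_parts :
  \int[mu]_(z in D) ((f z.2 * g z.1) * space_derive xi z.2 z) =
  - \int[mu]_(z in D) (f z.2 * pg z * xi z).
Proof.
have [C QC] := Qbound.
have mQ n : measurable_fun setT (Q n).
  apply: measurable_funM => //; apply: measurable_funB => //.
  by apply: measurableT_comp => //; exact: measurable_shear.
pose dom z : R := C * \1_(@cube R d (rad + 1) `*` @sphere R d) z.
have domQ : {ae mu, forall z, forall n, setT z ->
    (`|(Q n z)%:E| <= (dom z)%:E)%E}.
  by apply: aeW => z n _; rewrite /= lee_fin.
have cvQ : {ae mu, forall z, setT z -> (Q n z)%:E @[n --> \oo] --> (Lm z)%:E}.
  by apply: filterS cvg_Q => z Qz _; apply: cvg_EFin => //; exact: nearW.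
have [_ _] := dominated_convergence measurableT
  (fun n => (measurable_EFinP _ _).2 (mQ n)) ((measurable_EFinP _ _).2 mLm) cvQ
  (integrable_box _ _) domQ.
rewrite (_ : [sequence _]_n = cst 0%E); last first.
  by apply/funext => n; exact: integral_Q.
move=> Q0; have Lm0 : (\int[mu]_z (EFin \o Lm) z = 0)%E.
  by apply/esym; apply: (cvg_unique _ _ Q0) => //; exact: cvg_cst.
have mD := measurable_phase HP; have fD := phase_lty HP.
have bg := bdd_meas_fst D (bdd_piece HP gK g0).
have bf' := bdd_meas_snd D bf.
have i1 : mu.-integrable D (EFin \o (fun z => (f z.2 * g z.1) * space_derive xi z.2 z)).
  apply: bdd_meas_integrable => //; apply: bdd_measM; first exact: bdd_measM.
  exact: bdd_meas_test_derive.
have i2 : mu.-integrable D (EFin \o (fun z => f z.2 * pg z * xi z)).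
  apply: bdd_meas_integrable => //; apply: bdd_measM; last exact: bdd_meas_test.
  by apply: bdd_measM => //; exact: bdd_pgrad.
apply/eqP; rewrite -addr_eq0 -RintegralD//.
rewrite /Rintegral (_ : integral _ _ _ = 0%E)//.
rewrite -Lm0 integral_mkcond; apply: eq_integral => z _ /=.
rewrite patchE /Lm indicE; case: ifP => _; last by rewrite mul0r.
by rewrite mul1r /H; congr (_%:E); ring.
Qed.

End with_test_function.

Lemma bdd_streaming : bdd_meas D (fun z => f z.2 * pg z).
Proof. by apply: bdd_measM; [exact: bdd_meas_snd|exact: bdd_pgrad]. Qed.

Lemma bdd_meas_square_integrable (v : E * E -> R) : bdd_meas D v ->
  square_integrable (phase_measure d) D (cst 1) v.
Proof.
move=> bv; split; first by case: bv.
under eq_integral do rewrite mul1r.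
by apply: bdd_meas_L2 => //; [exact: measurable_phase HP|exact: phase_lty HP].
Qed.

Lemma weak_streaming_piece :
  weak_streaming Om (fun z => f z.2 * g z.1) (fun z => f z.2 * pg z).
Proof.
split.
- apply: bdd_meas_square_integrable; apply: bdd_measM.
    exact: bdd_meas_snd.
  exact: (bdd_meas_fst D (bdd_piece HP gK g0)).
- exact/bdd_meas_square_integrable/bdd_streaming.
- by move=> xi txi; exact: integral_by_parts.
Qed.

End integration_by_parts.

(** * Uniqueness of the weak derivative *)

Section smooth_step.
Context {R : realType}.

Definition pos_sq (t : R) : R := Num.max 0 t ^+ 2.

(** A transition from 0 for [t <= 0] to 1 for [t >= 1]. Squares of positive parts are continuously
    differentiable, which is all the regularity that test functions ask for. *)
Definition smooth_step (t : R) : R := 1 - pos_sq (1 - pos_sq t).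

Lemma pos_sq_taylor t h :
  `|pos_sq (t + h) - pos_sq t - h * (2 * Num.max 0 t)| <= h ^+ 2.
Proof.
rewrite /pos_sq ler_norml; have [h1|h1] := leP 0 (t + h); have [h2|h2] := leP 0 t;
  by apply/andP; split; nra.
Qed.

Lemma pos_sq_is_derive (t : R) : is_derive t 1 pos_sq (2 * Num.max 0 t).
Proof.
have H : h^-1 *: ((pos_sq \o shift t) (h *: (1 : R)) - pos_sq t) @[h --> 0^'] -->
    (2 * Num.max 0 t).
  apply/cvgrPdist_le => e e0; near=> h.
  have h0 : h != 0 by near: h; exact: nbhs_dnbhs_neq.
  have he : `|h| <= e.
    near: h; apply: nbhs_dnbhs; apply/nbhs_ballP; exists e => //= h.
    by rewrite /ball/= sub0r normrN => /ltW.
  apply: le_trans he; rewrite /= /GRing.scale /= mulr1 [h + t]addrC.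
  have -> : 2 * Num.max 0 t - h^-1 * (pos_sq (t + h) - pos_sq t) =
     - h^-1 * (pos_sq (t + h) - pos_sq t - h * (2 * Num.max 0 t)).
    by rewrite [RHS]mulrBr !mulNr mulKf// opprK addrC.
  rewrite normrM normrN normfV ler_pdivrMl ?normr_gt0//.
  by apply: le_trans (pos_sq_taylor _ _) _; rewrite -expr2 real_normK// num_real.
split; [by apply/cvg_ex; eexists; exact: H|exact: cvg_lim H].
Unshelve. all: by end_near. Qed.

Lemma smooth_step_ge1 t : 1 <= t -> smooth_step t = 1.
Proof.
move=> t1; rewrite /smooth_step /pos_sq (max_r (_ : 0 <= t)); last lra.
rewrite max_l ?expr0n ?subr0//; nra.
Qed.

Lemma smooth_step_le0 t : t <= 0 -> smooth_step t = 0.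
Proof.
move=> t0; rewrite /smooth_step /pos_sq (max_l t0) expr0n/= subr0.
by rewrite max_r// expr1n subrr.
Qed.

Lemma smooth_step_bound t : 0 <= smooth_step t <= 1.
Proof.
rewrite /smooth_step; have q0 : 0 <= pos_sq t by exact: sqr_ge0.
rewrite {1 3}/pos_sq; set u := Num.max 0 _.
have u0 : 0 <= u by rewrite le_max lexx.
have u1 : u <= 1 by rewrite ge_max ler01 gerBl.
by rewrite subr_ge0 gerBl sqr_ge0 andbT exprn_ile1.
Qed.

End smooth_step.

Lemma continuous_mulr {R : realType} (T : topologicalType) (f g : T -> R) :
  continuous f -> continuous g -> continuous (fun x => f x * g x).
Proof. by move=> cf cg x; apply: cvgM; [exact: cf|exact: cg]. Qed.

Lemma continuous_addr {R : realType} (T : topologicalType) (f g : T -> R) :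
  continuous f -> continuous g -> continuous (fun x => f x + g x).
Proof. by move=> cf cg x; apply: cvgD; [exact: cf|exact: cg]. Qed.

Section continuously_differentiable.
Context {R : realType} (d : nat).
Notation E := 'rV[R]_d.
Implicit Types f g : E -> R.

Definition C1 f := (forall x, differentiable f x) /\
  forall e, continuous (fun x => 'D_e f x).

Lemma C1_continuous f : C1 f -> continuous f.
Proof. by move=> [df _] x; exact/differentiable_continuous/df. Qed.

Lemma C1_cst c : C1 (cst c).
Proof.
split=> [x|e x]; first exact: differentiable_cst.
rewrite (_ : 'D_e _ = cst 0); first exact: cst_continuous.
by apply/funext => y; rewrite derive_cst.
Qed.

Lemma C1_affine (a : E) b : C1 (fun x => dot a x + b).
Proof.
split=> [x|e x]; first exact: differentiable_affine.
rewrite (_ : 'D_e _ = cst (dot a e)); first exact: cst_continuous.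
by apply/funext => y; rewrite derive_affine.
Qed.

Lemma C1M f g : C1 f -> C1 g -> C1 (fun x => f x * g x).
Proof.
move=> Cf Cg; split=> [x|e].
  by apply: differentiableM; [exact: Cf.1|exact: Cg.1].
rewrite (_ : 'D_e _ = (fun x => f x * 'D_e g x + g x * 'D_e f x)).
  apply: continuous_addr; apply: continuous_mulr.
  - exact: C1_continuous.
  - exact: Cg.2.
  - exact: C1_continuous.
  - exact: Cf.2.
apply/funext => y; rewrite (deriveM (f := f) (g := g)) //.
  exact/diff_derivable/Cf.1.
exact/diff_derivable/Cg.1.
Qed.

Lemma C1D f g : C1 f -> C1 g -> C1 (fun x => f x + g x).
Proof.
move=> Cf Cg; split=> [x|e].
  by apply: differentiableD; [exact: Cf.1|exact: Cg.1].
rewrite (_ : 'D_e _ = (fun x => 'D_e f x + 'D_e g x)).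
  by apply: continuous_addr; [exact: Cf.2|exact: Cg.2].
apply/funext => y; rewrite (deriveD (f := f) (g := g)) //.
  exact/diff_derivable/Cf.1.
exact/diff_derivable/Cg.1.
Qed.

Lemma C1_prod I (s : seq I) (F : I -> E -> R) : (forall i, C1 (F i)) ->
  C1 (fun x => \prod_(i <- s) F i x).
Proof.
move=> CF; elim: s => [|i s ih].
  by under eq_fun do rewrite big_nil; exact: C1_cst.
by under eq_fun do rewrite big_cons; exact: C1M.
Qed.

Lemma continuous_max0 : continuous (fun t : R => Num.max 0 t).
Proof.
rewrite (_ : (fun _ => _) = (fun t : R => (t + `|t|) / 2)).
  apply: continuous_mulr; last exact: cst_continuous.
  apply: continuous_addr => u; [exact: cvg_id|apply: cvg_norm; exact: cvg_id].
apply/funext => u; have [u0|u0] := leP 0 u; first by rewrite ger0_norm//; lra.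
by rewrite ltr0_norm//; lra.
Qed.

Lemma C1_pos_sq f : C1 f -> C1 (fun x => pos_sq (f x)).
Proof.
move=> Cf.
have dq y : differentiable (@pos_sq R) y.
  by apply/derivable1_diffP; have [] := pos_sq_is_derive y.
have dcomp x : differentiable (fun x => pos_sq (f x)) x.
  by apply: differentiable_comp; [exact: Cf.1|exact: dq].
split=> [//|e].
rewrite (_ : 'D_e _ = (fun x => 'D_e f x * (2 * Num.max 0 (f x)))).
  apply: continuous_mulr; first exact: Cf.2.
  apply: continuous_mulr; first exact: cst_continuous.
  move=> x; apply: (@continuous_comp _ _ _ f (fun t => Num.max 0 t)).
    exact: C1_continuous.
  exact: continuous_max0.
apply/funext => x; rewrite deriveE// -[X in 'd X x e]/(pos_sq \o f).
rewrite (diff_comp (Cf.1 x) (dq (f x))) /=.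
have -> : 'd f x e = 'D_e f x by rewrite deriveE//; exact: Cf.1.
rewrite -[X in 'd _ _ X]mulr1 -[_ * 1]/('D_e f x *: (1 : R)) linearZ.
rewrite -deriveE; last exact: dq.
by have := pos_sq_is_derive (f x) => /@derive_val ->.
Qed.

Lemma C1_smooth_step f : C1 f -> C1 (fun x => smooth_step (f x)).
Proof.
move=> Cf.
have Cc g : C1 g -> C1 (fun x => 1 - g x).
  move=> Cg; rewrite (_ : (fun _ => _) = (fun x => 1 + (-1) * g x)).
    by apply: C1D; [exact: C1_cst|apply: C1M => //; exact: C1_cst].
  by apply/funext => x; rewrite mulN1r.
by apply: (Cc); apply: C1_pos_sq; apply: (Cc); exact: C1_pos_sq.
Qed.

Lemma test_function_tensor (Om K : set E) (phi psi : E -> R) : C1 phi ->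
  continuous psi -> compact K -> K `<=` Om -> (forall x, ~ K x -> phi x = 0) ->
  test_function Om (fun z => psi z.2 * phi z.1).
Proof.
move=> Cphi cpsi cK KOm phi0.
have c1 : continuous (fun z : E * E => phi z.1).
  move=> z; apply: (@continuous_comp _ _ _ fst phi); first exact: cvg_fst.
  exact: C1_continuous.
have c2 : continuous (fun z : E * E => psi z.2).
  move=> z; apply: (@continuous_comp _ _ _ snd psi); first exact: cvg_snd.
  exact: cpsi.
split.
- exact: continuous_mulr.
- move=> z /=; apply: differentiableM; first exact: differentiable_cst.
  exact: Cphi.1.
- move=> e.
  rewrite (_ : space_derive _ _ = (fun z => psi z.2 * 'D_e phi z.1)).
    apply: continuous_mulr; first exact: c2.
    move=> z; apply: (@continuous_comp _ _ _ fst (fun x => 'D_e phi x)); first exact: cvg_fst.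
    exact: Cphi.2.
  apply/funext => y; rewrite /space_derive /=.
  rewrite (deriveZ (f := phi) (psi y.2)) //.
  exact/diff_derivable/Cphi.1.
- by exists K => // z nK; rewrite phi0 ?mulr0.
Qed.

End continuously_differentiable.

Section Rintegral_lemmas.
Context {R : realType} d (T : measurableType d) (mu : {measure set T -> \bar R}).
Variables (D : set T) (mD : measurable D).

Lemma integrable_Rsum I (s : seq I) (F : I -> T -> R) :
  (forall i, mu.-integrable D (EFin \o F i)) ->
  mu.-integrable D (EFin \o (fun x => \sum_(i <- s) F i x)).
Proof.
move=> Fi; rewrite (_ : EFin \o _ = (fun x => \sum_(i <- s) (EFin \o F i) x)%E).
  by apply: integrable_sum => // i _; exact: Fi.
by apply/funext => x /=; rewrite sumEFin.
Qed.

Lemma Rintegral_sum I (s : seq I) (F : I -> T -> R) :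
  (forall i, mu.-integrable D (EFin \o F i)) ->
  \int[mu]_(x in D) (\sum_(i <- s) F i x) = \sum_(i <- s) \int[mu]_(x in D) F i x.
Proof.
move=> Fi; elim: s => [|i s ih].
  under eq_Rintegral do rewrite big_nil; rewrite big_nil.
  by rewrite Rintegral_cst// mul0r.
under eq_Rintegral do rewrite big_cons; rewrite big_cons RintegralD// ?ih//.
exact: integrable_Rsum.
Qed.

Lemma ae_eq_Rintegral (f g : T -> R) : measurable_fun D f -> measurable_fun D g ->
  {ae mu, forall x, D x -> f x = g x} ->
  \int[mu]_(x in D) f x = \int[mu]_(x in D) g x.
Proof.
move=> mf mg fg; congr fine; apply: ae_eq_integral => //.
- exact/measurable_EFinP.
- exact/measurable_EFinP.
- by apply: filterS fg => x fgx Dx; rewrite fgx.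
Qed.

Lemma Rintegral_lim0 (f_ : nat -> T -> R) (f g : T -> R) :
  (forall n, measurable_fun D (f_ n)) -> measurable_fun D f ->
  {ae mu, forall x, D x -> f_ n x @[n --> \oo] --> f x} ->
  mu.-integrable D (EFin \o g) ->
  (forall n x, D x -> `|f_ n x| <= g x) ->
  (forall n, \int[mu]_(x in D) f_ n x = 0) -> \int[mu]_(x in D) f x = 0.
Proof.
move=> mf_ mf cf ig fg f0.
have cf' : {ae mu, forall x, D x -> (f_ n x)%:E @[n --> \oo] --> (f x)%:E}.
  by apply: filterS cf => x fx Dx; apply: cvg_EFin; [exact: nearW|exact: fx].
have domf : {ae mu, forall x, forall n, D x -> (`|(f_ n x)%:E| <= (g x)%:E)%E}.
  by apply: aeW => x n Dx; rewrite /= lee_fin; exact: fg.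
have [_ _] := dominated_convergence mD
  (fun n => (measurable_EFinP _ _).2 (mf_ n)) ((measurable_EFinP _ _).2 mf) cf' ig domf.
rewrite (_ : [sequence _]_n = cst 0%E); last first.
  apply/funext => n; rewrite -[RHS]/((0 : R)%:E) -(f0 n) /Rintegral fineK//; apply: integrable_fin_num => //.
  apply: le_integrable ig => //; first exact/measurable_EFinP.
  by move=> x Dx /=; rewrite lee_fin (le_trans (fg n x Dx))// ler_norm.
move=> c0; rewrite /Rintegral.
by rewrite (_ : integral _ _ _ = 0%E)//; apply/esym; apply: (cvg_unique _ _ c0) => //; exact: cvg_cst.
Qed.

End Rintegral_lemmas.

Section ramp.
Context {R : realType}.

(** Equal to 1 for [t >= 0] and to 0 for [t <= -1/(n+1)], linear in between. The limit is the
    indicator of [t >= 0] at every point, including 0, so no null set of directions has to be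
    discarded. *)
Definition ramp (n : nat) (t : R) := Num.max 0 (1 - Num.max 0 (- (n.+1%:R * t))).

Lemma ramp_bound n t : 0 <= ramp n t <= 1.
Proof. by rewrite le_max lexx/= ge_max ler01 gerBl le_max lexx. Qed.

Lemma continuous_ramp n : continuous (ramp n).
Proof.
have c1 (f : R -> R) : continuous f -> continuous (fun t => Num.max 0 (f t)).
  move=> cf t; apply: (@continuous_comp _ _ _ f (fun t => Num.max 0 t)); first exact: cf.
  exact: continuous_max0.
apply: (c1); rewrite (_ : (fun _ => _) = (fun t => 1 + (-1) * Num.max 0 (- n.+1%:R * t))).
  apply: continuous_addr; first exact: cst_continuous.
  apply: continuous_mulr; first exact: cst_continuous.
  apply: (c1); apply: continuous_mulr; first exact: cst_continuous.
  by move=> t; exact: cvg_id.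
by apply/funext => t; rewrite mulN1r mulNr.
Qed.

Lemma near_natmul_ge (t c : R) : 0 < t -> \forall n \near \oo, c <= n.+1%:R * t.
Proof.
move=> t0; near=> n; rewrite -ler_pdivrMr//.
apply: le_trans (ltW (truncnS_gt _)) _.
by rewrite ler_nat ltnS; near: n; exact: nbhs_infty_ge.
Unshelve. all: by end_near. Qed.

Lemma ramp_near t : \forall n \near \oo, ramp n t = (0 <= t)%R%:R.
Proof.
have [t0|t0] := leP 0 t.
  apply: nearW => n; rewrite /ramp (max_l (_ : - (n.+1%:R * t) <= 0)).
    by rewrite subr0 max_r.
  by rewrite oppr_le0 mulr_ge0.
have t0' : 0 < - t by rewrite oppr_gt0.
apply: filterS (near_natmul_ge 1 t0') => n; rewrite mulrN => h.
by rewrite /ramp (max_r (le_trans ler01 h)) max_l// subr_le0.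
Qed.

(** The shift by 1 makes the function vanish for [t <= 1/(n+1)], so a product over the faces of a
    cell is supported in a compact subset of its interior. *)
Lemma smooth_step_near (t : R) :
  \forall n \near \oo, smooth_step (n.+1%:R * t - 1) = (0 < t)%R%:R.
Proof.
have [t0|t0] := ltP 0 t.
  apply: filterS (near_natmul_ge 2 t0) => n h.
  by rewrite smooth_step_ge1//; lra.
apply: nearW => n; rewrite smooth_step_le0// subr_le0.
by apply: (@le_trans _ _ 0) => //; rewrite mulr_ge0_le0.
Qed.

Lemma prod_indicator m (P : 'I_m -> bool) :
  \prod_j (P j)%:R = [forall j, P j]%:R :> R.
Proof.
have [/forallP h|/forallPn[j nj]] := boolP [forall j, P j].
  by apply: big1 => j _; rewrite h.
by rewrite (bigD1 j)//= (negbTE nj) mul0r.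
Qed.

Lemma prod_le1 m (F : 'I_m -> R) : (forall j, 0 <= F j <= 1) -> 0 <= \prod_j F j <= 1.
Proof.
move=> h; apply/andP; split.
  by apply: prodr_ge0 => j _; case/andP: (h j).
by apply: prodr_ile1 => j _; exact: h.
Qed.

End ramp.

(** * Indicators of cells and cones as limits of test functions *)

Section orthogonality.
Context {R : realType} (d N m : nat).
Notation E := 'rV[R]_d.
Notation mu := (@phase_measure R d).
Variables (Om : set E) (a : 'I_N -> 'I_m -> E) (b : 'I_N -> 'I_m -> R).
Variables (rad : R) (HP : polytopal Om a b rad).
Notation D := (phase Om).
Variable gam : E * E -> R.
Hypothesis igam : mu.-integrable D (EFin \o gam).
Hypothesis gam0 : forall xi, test_function Om xi ->
  \int[mu]_(z in D) (gam z * xi z) = 0.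

Definition cone l (c : 'I_l -> E) : set E := [set s | forall j, 0 <= dot (c j) s].

Lemma measurable_cone l (c : 'I_l -> E) : measurable (cone c).
Proof.
rewrite (_ : cone c = poly c (fun=> 0)); first exact: measurable_poly.
by apply/seteqP; split=> s h j; have := h j; rewrite addr0.
Qed.

(** The factors [phi n] live on the cell shrunk by [1/(n+1)] in each inequality and tend to its
    indicator off the faces; the factors [psi n] tend everywhere to the affine function cut off to
    the cone. All products are bounded by [P] on [D], so [P |gam|] dominates. *)
Lemma orthogonal_cell i l (c : 'I_l -> E) (u : E) (v : R) :
  \int[mu]_(z in D) (gam z * ((dot u z.2 + v) * \1_(cone c) z.2 * \1_(poly (a i) (b i)) z.1)) = 0.
Proof.
pose phi n (x : E) : R := \prod_j smooth_step (n.+1%:R * (dot (a i j) x + b i j) - 1).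
pose psi n (s : E) : R := (dot u s + v) * \prod_j ramp n (dot (c j) s).
pose xi n (z : E * E) := psi n z.2 * phi n z.1.
have txi n : test_function Om (xi n).
  apply: (@test_function_tensor R d Om (poly (a i) (fun j => b i j - n.+1%:R^-1))).
  - apply: C1_prod => j; apply: C1_smooth_step.
    rewrite (_ : (fun _ => _) = (fun x => dot (n.+1%:R *: a i j) x + (n.+1%:R * b i j - 1))).
      exact: C1_affine.
    by apply/funext => x; rewrite dotZl mulrDr addrA.
  - apply: continuous_mulr; first exact: continuous_affine.
    have cr j : continuous (fun s : E => ramp n (dot (c j) s)).
      move=> s; apply: (@continuous_comp _ _ _ (fun s => dot (c j) s) (ramp n)).
        rewrite (_ : (fun s => _) = (fun s : E => dot (c j) s + 0)).
          exact: continuous_affine.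
        by apply/funext => y; rewrite addr0.
      exact: continuous_ramp.
    rewrite (_ : (fun s => _) = (fun s : E => \prod_(j <- index_enum 'I_l) ramp n (dot (c j) s)))//.
    elim: (index_enum _) => [|j s ih].
      under eq_fun do rewrite big_nil; exact: cst_continuous.
    by under eq_fun do rewrite big_cons; exact: continuous_mulr.
  - have sub : poly (a i) (fun j => b i j - n.+1%:R^-1) `<=` poly (a i) (b i).
      move=> x h j; have := h j; rewrite addrA subr_ge0; apply: le_trans.
      by rewrite invr_ge0.
    apply: bounded_closed_compact; last exact: closed_poly.
    exists `|rad|; split; first exact: num_real.
    move=> M M1 x /sub/(polytopal_bounded HP) xc; apply/ltW; apply: le_lt_trans M1.
    rewrite -[`|x|]/(mx_norm x).
    have [->//|/mx_norm_neq0[k ->]] := eqVneq (mx_norm x) 0.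
    by rewrite (ord1 k.1) (le_trans (xc _))// ler_norm.
  - apply: subset_trans (polytopal_interior HP (i := i)) => x h j.
    by have := h j; rewrite addrA subr_ge0; apply: lt_le_trans; rewrite invr_gt0.
  - move=> x nx; apply/eqP; rewrite /phi.
    have [j /negP nj] : exists j, ~ (0 <= dot (a i j) x + (b i j - n.+1%:R^-1)).
      by apply/existsNP.
    rewrite (bigD1 j)//= smooth_step_le0 ?mul0r//.
    rewrite addrA subr_ge0 -ltNge in nj.
    by rewrite subr_le0 -ler_pdivlMl// mulr1 ltW.
have mD := measurable_phase HP.
have muD : (mu D < +oo)%E by exact: phase_lty HP.
have mgam : measurable_fun D gam.
  by apply/measurable_EFinP; case/integrableP: igam.
pose P := enorm u + `|v|.
have uP z : D z -> `|dot u z.2 + v| <= P.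
  move=> [_ sz]; apply: le_trans (ler_normD _ _) _; rewrite lerD2r.
  by apply: le_trans (CauchySchwarz_dot _ _) _; rewrite sz mulr1.
apply: (@Rintegral_lim0 _ _ _ mu D mD (fun n z => gam z * xi n z) _ (fun z => P * `|gam z|)) => //.
- move=> n; apply: measurable_funM => //; apply: measurable_funTS.
  exact: measurable_test (txi n).
- apply: measurable_funM => //; apply: measurable_funTS.
  apply: measurable_funM; first apply: measurable_funM.
  + apply: (measurableT_comp (measurable_affine u v)); exact: measurable_snd.
  + apply: measurableT_comp; last exact: measurable_snd.
    by apply: measurable_indic; exact: measurable_cone.
  + apply: measurableT_comp; last exact: measurable_fst.
    by apply: measurable_indic; exact: measurable_poly.
- apply: filterS (phase_ae_fst (ae_off_faces HP)) => z noface Dz.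
  apply: cvg_near_cst.
  have n1 : \forall n \near \oo, forall j, ramp n (dot (c j) z.2) = (0 <= dot (c j) z.2)%R%:R.
    by apply: filter_forall => j; exact: ramp_near.
  have n2 : \forall n \near \oo, forall j,
      smooth_step (n.+1%:R * (dot (a i j) z.1 + b i j) - 1) = (0 < dot (a i j) z.1 + b i j)%R%:R.
    by apply: filter_forall => j; exact: smooth_step_near.
  apply: filterS2 n1 n2 => n h1 h2.
  rewrite /xi /psi /phi (eq_bigr _ (fun j _ => h1 j)).
  rewrite [X in _ * (_ * X)](eq_bigr _ (fun j _ => h2 j)).
  rewrite !prod_indicator !indicE; congr (_ * (_ * (nat_of_bool _)%:R * (nat_of_bool _)%:R)).
    by apply/forallP/idP => [h|]; [apply/mem_set|move/set_mem].
  apply/forallP/idP => [h|/set_mem h j].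
    by apply/mem_set => j; exact/ltW/h.
  by rewrite lt_neqAle eq_sym noface h.
- rewrite (_ : EFin \o _ = (fun z => P%:E * (EFin \o (normr \o gam)) z)%E)//.
  by apply: integrableZl => //; exact: integrable_norm.
- move=> n z Dz; rewrite normrM mulrC ler_wpM2r// /xi /psi !normrM.
  have /andP[p1 p2] : 0 <= \prod_j ramp n (dot (c j) z.2) <= 1.
    by apply: prod_le1 => j; exact: ramp_bound.
  have /andP[q1 q2] : 0 <= phi n z.1 <= 1.
    by apply: prod_le1 => j; exact: smooth_step_bound.
  rewrite (ger0_norm p1) (ger0_norm q1).
  rewrite -[leRHS]mulr1; apply: ler_pM => //; first by rewrite mulr_ge0.
  by rewrite -[leRHS]mulr1; apply: ler_pM => //; exact: uP.
- by move=> n; exact: gam0 (txi n).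
Qed.

Lemma bdd_cell i l (c : 'I_l -> E) (u : E) (v : R) : bdd_meas D
  (fun z => (dot u z.2 + v) * \1_(cone c) z.2 * \1_(poly (a i) (b i)) z.1).
Proof.
apply: bdd_measM; first apply: bdd_measM.
- split.
    apply: measurable_funTS.
    by apply: (measurableT_comp (measurable_affine u v)); exact: measurable_snd.
  exists (enorm u + `|v|) => z [_ sz]; apply: le_trans (ler_normD _ _) _; rewrite lerD2r.
  by apply: le_trans (CauchySchwarz_dot _ _) _; rewrite sz mulr1.
- apply: (@bdd_meas_snd R d D \1_(cone c)).
  by apply: bdd_meas_indic; exact: measurable_cone.
- apply: (@bdd_meas_fst R d D \1_(poly (a i) (b i))).
  by apply: bdd_meas_indic; exact: measurable_poly.
Qed.

Lemma orthogonal_tensor M l (c : 'I_M -> 'I_l -> E) (u : 'I_M -> E) (v : 'I_M -> R)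
    (cst : 'I_N -> R) (f x : E -> R) :
  (forall s, sphere s -> f s = \sum_k (dot (u k) s + v k) * \1_(cone (c k)) s) ->
  (forall r, x r = \sum_i cst i * \1_(poly (a i) (b i)) r) ->
  \int[mu]_(z in D) (gam z * (f z.2 * x z.1)) = 0.
Proof.
move=> fE xE.
have mD := measurable_phase HP.
pose F (p : 'I_M * 'I_N) z := gam z * ((dot (u p.1) z.2 + v p.1) *
  \1_(cone (c p.1)) z.2 * \1_(poly (a p.2) (b p.2)) z.1).
rewrite (@eq_Rintegral _ _ _ mu D (fun z => \sum_(p <- index_enum _) cst p.2 * F p z)); last first.
  move=> z /set_mem[_ sz]; rewrite fE// xE.
  rewrite [RHS](eq_bigr (fun p => cst p.2 * F (p.1, p.2) z)); last by case.
  rewrite -(pair_bigA _ (fun k i => cst i * F (k, i) z)) /= mulr_suml mulr_sumr.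
  apply: eq_bigr => k _; rewrite !mulr_sumr; apply: eq_bigr => i _.
  by rewrite /F /=; ring.
have iF p : mu.-integrable D (EFin \o F p).
  by apply: integrable_bddM => //; exact: bdd_cell.
rewrite Rintegral_sum//; last first.
  move=> p; rewrite (_ : EFin \o _ = (fun z => (cst p.2)%:E * (EFin \o F p) z)%E)//.
  exact: integrableZl.
apply: big1 => p _; rewrite RintegralZl//.
by rewrite orthogonal_cell mulr0.
Qed.

End orthogonality.

(** * Hausdorff measure of the boundary *)

Section layers.
Context {R : realType} (T : Type) (mu : {outer_measure set T -> \bar R}).
Local Open Scope ereal_scope.

(* The measures of the layers telescope: [mu (S k.+2 `\` S k.+1) <= mu (S k.+2) - mu (S k)],
   so that the layers beyond a large index have small total measure. *)
Lemma outer_measure_layers (X A : set T) (S : nat -> set T) :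
  (forall k, S k `<=` S k.+1) -> X `&` A = \bigcup_k S k ->
  (forall k, mu (S k) + mu (S k.+2 `\` S k.+1) <= mu (S k.+2)) ->
  (forall k, mu (S k) + mu (X `&` ~` A) <= mu X) ->
  mu (X `&` A) + mu (X `&` ~` A) <= mu X.
Proof.
move=> ndS XAS sep1 sep2.
have [Xoo|Xoo] := leP +oo (mu X); first by rewrite (le_trans (leey _)).
have finS (B : set T) : B `<=` X -> mu B \is a fin_num.
  move=> BX; rewrite ge0_fin_numE ?outer_measure_ge0//.
  by apply: le_lt_trans Xoo; exact: le_outer_measure.
have SX k : S k `<=` X.
  by move=> x Sx; have : (X `&` A) x by [rewrite XAS; exists k]; case.
have SD k : S k.+2 `\` S k.+1 `<=` X by move=> x [/SX].
have fS k := finS _ (SX k).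
have fD k := finS _ (SD k).
have fb : mu (X `&` ~` A) \is a fin_num by apply: finS; exact: subIsetl.
have fX : mu X \is a fin_num by exact: finS.
pose al k := fine (mu (S k)).
have alE k : mu (S k) = (al k)%:E by rewrite fineK.
pose be := fine (mu (X `&` ~` A)).
have beE : mu (X `&` ~` A) = be%:E by rewrite fineK.
pose M := fine (mu X).
have ME : mu X = M%:E by rewrite fineK.
have albe k : (al k + be <= M)%R.
  by have := sep2 k; rewrite alE beE ME -EFinD lee_fin.
have nd k : (al k <= al k.+1)%R.
  by rewrite -lee_fin -!alE le_outer_measure.
have Dle k : mu (S k.+2 `\` S k.+1) <= (al k.+2 - al k)%:E.
  have := sep1 k; rewrite !alE -(fineK (fD k)) -EFinD !lee_fin.
  by rewrite lerBrDl.
pose L := sup (range al).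
have hS : has_sup (range al).
  split; first by exists (al 0%N); exists 0%N.
  by exists (M - be)%R => _ [k _ <-]; rewrite lerBrDr.
have alL k : (al k <= L)%R by apply: sup_upper_bound => //; exists k.
have Lbe : (L <= M - be)%R.
  apply: ge_sup; first by exists (al 0%N); exists 0%N.
  by move=> _ [k _ <-]; rewrite lerBrDr.
(* Cover by [S k.+1] and the layers beyond it. After [n] layers the bounds sum to
   [al (k + n).+1 + al (k + n) - al k], at most [2 L - al k], which comes arbitrarily close to
   [L]. *)
have key k : mu (X `&` A) <= (2 * L - al k)%:E.
  pose G n := if n is i.+1 then S (k + i).+2 `\` S (k + i).+1 else S k.+1.
  have cover : X `&` A `<=` \bigcup_n G n.
    rewrite XAS => x [n _ Snx].
    have [n1 n1P n1min] := ex_minnP (P := fun n => `[< S n x >]) (ex_intro _ n (asboolT Snx)).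
    have [n1k|kn1] := leqP n1 k.+1.
      exists 0%N => //=; move/asboolP: n1P.
      elim: k.+1 n1k => [|p ih]; first by rewrite leqn0 => /eqP ->.
      by rewrite leq_eqVlt => /predU1P[->//|]; rewrite ltnS => /ih h /h /ndS.
    exists (n1 - k.+1)%N => //.
    have [i iE] : exists i, n1 = (k + i).+2.
      by exists (n1 - k.+2)%N; rewrite -addSn -addSn subnKC.
    rewrite iE subSS -addnS addnC addnK /=; split.
      by apply/asboolP; rewrite -iE.
    move=> Sx; have := n1min _ (asboolT Sx).
    by rewrite iE ltnn.
  apply: le_trans (le_outer_measure mu _ _ cover) _.
  apply: le_trans (outer_measure_sigma_subadditive _ _) _.
  apply: lime_le; first by apply: is_cvg_nneseries => n _ _; exact: outer_measure_ge0.
  have al0 : (0 <= al k)%R by apply: fine_ge0; exact: outer_measure_ge0.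
  apply: nearW => -[|n].
    by rewrite big_nil lee_fin; have := alL k; lra.
  rewrite big_nat_recl//= alE.
  have : \sum_(0 <= i < n) mu (S (k + i).+2 `\` S (k + i).+1) <=
      (al (k + n).+1 + al (k + n)%N - al k.+1 - al k)%:E.
    elim: n => [|n ih]; first by rewrite big_nil addn0 lee_fin; lra.
    rewrite big_nat_recr//=; apply: le_trans (leeD ih (Dle _)) _.
    by rewrite -EFinD lee_fin addnS; lra.
  move=> h; apply: le_trans (leeD2l _ h) _.
  rewrite -EFinD lee_fin; have := alL (k + n).+1; have := alL (k + n)%N; lra.
rewrite beE ME -leeBrDr// -EFinB.
apply/lee_addgt0Pr => e e0.
have [_ [k _ <-] ke] := sup_adherent e0 hS.
apply: le_trans (key k) _; rewrite -EFinD lee_fin.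
by move: ke; rewrite -/L => ke; lra.
Qed.

End layers.

Section hausdorff_metric.
Context {R : realType} (d m : nat).
Notation E := 'rV[R]_d.
Notation H := (@hausdorff R d m).
Local Open Scope ereal_scope.

Lemma hausdorff_gauge_set0 e : @hausdorff_gauge R d m e set0 = 0.
Proof. by rewrite /hausdorff_gauge asboolT. Qed.

Lemma hausdorff_gauge_ge0 e (A : set E) : 0 <= hausdorff_gauge m e A.
Proof.
rewrite /hausdorff_gauge; case: asboolP => // /eqP/set0P A0.
case: ifPn => // _; rewrite lee_fin mulr_ge0 ?fine_ge0//.
by rewrite exprn_ge0// divr_ge0// fine_ge0// ediam_ge0.
Qed.

Lemma hausdorff_gauge_le e e' (A : set E) : (e <= e')%R ->
  hausdorff_gauge m e' A <= hausdorff_gauge m e A.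
Proof.
move=> ee'; rewrite /hausdorff_gauge; case: asboolP => // _.
have [h|h] := boolP (ediam A <= e%:E); last by rewrite leey.
by rewrite (le_trans h) ?lee_fin.
Qed.

Notation He e := (mu_ext (@hausdorff_gauge R d m e)).

Lemma hausdorff_ext_le e e' (A : set E) : (e <= e')%R -> He e' A <= He e A.
Proof.
move=> ee'; apply: le_ereal_inf_tmp => _ [F cF <-].
apply: le_trans (_ : \sum_(k <oo) hausdorff_gauge m e' (F k) <= _).
  by apply: ereal_inf_lbound; exists F.
apply: lee_nneseries => [k _ _|k _]; first exact: hausdorff_gauge_ge0.
exact: hausdorff_gauge_le.
Qed.

Lemma le_ediam (A : set E) x y : A x -> A y -> (enorm (x - y))%:E <= ediam A.
Proof. by move=> Ax Ay; apply: ereal_sup_ubound; exists (x, y). Qed.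

Definition separated (A B : set E) := exists2 del : R, (0 < del)%R &
  forall x y, A x -> B y -> (del <= enorm (x - y))%R.

(** A covering set of finite gauge has diameter at most [e < del], so it cannot meet both [A] and
    [B]; every cover of the union splits into a cover of each. *)
Lemma hausdorff_ext_separated e del (A B : set E) : (e < del)%R ->
  (forall x y, A x -> B y -> (del <= enorm (x - y))%R) ->
  He e A + He e B <= He e (A `|` B).
Proof.
move=> edel sep; apply: le_ereal_inf_tmp => _ [F [mF cF] <-].
pose G C k := if `[< F k `&` C !=set0 >] then F k else set0.
have mG C k : measurable (G C k) by rewrite /G; case: ifP.
have GC C : C `<=` A `|` B -> He e C <= \sum_(k <oo) hausdorff_gauge m e (G C k).
  move=> CAB; apply: ereal_inf_lbound; exists (G C) => //; split=> // x Cx.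
  have [k _ Fx] := cF _ (CAB _ Cx); exists k => //.
  by rewrite /G asboolT//; exists x.
apply: (@le_trans _ _ (\sum_(k <oo) (hausdorff_gauge m e (G A k) + hausdorff_gauge m e (G B k)))).
  rewrite nneseriesD; last 2 first.
    by move=> *; exact: hausdorff_gauge_ge0.
    by move=> *; exact: hausdorff_gauge_ge0.
  by apply: leeD; apply: GC; [exact: subsetUl|exact: subsetUr].
apply: lee_nneseries => [k _ _|k _].
  by rewrite adde_ge0// hausdorff_gauge_ge0.
rewrite /G; case: asboolP => [[x [Fx Ax]]|_]; last first.
  rewrite hausdorff_gauge_set0 add0e; case: asboolP => // _.
  by rewrite hausdorff_gauge_set0 hausdorff_gauge_ge0.
case: asboolP => [[y [Fy By]]|_]; last by rewrite hausdorff_gauge_set0 adde0.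
suff -> : hausdorff_gauge m e (F k) = +oo by rewrite leey.
rewrite /hausdorff_gauge; case: asboolP => [F0|_]; first by move: Fx; rewrite F0.
case: ifPn => // h; exfalso.
have := le_trans (le_ediam Fx Fy) h; rewrite lee_fin leNgt => /negP; apply.
exact: lt_le_trans (sep _ _ Ax By).
Qed.

Lemma hausdorff_ge0 (A : set E) : 0 <= H A.
Proof. exact: outer_measure_ge0. Qed.

(** The two suprema are reached independently: any pair of scales is compared with a common smaller
    one, at which the outer measures are larger. Finiteness permits moving terms across the
    inequality. *)
Lemma hausdorff_separated (A B : set E) : separated A B ->
  H A + H B <= H (A `|` B).
Proof.
move=> [del del0 sep].
have key e1 e2 : (0 < e1)%R -> (0 < e2)%R -> He e1 A + He e2 B <= H (A `|` B).
  move=> e10 e20; pose e := Num.min (Num.min e1 e2) (del / 2)%R.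
  have e0 : (0 < e)%R by rewrite !lt_min e10 e20 divr_gt0.
  have ee1 : (e <= e1)%R by rewrite !ge_min lexx.
  have ee2 : (e <= e2)%R by rewrite !ge_min lexx orbT.
  have edel : (e < del)%R.
    by apply: (@le_lt_trans _ _ (del / 2)%R); [rewrite ge_min lexx orbT|lra].
  apply: (@le_trans _ _ (He e A + He e B)).
    by apply: leeD; exact: hausdorff_ext_le.
  apply: le_trans (hausdorff_ext_separated edel sep) _.
  by apply: ereal_sup_ubound; exists e.
have He0 e C : 0 <= He e C by apply: mu_ext_ge0 => D; exact: hausdorff_gauge_ge0.
have [oo|fin] := leP +oo (H (A `|` B)); first by rewrite (le_trans (leey _)).
have fAB : H (A `|` B) \is a fin_num by rewrite ge0_fin_numE// hausdorff_ge0.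
have fB e2 : (0 < e2)%R -> He e2 B \is a fin_num.
  move=> e20; rewrite ge0_fin_numE//; apply: le_lt_trans fin.
  by apply: le_trans (key _ _ e20 e20); rewrite leeDr.
have fA : H A \is a fin_num.
  rewrite ge0_fin_numE ?hausdorff_ge0//; apply: le_lt_trans fin.
  by apply: le_outer_measure; exact: subsetUl.
have hA e2 : (0 < e2)%R -> H A + He e2 B <= H (A `|` B).
  move=> e20; rewrite -leeBrDr ?fB//; apply: ge_ereal_sup => _ [e1 e10 <-].
  by rewrite leeBrDr ?fB// key.
rewrite addeC -leeBrDr//; apply: ge_ereal_sup => _ [e2 e20 <-].
by rewrite leeBrDr// addeC hA.
Qed.

Lemma coord_separated (A B : set E) i (c c' : R) : (c < c')%R ->
  (forall x, A x -> (c' <= x ord0 i)%R) -> (forall y, B y -> (y ord0 i <= c)%R) ->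
  separated A B.
Proof.
move=> cc' hA hB; exists (c' - c)%R; first by rewrite subr_gt0.
move=> x y Ax By; apply: le_trans (ler_coord_enorm _ i).
rewrite !mxE; apply: le_trans (ler_norm _); have := hA x Ax; have := hB y By; lra.
Qed.

(** Caratheodory's criterion for metric outer measures, run on the half-spaces that generate the
    Borel sets. The thresholds [t k] decrease to [c], and the gap between [t k.+1] and [t k]
    separates [S k] from the layer [S k.+2] minus [S k.+1]. *)
Lemma caratheodory_halfspace i (c : R) :
  (H : {outer_measure set E -> \bar R}).-caratheodory [set x : E | (c < x ord0 i)%R].
Proof.
set A := [set _ | _]; apply: le_caratheodory_measurable => X.
pose t k : R := (c + k.+1%:R^-1)%R.
have tlt k : (t k.+1 < t k)%R by rewrite ltrD2l ltf_pV2 ?posrE// ltr_nat.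
have t0 k : (c < t k)%R by rewrite ltrDl invr_gt0.
pose S k := X `&` [set x : E | (t k <= x ord0 i)%R].
apply: (@outer_measure_layers R E H X A S).
- by move=> k x [Xx tx]; split => //=; apply: le_trans (ltW (tlt _)) tx.
- apply/seteqP; split=> [x [Xx Ax]|x [k _ [Xx tx]]]; last first.
    by split=> //=; apply: lt_le_trans tx.
  have dx : (0 < x ord0 i - c)%R by rewrite subr_gt0.
  exists (truncn (x ord0 i - c)^-1) => //; split=> //=.
  by rewrite -lerBrDl invf_ple ?posrE//; apply/ltW/truncnS_gt.
- move=> k; apply: le_trans (hausdorff_separated _) _.
    apply: (@coord_separated _ _ i (t k.+1) (t k)) => // [x []//|y [[Xy _] nSy]].
    by rewrite leNgt; apply/negP => h; apply: nSy; split => //=; exact: ltW.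
  apply: le_outer_measure => x [[Xx tx]|[]//]; split=> //=.
  by apply: le_trans tx; apply: ltW; apply: lt_trans (tlt k).
- move=> k; apply: le_trans (hausdorff_separated _) _.
    apply: (@coord_separated _ _ i c (t k)) => // [x []//|y [_ /negP]].
    by rewrite -leNgt.
  by apply: le_outer_measure => x [|] [].
Qed.

End hausdorff_metric.

(** * Finiteness of the Hausdorff measure on parallelotopes and facets *)

Section hausdorff_finite.
Context {R : realType} (d m : nat).
Notation E := 'rV[R]_d.
Notation H := (@hausdorff R d m).
Local Open Scope ereal_scope.

(** The number of sets and the [m]-th power of their diameters balance: the total gauge is at most
    the volume of the unit ball times [(C / 2)^m], whatever [n]. *)
Lemma hausdorff_cover_lty (A : set E) (C : R) : (0 <= C)%R ->
  (forall n, exists M (F : 'I_M -> set E), [/\ (M <= n.+1 ^ m)%N,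
     forall i, measurable (F i), forall i, ediam (F i) <= (C / n.+1%:R)%:E &
     A `<=` \bigcup_(i in [set: 'I_M]) F i]) ->
  H A < +oo.
Proof.
move=> C0 cov; pose om : R := fine (lebesgue_rV m (@uball R m)).
have om0 : (0 <= om)%R by apply: fine_ge0; exact: measure_ge0.
suff : H A <= (om * (C / 2) ^+ m)%:E by move=> h; apply: le_lt_trans h (ltry _).
apply: ge_ereal_sup => _ [e /= e0 <-].
have [n ne] : exists n, (C / n.+1%:R <= e)%R.
  exists (truncn (C / e)); rewrite ler_pdivrMr// mulrC -ler_pdivrMr//.
  exact/ltW/truncnS_gt.
have [M [F [Mn mF dF AF]]] := cov n.
pose G k := if insub k is Some i then F i else set0.
pose c := (om * (C / 2 / n.+1%:R) ^+ m)%R.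
have c0 : (0 <= c)%R by rewrite mulr_ge0// exprn_ge0// !divr_ge0.
have gG k : hausdorff_gauge m e (G k) <= (if (k < M)%N then c else 0)%:E.
  rewrite /G; case: insubP => [i iM <-|/negbTE ->]; last by rewrite hausdorff_gauge_set0.
  rewrite ltn_ord /hausdorff_gauge; case: asboolP => [_|/eqP/set0P F0]; first by rewrite lee_fin.
  rewrite (le_trans (dF i)) ?lee_fin// ler_wpM2l// lerXn2r ?nnegrE//.
  - by rewrite divr_ge0// fine_ge0// ediam_ge0.
  - by rewrite !divr_ge0.
  - rewrite mulrAC ler_wpM2r// -lee_fin fineK// ge0_fin_numE ?ediam_ge0//.
    by apply: le_lt_trans (dF i) (ltry _).
apply: (@le_trans _ _ (\sum_(k <oo) hausdorff_gauge m e (G k))).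
  apply: ereal_inf_lbound; exists G => //; split.
    by move=> k; rewrite /G; case: insubP.
  move=> x /AF[i _ Fx]; exists i => //.
  by rewrite /G valK.
apply: lime_le.
  by apply: is_cvg_nneseries => k _ _; exact: hausdorff_gauge_ge0.
apply: nearW => p.
apply: (@le_trans _ _ (M%:R * c)%:E).
  apply: (@le_trans _ _ ((minn p M)%:R * c)%:E); last first.
    by rewrite lee_fin ler_wpM2r// ler_nat geq_minr.
  elim: p => [|p ih]; first by rewrite big_nil min0n mul0r.
  rewrite big_nat_recr//=; apply: le_trans (leeD ih (gG p)) _.
  rewrite -EFinD lee_fin; case: ltnP => pM.
    by rewrite (minn_idPl pM) -natr1 mulrDl mul1r.
  by rewrite (minn_idPr (leqW pM)) addr0.
rewrite lee_fin; apply: (@le_trans _ _ ((n.+1 ^ m)%:R * c)%R).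
  by rewrite ler_wpM2r// ler_nat.
rewrite /c mulrCA natrX -exprMn ler_wpM2l//.
by rewrite mulrCA mulfV ?mulr1.
Qed.

Lemma measurable_eball (y : E) (r : R) : measurable [set x : E | (enorm (x - y) <= r)%R].
Proof.
rewrite (_ : [set _ | _] = (fun x : E => enorm (x - y)%R) @^-1` `]-oo, r]%classic); last first.
  by apply/seteqP; split=> x /=; rewrite in_itv.
rewrite -[X in measurable X]setTI.
apply: (@measurableT_comp _ _ _ _ _ _ (@enorm R d)) => //.
  exact: measurable_enorm.
exact: measurable_rV_shift.
Qed.

(** A grid of [(n+1)^m] parameters: rounding each [t i] to the grid costs at most [1/(n+1)], so
    balls of radius [L / (n+1)] about the grid points cover [A]. *)
Lemma hausdorff_parallelotope (A : set E) (w : E) (u : 'I_m -> E) :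
  (forall x, A x -> exists t : 'I_m -> R,
     (forall i, 0 <= t i <= 1)%R /\ x = (w + \sum_i t i *: u i)%R) -> H A < +oo.
Proof.
move=> hA; pose L : R := (\sum_i enorm (u i))%R.
have L0 : (0 <= L)%R by apply: sumr_ge0 => i _; exact: enorm_ge0.
apply: (@hausdorff_cover_lty A (2 * L)%R); first by rewrite mulr_ge0.
move=> n; pose y (p : {ffun 'I_m -> 'I_n.+1}) : E :=
  (w + \sum_i ((p i)%:R / n.+1%:R) *: u i)%R.
exists #|{: {ffun 'I_m -> 'I_n.+1}}|,
  (fun k => [set x : E | (enorm (x - y (enum_val k)) <= L / n.+1%:R)%R]); split.
- by rewrite card_ffun !card_ord.
- by move=> k; exact: measurable_eball.
- move=> k; apply: ge_ereal_sup => _ [[x z] /= [hx hz] <-]; rewrite lee_fin.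
  rewrite (_ : x - z = (x - y (enum_val k)) + (- (z - y (enum_val k))))%R; last first.
    by rewrite opprB addrA subrK.
  apply: le_trans (enormD _ _) _; rewrite enormN.
  by move: hx hz; rewrite -mulrA mulr_natl mulr2n; exact: lerD.
move=> x /hA[t [t01 xE]].
(* At [t i = 1] the truncation gives [n + 1], which is no index; the minimum with [n] is still
   within [1/(n+1)]. *)
pose p : {ffun 'I_m -> 'I_n.+1} := [ffun i => inord (minn (truncn (t i * n.+1%:R)%R) n)].
exists (enum_rank p) => //=; rewrite enum_rankK xE /y opprD addrACA subrr add0r.
rewrite -sumrB; apply: (@le_trans _ _ (\sum_i enorm ((t i - (p i)%:R / n.+1%:R) *: u i))%R).
  elim/big_ind2 : _ => [|x1 x2 y1 y2 h1 h2|i _].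
  - by rewrite /enorm /dot big1 ?sqrtr0// => i _; rewrite mxE mul0r.
  - by apply: le_trans (enormD _ _) _; exact: lerD.
  - by rewrite scalerBl.
rewrite /L mulr_suml; apply: ler_sum => i _; rewrite enormZ mulrC ler_wpM2l ?enorm_ge0//.
have /andP[t0 t1] := t01 i.
have n0 : (0 < n.+1%:R :> R)%R by [].
rewrite -(ler_pM2r n0) mulVf ?gt_eqF// -[X in (_ * X)%R](gtr0_norm n0) -normrM mulrBl divfK ?gt_eqF//.
rewrite ffunE inordK ?ltnS ?geq_minr//.
have tn0 : (0 <= t i * n.+1%:R)%R by rewrite mulr_ge0.
have /andP[f1 f2] := truncn_itv tn0.
have tn : (t i * n.+1%:R <= n.+1%:R)%R by rewrite ler_piMl.
move: tn f1 f2; rewrite -natr1 => f0.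
set q := (t i * _)%R in f0 *; rewrite -/q -natr1; set k := truncn _ => f1 f2.
rewrite ler_norml; have [h|h] := leqP k n; first by apply/andP; split; lra.
have : (n%:R + 1 <= k%:R :> R)%R by rewrite natr1 ler_nat.
by move=> h'; apply/andP; split; lra.
Qed.

End hausdorff_finite.

Section boundary_measure.
Context {R : realType} (d : nat).
Notation E := 'rV[R]_d.

Lemma measurable_surface_id :
  measurable_fun [set: surface_type d] (fun r : surface_type d => r : E).
Proof.
apply: measurable_fun_coordP => i.
apply: (measurability _ (RGenOInfty.measurableE R)).
move=> _ [_ [c ->] <-]; rewrite setTI.
have := @caratheodory_halfspace R d d.-1 i c.
rewrite (_ : [set x | _] = (fun r : surface_type d => (r : E) ord0 i) @^-1` `]c, +oo[%classic)//.
by apply/seteqP; split=> x /=; rewrite in_itv/= andbT.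
Qed.

Lemma measurable_surface (A : set E) : measurable A ->
  measurable (A : set (surface_type d)).
Proof.
move=> mA; rewrite -[X in measurable X]setTI.
exact: measurable_surface_id.
Qed.

End boundary_measure.

(** A facet lies in the parallelotope spanned by its [d - 1] edges at one vertex, with barycentric
    coordinates as parameters. *)
Lemma simplex_face_lty (R : realType) d (V : 'M[R]_(d.+1, d)) (j : 'I_d.+1) : (0 < d)%N ->
  (hausdorff d.-1 (simplex_face V (~: [set j])%SET) < +oo)%E.
Proof.
case: d V j => // d V j _ /=.
pose v k := row (lift j k) V.
apply: (@hausdorff_parallelotope _ _ _ _ (v ord0) (fun i => v (lift ord0 i) - v ord0)).
move=> x [l [l0 lJ l1 ->]].
have lj : l ord0 j = 0 by apply: lJ; rewrite !inE eqxx.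
exists (fun i => l ord0 (lift j (lift ord0 i))); split=> [i|].
  rewrite l0 /= -l1 (bigD1 (lift j (lift ord0 i)))//= lerDl.
  by apply: sumr_ge0.
rewrite mulmx_sum_row (bigD1_ord j)//= lj scale0r add0r big_ord_recl/=.
have l1' : l ord0 (lift j ord0) = 1 - \sum_i l ord0 (lift j (lift ord0 i)).
  by move: l1; rewrite (bigD1_ord j)//= lj add0r big_ord_recl => <-; rewrite addrK.
rewrite l1' scalerBl scale1r scaler_suml -addrA; congr (_ + _).
rewrite addrC -sumrB; apply: eq_bigr => i _.
by rewrite scalerBr.
Qed.

(** * Almost everywhere bounds and the optical coefficients *)

Section ae_bounded.
Context {R : realType} d (T : measurableType d) (mu : {measure set T -> \bar R}).
Variables (D : set T) (mD : measurable D) (muD : (mu D < +oo)%E).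
Implicit Types f g : T -> R.

(** Also stable under products, and wide enough for the coefficients, the angular averages and the
    flux [|s . n|], whose bounds may fail on null sets. *)
Definition ae_bdd f := measurable_fun D f /\
  exists M, {ae mu, forall x, D x -> `|f x| <= M}.

Lemma bdd_meas_ae f : bdd_meas D f -> ae_bdd f.
Proof. by move=> [mf [M fM]]; split => //; exists M; exact: aeW. Qed.

Lemma ae_bddM f g : ae_bdd f -> ae_bdd g -> ae_bdd (fun x => f x * g x).
Proof.
move=> [mf [M fM]] [mg [N gN]]; split; first exact: measurable_funM.
exists (M * N); apply: filterS2 fM gN => x fM gN Dx.
by rewrite normrM; apply: ler_pM => //; [exact: fM|exact: gN].
Qed.

Lemma ae_bdd_integrable f : ae_bdd f -> mu.-integrable D (EFin \o f).
Proof.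
move=> [mf [M fM]]; apply/integrableP; split; first exact/measurable_EFinP.
apply: (@le_lt_trans _ _ (\int[mu]_(x in D) `|M|%:E)%E).
  apply: ae_ge0_le_integral => //.
  - by apply: measurableT_comp => //; exact/measurable_EFinP.
  - apply: filterS fM => x fM Dx; rewrite lee_fin.
    by apply: le_trans (fM Dx) (ler_norm _).
by rewrite integral_cst// lte_mul_pinfty// lee_fin.
Qed.

Lemma ae_ge0_Rintegral f : measurable_fun D f ->
  {ae mu, forall x, D x -> 0 <= f x} -> 0 <= \int[mu]_(x in D) f x.
Proof.
move=> mf f0.
rewrite (@ae_eq_Rintegral _ _ _ mu D mD f (fun x => `|f x|)) //.
- by apply: Rintegral_ge0.
- exact: measurableT_comp.
- by apply: filterS f0 => x f0 Dx; rewrite ger0_norm// f0.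
Qed.

Lemma ae_le_Rintegral f g : mu.-integrable D (EFin \o f) ->
  mu.-integrable D (EFin \o g) -> {ae mu, forall x, D x -> f x <= g x} ->
  \int[mu]_(x in D) f x <= \int[mu]_(x in D) g x.
Proof.
move=> fi gi fg; rewrite -subr_ge0 -RintegralB//.
apply: ae_ge0_Rintegral.
- by apply: measurable_funB; apply/measurable_EFinP; [case/integrableP: gi|case/integrableP: fi].
- by apply: filterS fg => x fg Dx; rewrite subr_ge0 fg.
Qed.

End ae_bounded.

Section Linfty.
Context {R : realType} (d : nat).
Notation E := 'rV[R]_d.
Variable Om : set E.

Lemma Linfty_norm_ge0 (f : E -> R) : (0 <= Linfty_norm Om f)%E.
Proof. exact: Lnorm_ge0. Qed.

Lemma Linfty_norm_ae (f : E -> R) : (Linfty_norm Om f < +oo)%E ->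
  {ae lebesgue_rV d, forall r, Om r -> `|f r| <= fine (Linfty_norm Om f)}.
Proof.
have := Linfty_norm_ge0 f.
rewrite /Linfty_norm unlock; case: ifPn => [mu0 ess0 essoo|mu0 _ _].
  have := ess_sup_ge (lebesgue_rV d) (abse \o (fun r => (f r * \1_Om r)%:E)).
  apply: filterS => r; set es := ess_sup _ _ in ess0 essoo *.
  move=> h Or; rewrite -lee_fin fineK ?ge0_fin_numE//.
  by apply: le_trans h; rewrite /= indicE mem_set// mulr1.
(* If the whole space is null, the norm is 0 by convention, and every property holds almost
   everywhere. *)
exists setT; split => //.
by apply/eqP; rewrite eq_le measure_ge0 andbT leNgt.
Qed.

Variables (sigma_s sigma_t sigma_a : E -> R).
Hypothesis Hsigma : optical_data Om sigma_s sigma_t sigma_a.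
Notation rho := (scattering_ratio Om sigma_s sigma_t).

Lemma scattering_ratio_ge0 : 0 <= rho.
Proof. by apply: fine_ge0; exact: Linfty_norm_ge0. Qed.

(* Since [sigma_a >= c0 > 0], the quotient [sigma_s / sigma_t] is at most 1
   almost everywhere; in particular [fine] does not truncate its norm. *)
Lemma optical_data_ae : exists M, {ae lebesgue_rV d, forall r, Om r ->
  [/\ 0 <= sigma_s r, 0 < sigma_t r, sigma_t r <= M & sigma_s r <= rho * sigma_t r]}.
Proof.
have [_ pos [_ tfin] sum [c0 c00 ha]] := Hsigma.
have fin : (Linfty_norm Om (fun r => sigma_s r / sigma_t r)%R < +oo)%E.
  rewrite /Linfty_norm unlock; case: ifPn => [_|_]; last by rewrite ltry.
  apply: (@le_lt_trans _ _ 1%E); last by rewrite ltry.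
  apply/ess_supP; apply: filterS2 pos ha => r pos ha.
  rewrite /= lee_fin indicE; have [Or|nOr] := boolP (r \in Om); last by rewrite mulr0 normr0.
  rewrite mulr1; move/set_mem: Or => Or; have [s0 t0] := pos Or.
  rewrite ger0_norm; last by apply: divr_ge0; exact: ltW.
  rewrite ler_pdivrMr// mul1r (sum r Or) lerDr.
  by apply: le_trans (ha Or); exact: ltW.
exists (fine (Linfty_norm Om sigma_t)).
have h1 := Linfty_norm_ae tfin; have h2 := Linfty_norm_ae fin.
apply: filterS3 pos h1 h2 => r pos h1 h2 Or; have [s0 t0] := pos Or.
split=> //; first exact: ltW.
  by apply: le_trans (ler_norm _) (h1 Or).
by rewrite -ler_pdivrMr//; apply: le_trans (ler_norm _) (h2 Or).
Qed.

End Linfty.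

(** * From the mesh to polytopes and boundary integrals *)

Section boundary_integrals.
Context {R : realType} (d : nat) (d0 : (0 < d)%N).
Notation E := 'rV[R]_d.
Variables (Om : set E) (HOm : lipschitz_domain Om).
Variables (kappa h : R) (N : nat) (T : 'I_N -> 'M[R]_(d.+1, d)).
Hypothesis HT : space_mesh Om kappa h T.

(** An open cell lies in the interior of [closure Om], which a Lipschitz domain contains. A point of
    a simplex with all barycentric coordinates positive is therefore in [Om], and the boundary is
    left with the facets. *)
Lemma space_mesh_polytopal : exists (a : 'I_N -> 'I_d.+1 -> E) b rad,
  [/\ polytopal Om a b rad, forall i, simplex (T i) = poly (a i) (b i) &
   forall i, simplex (T i) `<=` Om `|`
     \bigcup_(j in [set: 'I_d.+1]) simplex_face (T i) (~: [set j])%SET].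
Proof.
have [Tfree clE _ _ _] := HT.
have /choice[a] := fun i => simplex_halfspaces d0 (Tfree i).
move=> /choice[b hab].
have a0 i j : a i j != 0 by have [] := hab i.
have sE i : simplex (T i) = poly (a i) (b i) by have [] := hab i.
have fE i J : simplex_face (T i) J = [set x | (forall j, 0 <= dot (a i j) x + b i j) /\
   forall j, j \notin J -> dot (a i j) x + b i j = 0] by have [] := hab i.
have iOm i : ipoly (a i) (b i) `<=` Om.
  apply: subset_trans (lipschitz_domain_regular HOm) => x ix.
  rewrite /interior; apply: (@filterS _ _ _ (ipoly (a i) (b i))).
    move=> y iy; rewrite clE; exists i => //; rewrite sE => j; exact: ltW.
  apply: (@filter_forall _ _ (fun j => [set y : E | 0 < dot (a i j) y + b i j]) (nbhs x)) => j.
  by apply: open_nbhs_nbhs; split; [exact: open_affine_gt0|exact: ix].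
have /choice[r hr] : forall i, exists r, simplex (T i) `<=` @cube R d r.
  by move=> i; exact: simplex_bounded.
exists a, b, (\sum_i `|r i|); split=> //.
- split=> //.
  + by case: HOm.
  + by rewrite clE; apply: eq_bigcupr => i _; rewrite sE.
  + move=> i x; rewrite -sE => /hr xc k; apply: le_trans (xc k) _.
    apply: le_trans (ler_norm _) _; rewrite (bigD1 i)//= lerDl.
    by apply: sumr_ge0.
- move=> i x; rewrite sE => px.
  have [ix|nix] := pselect (ipoly (a i) (b i) x); first by left; exact: iOm ix.
  right; move/existsNP: nix => [j /negP nj]; exists j => //.
  rewrite fE; split=> // k; rewrite !inE negbK => /eqP ->.
  by apply/eqP; rewrite eq_le px leNgt nj.
Qed.

Lemma measurable_boundary : measurable (boundary Om : set (surface_type d)).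
Proof.
apply: measurable_surface; apply: measurableD.
  rewrite -[closure Om]setCK; apply: measurableC; apply: measurable_open_rV.
  by apply: closed_openC; exact: closed_closure.
by apply: measurable_open_rV; exact: open_interior.
Qed.

Lemma boundary_lty : (surface d (boundary Om) < +oo)%E.
Proof.
have [_ clE _ _ _] := HT.
have [a [b [rad [_ _ sub]]]] := space_mesh_polytopal.
pose F (p : 'I_N * 'I_d.+1) := simplex_face (T p.1) (~: [set p.2])%SET.
have bF : boundary Om `<=` \bigcup_(p in [set: 'I_N * 'I_d.+1]) F p.
  move=> x [cx nix]; move: (cx); rewrite clE => -[i _ /sub[Ox|[j _ Fj]]].
    exfalso; apply: nix; case: HOm => + _ _ _.
    by rewrite openE; apply.
  by exists (i, j).
apply: le_lt_trans (le_outer_measure (hausdorff d.-1) _ _ bF) _.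
rewrite -bigsetU_fset_set; last exact: finite_finset.
have : forall s : seq ('I_N * 'I_d.+1), (hausdorff d.-1 (\big[setU/set0]_(p <- s) F p) < +oo)%E.
  elim=> [|p s ih]; first by rewrite big_nil outer_measure0.
  rewrite big_cons; apply: le_lt_trans (outer_measureU2 _ _ _) _.
  by apply: lte_add_pinfty => //; exact: simplex_face_lty.
exact.
Qed.

Variables (n : E -> E) (Hn : outward_normal_field Om n).
Notation bD := (phase_boundary Om : set (surface_type d * E)).
Notation bmu := (@phase_surface R d).

Lemma measurable_phase_boundary : measurable bD.
Proof.
by apply: measurableX; [exact: measurable_boundary|exact: measurable_sphere].
Qed.

Lemma phase_surfaceX (A : set (surface_type d)) (B : set E) :
  measurable A -> measurable B ->
  bmu (A `*` B) = (surface d A * sphere_measure B)%E.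
Proof. by move=> mA mB; exact: product_measure1E. Qed.

Lemma phase_boundary_lty : (bmu bD < +oo)%E.
Proof.
rewrite phase_surfaceX; [|exact: measurable_boundary|exact: measurable_sphere].
apply: lte_mul_pinfty; first exact: measure_ge0.
  by rewrite ge0_fin_numE; [exact: boundary_lty|exact: measure_ge0].
by apply: sphere_measure_lty; exact: measurable_sphere.
Qed.

Lemma measurable_normal_flux :
  measurable_fun bD (fun z : surface_type d * E => `|dot z.2 (n z.1)|).
Proof.
apply: measurableT_comp => //; apply: measurable_sum => i; apply: measurable_funM.
  apply: measurable_funTS.
  by apply: (measurableT_comp (measurable_coord i)); exact: measurable_snd.
apply: (measurableT_comp (measurable_coord i)).
have [mn _] := Hn.
apply: (@measurable_comp _ _ _ _ _ _ (boundary Om : set (surface_type d)) n) => //.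
- exact: measurable_boundary.
- by move=> _ [z [bz _] <-].
- by apply: measurable_funTS; exact: measurable_fst.
Qed.

Lemma ae_bdd_boundary (F : E * E -> R) : bdd_meas setT F ->
  ae_bdd bmu bD (fun z => `|dot z.2 (n z.1)| * F z).
Proof.
move=> [mF [M FM]]; apply: ae_bddM.
  split; first exact: measurable_normal_flux.
  (* Where [n] is a unit vector, Cauchy-Schwarz bounds the flux by 1; the exceptional set is a
     cylinder over a null set. *)
  exists 1; have [_ [A [mA A0 nA]]] := Hn.
  exists (fst @^-1` A); split.
  - by rewrite -[X in measurable X]setTI; exact: measurable_fst.
  - rewrite (_ : _ @^-1` _ = A `*` setT); last by apply/seteqP; split=> // z [].
    by rewrite phase_surfaceX// A0 mul0e.
  - move=> z /= hz; apply: nA => hn; apply: hz => -[bz sz].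
    rewrite normr_id; apply: le_trans (CauchySchwarz_dot _ _) _.
    by have [-> _] := hn bz; rewrite sz mulr1.
apply: bdd_meas_ae; split; last by exists M => z _; exact: FM.
apply: measurable_funTS.
(* The identity, passing from the Caratheodory to the Borel sigma-algebra, for which [F] is known to
   be measurable. *)
pose f (z : surface_type d * E) : E * E := (z.1, z.2).
have mf : measurable_fun setT f.
  apply/measurable_fun_pairP; split; last exact: measurable_snd.
  by apply: (measurableT_comp (@measurable_surface_id R d)); exact: measurable_fst.
have fE : F \o f = (F : surface_type d * E -> R) by apply/funext => -[x y].
by have := measurableT_comp mF mf; rewrite fE.
Qed.

Lemma integrable_boundary (F : E * E -> R) : bdd_meas setT F ->
  bmu.-integrable bD (EFin \o (fun z => `|dot z.2 (n z.1)| * F z)).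
Proof.
move=> bF; apply: ae_bdd_integrable.
- exact: measurable_phase_boundary.
- exact: phase_boundary_lty.
- exact: ae_bdd_boundary.
Qed.

End boundary_integrals.

(** * The scattering operator *)

Section angular_average.
Context {R : realType} (d : nat).
Notation E := 'rV[R]_d.
Notation sm := (@sphere_measure R d).
Variables (theta : R -> R) (Htheta : phase_function d theta).

Definition angular (v : E * E -> R) : E * E -> R := fun z =>
  \int[sm]_(s' in @sphere R d) (theta (dot z.2 s') * v (z.1, s')).

Let S := @sphere R d.

(** The phase function is given on [[-1, 1]] only. Extension by 0 makes the kernel measurable and
    nonnegative on all pairs of vectors, as Tonelli asks, and keeps it symmetric. *)
Definition kern (p : E * E) : R :=
  \1_S p.1 * \1_S p.2 * (theta \_ `[-1, 1]%classic) (dot p.1 p.2).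

Let theta0_ge0 t : 0 <= (theta \_ `[-1, 1]%classic) t.
Proof.
rewrite patchE; case: ifPn => // /set_mem /=; rewrite in_itv/=.
by case: Htheta => _ + _; apply.
Qed.

Lemma kern_ge0 p : 0 <= kern p.
Proof. by rewrite !mulr_ge0. Qed.

Lemma kernC s s' : kern (s, s') = kern (s', s).
Proof. by rewrite /kern /= (mulrC (\1_S s)) dotC. Qed.

Lemma kernE s s' : sphere s -> sphere s' -> kern (s, s') = theta (dot s s').
Proof.
move=> ss ss'; rewrite /kern !indicE !mem_set// !mul1r patchE mem_set//=.
by rewrite in_itv/=; exact: dot_sphere.
Qed.

Lemma kern0 s s' : ~ (sphere s /\ sphere s') -> kern (s, s') = 0.
Proof.
move=> nss; rewrite /kern !indicE.
case: (boolP (s \in S)) => [/set_mem ss|_]; last by rewrite !mul0r.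
rewrite [s' \in S]memNset ?mulr0 ?mul0r// => ss'; exact: nss.
Qed.

Lemma measurable_dot2 : measurable_fun [set: E * E] (fun p => dot p.1 p.2).
Proof.
apply: measurable_sum => i; apply: measurable_funM.
  by apply: (measurableT_comp (measurable_coord i)); exact: measurable_fst.
by apply: (measurableT_comp (measurable_coord i)); exact: measurable_snd.
Qed.

Lemma measurable_kern : measurable_fun setT kern.
Proof.
have mS : measurable S by exact: measurable_sphere.
apply: measurable_funM; first apply: measurable_funM.
- by apply: measurableT_comp; [exact: measurable_indic|exact: measurable_fst].
- by apply: measurableT_comp; [exact: measurable_indic|exact: measurable_snd].
- apply: measurableT_comp; last exact: measurable_dot2.
  have m01 : measurable (`[-1, 1] : set R) by exact: measurable_itv.
  by apply: (measurable_restrictT theta m01).1; case: Htheta.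
Qed.

Lemma kern_ae : {ae sm, forall s, (\int[sm]_s' (kern (s, s'))%:E = (\1_S s)%:E)%E}.
Proof.
case: Htheta => _ _; apply: filterS => s hs.
rewrite indicE; case: (boolP (s \in S)) => [/set_mem ss|/negP ns]; last first.
  rewrite integral0_eq// => s' _; rewrite kern0// => -[ss _].
  by apply: ns; exact/mem_set.
rewrite -(hs ss) [RHS]integral_mkcond; apply: eq_integral => s' _.
rewrite patchE; case: ifPn => [/set_mem ss'|/negP ns']; first by rewrite kernE.
by rewrite kern0// => -[_ ss']; apply: ns'; exact/mem_set.
Qed.

Lemma angularE v z : sphere z.2 ->
  angular v z = fine (\int[sm]_s' (kern (z.2, s') * v (z.1, s'))%:E).
Proof.
move=> sz; rewrite /angular /Rintegral integral_mkcond; congr fine.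
apply: eq_integral => s' _; rewrite patchE.
case: ifPn => [/set_mem ss'|/negP ns']; first by rewrite kernE.
by rewrite kern0 ?mul0r// => -[_ ss']; apply: ns'; exact/mem_set.
Qed.

Let k3 (v : E * E -> R) (p : (E * E) * E) : \bar R :=
  (kern (p.1.2, p.2) * v (p.1.1, p.2))%:E.

Let measurable_fst2 : measurable_fun [set: (E * E) * E] (fun p => p.1.1).
Proof. exact: (measurableT_comp (@measurable_fst _ _ E E) (@measurable_fst _ _ _ _)). Qed.

Let mk3 v : measurable_fun setT v -> measurable_fun setT (k3 v).
Proof.
move=> mv; apply/measurable_EFinP; apply: measurable_funM.
  apply: (measurableT_comp measurable_kern); apply/measurable_fun_pairP; split.
    by apply: (measurableT_comp (@measurable_snd _ _ E E)); exact: measurable_fst.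
  exact: measurable_snd.
apply: (measurableT_comp mv); apply/measurable_fun_pairP; split.
  exact: measurable_fst2.
exact: measurable_snd.
Qed.

Lemma measurable_angular (Om : set E) v : measurable Om -> measurable_fun setT v ->
  measurable_fun (phase Om) (angular v).
Proof.
move=> mOm mv.
have mD : measurable (phase Om) by apply: measurableX => //; exact: measurable_sphere.
apply: (eq_measurable_fun (fun z => fine (\int[sm]_s' k3 v (z, s'))%E)).
  by move=> z /set_mem[_ sz]; rewrite angularE.
apply: measurable_funTS; apply: measurableT_comp; first exact: fine_measurable.
rewrite (_ : (fun z => _) = (fun z => (\int[sm]_s' ((k3 v)^\+ (z, s')) -
    \int[sm]_s' ((k3 v)^\- (z, s')))%E)).
  apply: emeasurable_funB.
    apply: (measurable_fun_fubini_tonelli_F (m2 := sm)) => //.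
    exact: measurable_funepos (mk3 mv).
  apply: (measurable_fun_fubini_tonelli_F (m2 := sm)) => //.
  exact: measurable_funeneg (mk3 mv).
apply/funext => z; rewrite integralE; congr (_ - _)%E.
  by apply: eq_integral => s' _; rewrite !funeposE.
by apply: eq_integral => s' _; rewrite !funenegE.
Qed.

(** True for almost every direction; isolating it lets the estimates of the average be stated at a
    point. *)
Definition unit_mass s := (\int[sm]_s' (kern (s, s'))%:E = (\1_S s)%:E)%E.

Lemma ae_unit_mass : {ae @phase_measure R d, forall z, unit_mass z.2}.
Proof.
have [A [mA A0 nA]] := kern_ae.
exists (snd @^-1` A); split.
- by rewrite -[X in measurable X]setTI; exact: measurable_snd.
- rewrite (_ : _ @^-1` _ = setT `*` A); last by apply/seteqP; split=> // z [].
  by rewrite phase_measureX// A0 mule0.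
- by move=> z /= hz; exact: nA.
Qed.

Lemma integrable_kern s : unit_mass s -> sm.-integrable setT (fun s' => (kern (s, s'))%:E).
Proof.
move=> h; apply/integrableP; split.
  apply/measurable_EFinP.
  exact: (measurableT_comp measurable_kern (measurable_pair1 s)).
rewrite (eq_integral (fun s' => (kern (s, s'))%:E)).
  by rewrite h ltry.
by move=> s' _; rewrite gee0_abs// lee_fin kern_ge0.
Qed.

Lemma integrable_kernM s r (v : E * E -> R) : unit_mass s -> bdd_meas setT v ->
  sm.-integrable setT (EFin \o (fun s' => kern (s, s') * v (r, s'))).
Proof.
move=> h [mv [M vM]]; apply: integrable_bddM => //.
  exact: (integrable_kern h).
split; last by exists M => s' _; exact: vM.
exact: (measurableT_comp mv (measurable_pair1 r)).
Qed.

Lemma angularE' v z : sphere z.2 ->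
  angular v z = \int[sm]_s' (kern (z.2, s') * v (z.1, s')).
Proof. by move=> sz; rewrite angularE. Qed.

Lemma angularB (u v : E * E -> R) z : sphere z.2 -> unit_mass z.2 -> bdd_meas setT u ->
  bdd_meas setT v ->
  angular (fun w => u w - v w) z = angular u z - angular v z.
Proof.
move=> sz h bu bv; rewrite !angularE'// -RintegralB//; first last.
- exact: integrable_kernM.
- exact: integrable_kernM.
by apply: eq_Rintegral => s' _; rewrite mulrBr.
Qed.

Lemma Rintegral_kern s : sphere s -> unit_mass s -> \int[sm]_s' kern (s, s') = 1.
Proof. by move=> ss h; rewrite /Rintegral h indicE mem_set. Qed.

Lemma angular_bound (v : E * E -> R) M z : sphere z.2 -> unit_mass z.2 -> measurable_fun setT v ->
  (forall w, `|v w| <= M) -> `|angular v z| <= M.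
Proof.
move=> sz h mv vM; rewrite angularE'//.
have bv : bdd_meas setT v by split=> //; exists M => w _; exact: vM.
apply: le_trans (le_normr_Rintegral _ _) _ => //; first exact: integrable_kernM.
apply: (@le_trans _ _ (\int[sm]_s' (kern (z.2, s') * M))).
  apply: le_Rintegral => //.
  - exact: integrable_norm (integrable_kernM _ h bv).
  - by apply: (@integrable_kernM z.2 z.1 (cst M)) => //; exact: bdd_meas_cst.
  - by move=> s' _; rewrite normrM ger0_norm ?kern_ge0// ler_wpM2l// kern_ge0.
rewrite RintegralZr//; last exact: (integrable_kern h).
by rewrite Rintegral_kern// mul1r.
Qed.

(* Jensen's inequality for the probability density [theta (s . s')]. *)
Lemma angular_sqr (v : E * E -> R) z : sphere z.2 -> unit_mass z.2 -> bdd_meas setT v ->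
  angular v z ^+ 2 <= angular (fun w => v w ^+ 2) z.
Proof.
move=> sz h bv; set c := angular v z.
have bv2 : bdd_meas setT (fun w => v w ^+ 2) by exact: (bdd_measM bv bv).
have i1 := integrable_kernM z.1 h bv.
have i2 := integrable_kernM z.1 h bv2.
have i0 := integrable_kern h.
(* The variance about the mean [c]; as the kernel has mass 1, it equals the second moment minus
   [c^2]. *)
have : 0 <= \int[sm]_s' ((kern (z.2, s') * v (z.1, s') ^+ 2 -
     2 * c * (kern (z.2, s') * v (z.1, s'))) + c ^+ 2 * kern (z.2, s')).
  apply: Rintegral_ge0 => s' _.
  rewrite (_ : _ + _ = kern (z.2, s') * (v (z.1, s') - c) ^+ 2); last by ring.
  by rewrite mulr_ge0 ?kern_ge0 ?sqr_ge0.
have i1' : sm.-integrable setT (EFin \o (fun s' => 2 * c * (kern (z.2, s') * v (z.1, s')))).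
  rewrite (_ : EFin \o _ = (fun s' => (2 * c)%:E *
    (EFin \o (fun s' => kern (z.2, s') * v (z.1, s'))%R) s')%E)//.
  exact: integrableZl.
have i0' : sm.-integrable setT (EFin \o (fun s' => c ^+ 2 * kern (z.2, s'))).
  rewrite (_ : EFin \o _ = (fun s' => (c ^+ 2)%:E * (kern (z.2, s'))%:E)%E)//.
  exact: integrableZl.
rewrite RintegralD//; last exact: (integrableB _ i2 i1').
rewrite RintegralB// RintegralZl// RintegralZl// Rintegral_kern//.
have -> : (\int[sm]_s' (kern (z.2, s') * v (z.1, s')))%R = c by rewrite /c angularE'.
rewrite angularE'// => hh.
rewrite -subr_ge0; apply: le_trans hh _.
by rewrite le_eqVlt; apply/orP; left; apply/eqP; ring.
Qed.

Variables (Om : set E) (mOm : measurable Om).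
Notation D := (phase Om).
Notation mu := (@phase_measure R d).
Local Open Scope ereal_scope.

(* By Tonelli and the symmetry of the kernel, angular averaging is a contraction
   of the weighted L^2 space. *)
Lemma angular_contraction (tau : E -> R) (v : E * E -> R) : measurable_fun setT tau ->
  (forall r, 0 <= tau r)%R -> bdd_meas setT v ->
  \int[mu]_(z in D) (tau z.1 * angular v z ^+ 2)%:E <=
  \int[mu]_(z in D) (tau z.1 * v z ^+ 2)%:E.
Proof.
move=> mtau tau0 bv; have [mv _] := bv.
have mD : measurable D by apply: measurableX => //; exact: measurable_sphere.
have bv2 : bdd_meas setT (fun w => v w ^+ 2)%R by exact: (bdd_measM bv bv).
(* With [Om] moved into the weight, the integrals can run over the whole space. *)
pose t (r : E) : R := (\1_Om r * tau r)%R.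
have t0 r : (0 <= t r)%R by rewrite mulr_ge0.
have mt : measurable_fun setT t by apply: measurable_funM => //; exact: measurable_indic.
have mtk : measurable_fun setT
    (fun p : (E * E) * E => (t p.1.1 * (kern (p.1.2, p.2) * v (p.1.1, p.2) ^+ 2))%:E).
  apply/measurable_EFinP; apply: measurable_funM.
    by apply: (measurableT_comp mt); exact: measurable_fst2.
  by have /measurable_EFinP := mk3 bv2.1.
have tk0 p : 0 <= (t p.1.1 * (kern (p.1.2, p.2) * v (p.1.1, p.2) ^+ 2))%:E.
  by rewrite lee_fin mulr_ge0// mulr_ge0 ?kern_ge0 ?sqr_ge0.
pose W (z : E * E) := \int[sm]_s' (t z.1 * (kern (z.2, s') * v (z.1, s') ^+ 2))%:E.
have mW : measurable_fun setT W.
  exact: (measurable_fun_fubini_tonelli_F (m2 := sm) _ mtk tk0).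
have W0 z : 0 <= W z by apply: integral_ge0 => s' _; exact: (tk0 (z, s')).
apply: (@le_trans _ _ (\int[mu]_(z in D) W z)).
  apply: ae_ge0_le_integral => //.
  - by move=> z _; rewrite lee_fin mulr_ge0// sqr_ge0.
  - apply/measurable_EFinP; apply: measurable_funM; last first.
      by apply: measurable_funX; exact: measurable_angular.
    by apply: measurable_funTS; apply: (measurableT_comp mtau); exact: measurable_fst.
  - exact: measurable_funTS.
  - apply: filterS ae_unit_mass => z hz [Oz sz].
    have i2 := integrable_kernM z.1 hz bv2.
    rewrite /W (eq_integral (fun s' => (t z.1)%:E * (EFin \o (fun s' => kern (z.2, s') * v (z.1, s') ^+ 2)%R) s'))//.
    rewrite integralZl//= -(fineK (integrable_fin_num _ i2))// -EFinM lee_fin.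
    rewrite -[fine _]/(\int[sm]_s' (kern (z.2, s') * v (z.1, s') ^+ 2))%R.
    rewrite -(angularE' (fun w => v w ^+ 2)%R sz) /t indicE mem_set// mul1r.
    by rewrite ler_wpM2l// angular_sqr.
apply: (@le_trans _ _ (\int[mu]_z W z)).
  by apply: ge0_subset_integral => //; exact: measurable_funTS.
rewrite tonelli_phase1//.
rewrite [leRHS]integral_mkcond tonelli_phase1; last 2 first.
- apply/(measurable_restrictT _ _).1 => //; apply/measurable_EFinP; apply: measurable_funM.
    by apply: measurable_funTS; apply: (measurableT_comp mtau); exact: measurable_fst.
  by apply: measurable_funTS; case: bv2.
- move=> z; rewrite patchE; case: ifP => // _.
  by rewrite lee_fin mulr_ge0// sqr_ge0.
rewrite le_eqVlt; apply/orP; left; apply/eqP.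
apply: eq_integral => r _.
have mvr : measurable_fun setT (fun s' => v (r, s') ^+ 2)%R.
  exact: (measurableT_comp bv2.1 (measurable_pair1 r)).
have mr : measurable_fun setT (fun p : E * E => (t r * (kern p * v (r, p.2) ^+ 2))%:E).
  apply/measurable_EFinP; apply: measurable_funM => //; apply: measurable_funM.
    exact: measurable_kern.
  by apply: (measurableT_comp mvr); exact: measurable_snd.
have r0 p : 0 <= (t r * (kern p * v (r, p.2) ^+ 2))%:E.
  by rewrite lee_fin mulr_ge0// mulr_ge0 ?kern_ge0 ?sqr_ge0.
(* After the exchange the inner integral runs over the first argument of the kernel; by symmetry it
   is the mass, equal to 1 for almost every [s'] on the sphere. *)
rewrite /W /= (fubini_tonelli (m1 := sm) (m2 := sm) _ mr r0) /=.
apply: ae_eq_integral => //.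
- exact: (measurable_fun_fubini_tonelli_G (m1 := sm) _ mr r0).
- rewrite (_ : (fun s => _) = (fun s' => (t r * (\1_S s' * v (r, s') ^+ 2))%:E)).
    apply/measurable_EFinP; apply: measurable_funM => //; apply: measurable_funM => //.
    by apply: measurable_indic; exact: measurable_sphere.
  apply/funext => s'; rewrite patchE /t !indicE.
  rewrite (_ : ((r, s') \in D) = (r \in Om) && (s' \in S)); last first.
    by apply/idP/andP => [/set_mem[? ?]|[/set_mem ? /set_mem ?]]; [split; exact/mem_set|exact/mem_set].
  case: (r \in Om) => /=; last by rewrite !mul0r.
  by case: (s' \in S); rewrite !(mul0r, mul1r, mulr0).
apply: filterS kern_ae => s' hs' _.
rewrite (eq_integral (fun s => (t r * v (r, s') ^+ 2)%:E * (kern (s', s))%:E)); last first.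
  by move=> s _; rewrite kernC -EFinM; congr (_%:E); ring.
rewrite integralZl//; last exact: integrable_kern.
rewrite hs' patchE /t !indicE -EFinM.
rewrite (_ : ((r, s') \in D) = (r \in Om) && (s' \in S)); last first.
  by apply/idP/andP => [/set_mem[? ?]|[/set_mem ? /set_mem ?]]; [split; exact/mem_set|exact/mem_set].
case: (r \in Om) => /=; last by rewrite !mul0r.
by case: (s' \in S); rewrite !(mulr0, mulr1, mul1r).
Qed.

End angular_average.

(** * Linearity of the weak streaming derivative *)

Section streaming_theory.
Context {R : realType} (d : nat).
Notation E := 'rV[R]_d.
Notation mu := (@phase_measure R d).
Variables (N m : nat) (Om : set E) (a : 'I_N -> 'I_m -> E) (b : 'I_N -> 'I_m -> R).
Variables (rad : R) (HP : polytopal Om a b rad).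
Notation D := (phase Om).
Implicit Types u v g : E * E -> R.

Let mD : measurable D := measurable_phase HP.
Let muD : (mu D < +oo)%E := phase_lty HP.

Lemma square_integrableP v : square_integrable mu D (cst 1) v <->
  measurable_fun D v /\ (\int[mu]_(z in D) (v z ^+ 2)%:E < +oo)%E.
Proof.
rewrite /square_integrable; under eq_integral do rewrite mul1r.
by [].
Qed.

Lemma square_integrable_integrable v : square_integrable mu D (cst 1) v ->
  mu.-integrable D (EFin \o v).
Proof. by move=> /square_integrableP[mv v2]; exact: L2_integrable. Qed.

Lemma square_integrableD u v : square_integrable mu D (cst 1) u ->
  square_integrable mu D (cst 1) v ->
  square_integrable mu D (cst 1) (fun z => u z + v z).
Proof.
move=> /square_integrableP[mu' u2] /square_integrableP[mv v2].
by apply/square_integrableP; split; [exact: measurable_funD|exact: L2D].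
Qed.

Lemma square_integrableN v : square_integrable mu D (cst 1) v ->
  square_integrable mu D (cst 1) (fun z => - v z).
Proof.
move=> /square_integrableP[mv v2]; apply/square_integrableP; split.
  exact: measurableT_comp.
by under eq_integral do rewrite sqrrN.
Qed.

Lemma weak_streamingD u v g g' : weak_streaming Om u g -> weak_streaming Om v g' ->
  weak_streaming Om (fun z => u z + v z) (fun z => g z + g' z).
Proof.
move=> [u2 g2 ug] [v2 g'2 vg']; split; [exact: square_integrableD|exact: square_integrableD|].
move=> xi txi; have bxi := bdd_meas_test txi; have bdxi := bdd_meas_test_derive txi.
have i x y : square_integrable mu D (cst 1) x -> bdd_meas D y ->
    mu.-integrable D (EFin \o (fun z => x z * y z)).
  by move=> x2 yb; apply: integrable_bddM => //; exact: square_integrable_integrable.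
under eq_Rintegral do rewrite mulrDl.
rewrite RintegralD ?ug ?vg'//; try exact: i.
under [in RHS]eq_Rintegral do rewrite mulrDl.
by rewrite RintegralD ?opprD//; exact: i.
Qed.

Lemma weak_streamingN v g : weak_streaming Om v g ->
  weak_streaming Om (fun z => - v z) (fun z => - g z).
Proof.
move=> [v2 g2 vg]; split; [exact: square_integrableN|exact: square_integrableN|].
move=> xi txi; have bxi := bdd_meas_test txi; have bdxi := bdd_meas_test_derive txi.
have i x y : square_integrable mu D (cst 1) x -> bdd_meas D y ->
    mu.-integrable D (EFin \o (fun z => x z * y z)).
  by move=> x2 yb; apply: integrable_bddM => //; exact: square_integrable_integrable.
under eq_Rintegral do rewrite mulNr -mulN1r.
rewrite RintegralZl ?vg//; last exact: i.
under [in RHS]eq_Rintegral do rewrite mulNr -mulN1r.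
by rewrite RintegralZl ?mulrN//; exact: i.
Qed.

Lemma weak_streaming0 : weak_streaming Om (cst 0) (cst 0).
Proof.
have c0 : square_integrable mu D (cst 1) (cst 0).
  by apply: (bdd_meas_square_integrable HP); exact: bdd_meas_cst.
split=> // xi txi.
have int0 f : \int[mu]_(z in D) (cst 0 z * f z) = 0 :> R.
  by under eq_Rintegral do rewrite /= mul0r; rewrite Rintegral_cst// mul0r.
by rewrite !int0 oppr0.
Qed.

Lemma weak_streaming_sum I (s : seq I) (v g : I -> E * E -> R) :
  (forall i, weak_streaming Om (v i) (g i)) ->
  weak_streaming Om (fun z => \sum_(i <- s) v i z) (fun z => \sum_(i <- s) g i z).
Proof.
move=> vg; elim: s => [|i s ih].
  have e0 (F : I -> E * E -> R) : (fun z => \sum_(i <- [::]) F i z) = cst 0.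
    by apply/funext => z; rewrite big_nil.
  by rewrite !e0; exact: weak_streaming0.
have eS (F : I -> E * E -> R) : (fun z => \sum_(j <- i :: s) F j z) =
    (fun z => F i z + \sum_(j <- s) F j z) by apply/funext => z; rewrite big_cons.
by rewrite !eS; exact: weak_streamingD.
Qed.

Lemma streamingP v g : weak_streaming Om v g -> weak_streaming Om v (streaming Om v).
Proof. by move=> vg; rewrite /streaming; case: xgetP => [? ->//|/(_ g)]. Qed.

(** The default [cst 0] is square integrable too, so this holds whether or not [v] has a weak
    derivative. *)
Lemma square_integrable_streaming v : square_integrable mu D (cst 1) (streaming Om v).
Proof.
rewrite /streaming; case: xgetP => [g _ [] //|_].
by apply: (bdd_meas_square_integrable HP); exact: bdd_meas_cst.
Qed.

(** The derivative chosen for [u - v] and the difference of the chosen derivatives are both weak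
    derivatives of [u - v], so a test function does not distinguish them. *)
Lemma streamingB_test u v g g' xi : weak_streaming Om u g -> weak_streaming Om v g' ->
  test_function Om xi ->
  \int[mu]_(z in D) ((streaming Om (fun z => u z - v z) z -
    (streaming Om u z - streaming Om v z)) * xi z) = 0.
Proof.
move=> ug vg' txi; have bxi := bdd_meas_test txi.
have uS := streamingP ug; have vS := streamingP vg'.
have uvN := weak_streamingD uS (weak_streamingN vS).
have uvS := streamingP uvN.
have i x : square_integrable mu D (cst 1) x -> 
    mu.-integrable D (EFin \o (fun z => x z * xi z)).
  by move=> x2; apply: integrable_bddM => //; exact: square_integrable_integrable.
under eq_Rintegral do rewrite mulrBl.
rewrite RintegralB//; last 2 first.
- by apply: (i); exact: square_integrable_streaming.
- by apply: (i); apply: square_integrableD; [|apply: square_integrableN];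
     exact: square_integrable_streaming.
case: uvS => _ _ /(_ xi txi); case: uvN => _ _ /(_ xi txi) -> /oppr_inj ->.
by rewrite subrr.
Qed.

End streaming_theory.

(** * Parity and tensor products *)

Section parts.
Context {R : realType} (d : nat).
Notation E := 'rV[R]_d.
Implicit Types w : E * E -> R.

Lemma parts_decomposition w p q : w = p \+ q ->
  (forall z, p (z.1, - z.2) = p z) -> (forall z, q (z.1, - z.2) = - q z) ->
  even_part w = p /\ odd_part w = q.
Proof.
move=> -> pe qo; split; apply/funext => z; rewrite /even_part /odd_part /= pe qo.
  by lra.
by lra.
Qed.

Lemma even_partB u w : even_part (fun z => u z - w z) = (fun z => even_part u z - even_part w z).
Proof. by apply/funext => z; rewrite /even_part; ring. Qed.

Lemma odd_partB u w : odd_part (fun z => u z - w z) = (fun z => odd_part u z - odd_part w z).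
Proof. by apply/funext => z; rewrite /odd_part; ring. Qed.

End parts.

Section tensor_theory.
Context {R : realType} (d : nat).
Notation E := 'rV[R]_d.

Lemma tensor_lin (S X : set (E -> R)) c (u v : E * E -> R) :
  (forall f, S f -> S (fun s => c * f s)) ->
  tensor S X u -> tensor S X v -> tensor S X (fun z => c * u z + v z).
Proof.
move=> Sc [m [f [g [fg uE]]]] [m' [f' [g' [fg' vE]]]].
exists (m + m')%N,
  (fun k => match fintype.split k with inl j => fun s => c * f j s | inr j => f' j end),
  (fun k => match fintype.split k with inl j => g j | inr j => g' j end).
split=> [k|z].
  case: (fintype.split k) => j; last exact: fg'.
  by have [fj gj] := fg j; split => //; exact: Sc.
rewrite big_split_ord /= uE vE mulr_sumr; congr (_ + _).
  by apply: eq_bigr => j _; rewrite (unsplitK (inl j : 'I_m + 'I_m')) mulrA.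
by apply: eq_bigr => j _; rewrite (unsplitK (inr j : 'I_m + 'I_m')).
Qed.

Lemma S_plusZ N (T : 'I_N -> 'M[R]_d) c f : S_plus T f -> S_plus T (fun s => c * f s).
Proof.
move=> [[k fE] fe]; split; last by move=> s; rewrite fe.
exists (fun i => c * k i) => s; rewrite fE mulr_sumr.
by apply: eq_bigr => i _; rewrite mulrA.
Qed.

Lemma S_minusZ N (T : 'I_N -> 'M[R]_d) c f : S_minus T f -> S_minus T (fun s => c * f s).
Proof.
move=> [[u [k fE]] fe]; split; last by move=> s; rewrite fe mulrN.
exists (fun i => c *: u i), (fun i => c * k i) => s; rewrite fE mulr_sumr.
by apply: eq_bigr => i _; rewrite dotZl -mulrDr mulrA.
Qed.

Lemma W_h_lin Om NR (TR : 'I_NR -> 'M[R]_(d.+1, d)) NS (TS : 'I_NS -> 'M[R]_d) c u v :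
  W_h Om TR TS u -> W_h Om TR TS v -> W_h Om TR TS (fun z => c * u z + v z).
Proof.
move=> [up [um [hup hum ->]]] [vp [vm [hvp hvm ->]]].
exists (fun z => c * up z + vp z), (fun z => c * um z + vm z); split.
- by apply: tensor_lin => // f; exact: S_plusZ.
- by apply: tensor_lin => // f; exact: S_minusZ.
- by apply/funext => z /=; ring.
Qed.

End tensor_theory.

(** * The discrete problem *)

Section discrete_forms.
Context {R : realType} (d : nat) (d0 : (0 < d)%N).
Notation E := 'rV[R]_d.
Notation mu := (@phase_measure R d).
Variables (Om : set E) (HOm : lipschitz_domain Om).
Variables (n : E -> E) (Hn : outward_normal_field Om n).
Variables (sigma_a sigma_s sigma_t : E -> R).
Hypothesis Hsigma : optical_data Om sigma_s sigma_t sigma_a.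
Variables (theta : R -> R) (Htheta : phase_function d theta).
Variables (kappa h : R) (NR : nat) (TR : 'I_NR -> 'M[R]_(d.+1, d)).
Hypothesis HTR : space_mesh Om kappa h TR.
Variables (NS : nat) (TS : 'I_NS -> 'M[R]_d).
Hypothesis HTS : sphere_mesh kappa h TS.
Variables (a : 'I_NR -> 'I_d.+1 -> E) (b : 'I_NR -> 'I_d.+1 -> R) (rad : R).
Hypothesis HP : polytopal Om a b rad.
Hypothesis simplexE : forall i, simplex (TR i) = poly (a i) (b i).

Notation D := (phase Om).
Notation Wh := (W_h Om TR TS).
Notation rho := (scattering_ratio Om sigma_s sigma_t).
Implicit Types u v w : E * E -> R.

Let mD : measurable D := measurable_phase HP.
Let muD : (mu D < +oo)%E := phase_lty HP.

Lemma spherical_cone : exists c : 'I_NS -> 'I_d -> E, forall k,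
  spherical_simplex (TS k) = @sphere R d `&` cone (c k).
Proof.
have [Tfree _ _ _ _] := HTS.
have /choice[c cE] := fun k => spherical_halfspaces (Tfree k).
by exists c => k; rewrite cE.
Qed.

Lemma measurable_spherical k : measurable (spherical_simplex (TS k)).
Proof.
have [c ->] := spherical_cone.
by apply: measurableI; [exact: measurable_sphere|exact: measurable_cone].
Qed.

Lemma bdd_S_plus f : S_plus TS f -> bdd_meas setT f.
Proof.
move=> [[c fE] _]; rewrite (_ : f = fun s => \sum_i c i * \1_(spherical_simplex (TS i)) s).
  apply: bdd_meas_sum => i; apply: bdd_measZ.
  by apply: bdd_meas_indic; exact: measurable_spherical.
by apply/funext => s; rewrite fE.
Qed.

Lemma bdd_S_minus f : S_minus TS f -> bdd_meas setT f.
Proof.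
move=> [[u [c fE]] _].
rewrite (_ : f = fun s => \sum_i (dot (u i) s + c i) * \1_(spherical_simplex (TS i)) s); last first.
  by apply/funext => s; rewrite fE.
apply: bdd_meas_sum => i; split.
  apply: measurable_funM; first exact: measurable_affine.
  by apply: measurable_indic; exact: measurable_spherical.
exists (enorm (u i) + `|c i|) => s _; rewrite indicE.
have [/set_mem[ss _]|_] := boolP (s \in spherical_simplex (TS i)); last first.
  by rewrite mulr0 normr0 addr_ge0// enorm_ge0.
rewrite mulr1; apply: le_trans (ler_normD _ _) _; rewrite lerD2r.
by apply: le_trans (CauchySchwarz_dot _ _) _; rewrite ss mulr1.
Qed.

Lemma X_plus_pieces g : X_plus Om TR g -> exists (alpha : 'I_NR -> E) (beta : 'I_NR -> R),
  (forall i x, poly (a i) (b i) x -> g x = dot (alpha i) x + beta i) /\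
  (forall x, ~ closure Om x -> g x = 0).
Proof.
move=> [_ /choice[alpha /choice[beta gE]] g0]; exists alpha, beta; split=> // i x px.
by apply: gE; rewrite simplexE.
Qed.

Lemma bdd_X_plus g : X_plus Om TR g -> bdd_meas setT g.
Proof. by move=> /X_plus_pieces[alpha [beta [gK g0]]]; exact: (bdd_piece HP gK g0). Qed.

Lemma bdd_X_minus g : X_minus TR g -> bdd_meas setT g.
Proof.
move=> [c gE]; rewrite (_ : g = fun x => \sum_i c i * \1_(simplex (TR i)) x); last first.
  by apply/funext => s; rewrite gE.
apply: bdd_meas_sum => i; apply: bdd_measZ.
by apply: bdd_meas_indic; rewrite simplexE; exact: measurable_poly.
Qed.

Lemma bdd_tensor (S X : set (E -> R)) w : (forall f, S f -> bdd_meas setT f) ->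
  (forall g, X g -> bdd_meas setT g) -> tensor S X w -> bdd_meas setT w.
Proof.
move=> bS bX [m [f [g [fg wE]]]].
rewrite (_ : w = fun z => \sum_j f j z.2 * g j z.1); last first.
  by apply/funext => z; rewrite wE.
apply: bdd_meas_sum => j; have [Sf Xg] := fg j; apply: bdd_measM.
  by apply: bdd_meas_snd; exact: bS.
by apply: bdd_meas_fst; exact: bX.
Qed.

Lemma W_h_parts w : Wh w -> [/\ w = even_part w \+ odd_part w,
  tensor (S_plus TS) (X_plus Om TR) (even_part w) &
  tensor (S_minus TS) (X_minus TR) (odd_part w)].
Proof.
move=> [p [q [hp hq wE]]].
have [-> ->] : even_part w = p /\ odd_part w = q.
  apply: parts_decomposition wE _ _ => z.
    move: hp => [m [f [g [fg pE]]]]; rewrite !pE; apply: eq_bigr => j _ /=.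
    by have [[_ ->] _] := fg j.
  move: hq => [m [f [g [fg qE]]]]; rewrite !qE -sumrN; apply: eq_bigr => j _ /=.
  by have [[_ ->] _] := fg j; rewrite mulNr.
by split.
Qed.

Lemma bdd_even w : Wh w -> bdd_meas setT (even_part w).
Proof. by move=> /W_h_parts[_ hp _]; exact: (bdd_tensor bdd_S_plus bdd_X_plus hp). Qed.

Lemma bdd_odd w : Wh w -> bdd_meas setT (odd_part w).
Proof. by move=> /W_h_parts[_ _ hq]; exact: (bdd_tensor bdd_S_minus bdd_X_minus hq). Qed.

Lemma bdd_W_h w : Wh w -> bdd_meas setT w.
Proof.
move=> Ww; have [-> _ _] := W_h_parts Ww.
by apply: bdd_measD; [exact: bdd_even|exact: bdd_odd].
Qed.

Lemma bdd_D v : bdd_meas setT v -> bdd_meas D v.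
Proof. exact: bdd_measS. Qed.

Lemma streaming_even w : Wh w -> exists g, weak_streaming Om (even_part w) g.
Proof.
move=> /W_h_parts[_ [m [f [g [fg wE]]]] _].
have /choice[G hG] : forall j, exists G, weak_streaming Om (fun z => f j z.2 * g j z.1) G.
  move=> j; have [Sf /X_plus_pieces[alpha [beta [gK g0]]]] := fg j.
  by eexists; exact: (weak_streaming_piece HP gK g0 (bdd_S_plus Sf)).
exists (fun z => \sum_j G j z).
rewrite (_ : even_part w = fun z => \sum_j f j z.2 * g j z.1).
  exact: (weak_streaming_sum HP).
by apply/funext => z; rewrite wE.
Qed.

(** On the sphere the indicator of a spherical simplex is that of a cone, so an odd discrete
    function is a sum of products of cut-off affine functions of [s] and indicators of cells. *)
Lemma orthogonal_odd (gam : E * E -> R) w : Wh w ->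
  mu.-integrable D (EFin \o gam) ->
  (forall xi, test_function Om xi -> \int[mu]_(z in D) (gam z * xi z) = 0) ->
  \int[mu]_(z in D) (gam z * odd_part w z) = 0.
Proof.
move=> /W_h_parts[_ _ [m [f [x [fx wE]]]]] igam gam0.
have [c cE] := spherical_cone.
under eq_Rintegral do rewrite wE mulr_sumr.
rewrite Rintegral_sum//; last first.
  move=> j; apply: integrable_bddM => //; have [Sf Xx] := fx j.
  by apply: bdd_measM; [apply: bdd_meas_snd; exact: bdd_S_minus|
    apply: bdd_meas_fst; exact: bdd_X_minus].
apply: big1 => j _; have [[[u [v fE]] _] [k xE]] := fx j.
apply: (orthogonal_tensor HP igam gam0 (c := c) (u := u) (v := v) (cst := k)).
- move=> s ss; rewrite fE; apply: eq_bigr => i _; rewrite cE !indicE.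
  by rewrite in_setI (mem_set (A := @sphere R d) ss).
- by move=> r; rewrite xE; apply: eq_bigr => i _; rewrite simplexE.
Qed.

Lemma integrable_streamingM v w : bdd_meas setT w ->
  mu.-integrable D (EFin \o (fun z => streaming Om v z * w z)).
Proof.
move=> bw; apply: integrable_bddM => //; last exact: bdd_D.
by apply: (square_integrable_integrable HP); exact: (square_integrable_streaming HP).
Qed.

Lemma ip_streamingB u v w : Wh u -> Wh v -> Wh w ->
  ip Om (streaming Om (even_part (fun z => u z - v z))) (odd_part w) =
  ip Om (streaming Om (even_part u)) (odd_part w) -
  ip Om (streaming Om (even_part v)) (odd_part w).
Proof.
move=> Wu Wv Ww; have [gu hu] := streaming_even Wu; have [gv hv] := streaming_even Wv.
have bo := bdd_odd Ww.
have sq v' := square_integrable_streaming HP v'.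
rewrite /ip even_partB -RintegralB//; try exact: integrable_streamingM.
apply/eqP; rewrite -subr_eq0 -RintegralB//; first 1 last.
- exact: integrable_streamingM.
- under eq_fun do rewrite -mulrBl.
  apply: integrable_bddM => //; last exact: bdd_D.
  apply: (square_integrable_integrable HP).
  by apply: (square_integrableD HP) => //; exact: (square_integrableN).
apply/eqP; rewrite -[RHS](@orthogonal_odd (fun z => streaming Om (fun z => even_part u z - even_part v z) z -
    (streaming Om (even_part u) z - streaming Om (even_part v) z)) w Ww).
- by apply: eq_Rintegral => z _; ring.
- apply: (square_integrable_integrable HP).
  apply: (square_integrableD HP) => //; apply: square_integrableN.
  by apply: (square_integrableD HP) => //; exact: square_integrableN.
- by move=> xi txi; exact: (streamingB_test HP hu hv txi).
Qed.

Lemma optical_ae_D : exists M, {ae mu, forall z, D z ->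
  [/\ 0 <= sigma_s z.1, 0 < sigma_t z.1, sigma_t z.1 <= M &
      sigma_s z.1 <= rho * sigma_t z.1]}.
Proof.
have [M hM] := optical_data_ae Hsigma; exists M.
by apply: filterS (phase_ae_fst hM) => z hz [Oz _]; exact: hz.
Qed.

Lemma measurable_sigma (f : E -> R) : measurable_fun Om f ->
  measurable_fun D (fun z => f z.1).
Proof.
move=> mf; apply: (@measurable_comp _ _ _ _ _ _ Om f) => //.
- exact: measurable_domain HP.
- by move=> _ [z [Oz _] <-].
- by apply: measurable_funTS; exact: measurable_fst.
Qed.

Lemma ae_bdd_sigma_t : ae_bdd mu D (fun z => sigma_t z.1).
Proof.
have [M hM] := optical_ae_D; split.
  by apply: measurable_sigma; case: Hsigma => -[].
exists M; apply: filterS hM => z hz Dz.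
by have [_ t0 tM _] := hz Dz; rewrite gtr0_norm.
Qed.

Lemma ae_bdd_sigma_s : ae_bdd mu D (fun z => sigma_s z.1).
Proof.
have [M hM] := optical_ae_D; split.
  by apply: measurable_sigma; case: Hsigma => -[].
exists (rho * M); apply: filterS hM => z hz Dz.
have [s0 _ tM st] := hz Dz; rewrite ger0_norm//; apply: le_trans st _.
by rewrite ler_wpM2l// scattering_ratio_ge0.
Qed.

Lemma ae_bdd_angular v : bdd_meas setT v -> ae_bdd mu D (angular theta v).
Proof.
move=> [mv [M vM]]; split.
  by apply: measurable_angular => //; exact: measurable_domain HP.
exists M; apply: filterS (ae_unit_mass Htheta) => z hz [_ sz].
by apply: angular_bound => // w; exact: vM.
Qed.

Lemma ae_bdd_scatter v : bdd_meas setT v -> ae_bdd mu D (scatter sigma_s theta v).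
Proof. by move=> bv; apply: ae_bddM; [exact: ae_bdd_sigma_s|exact: ae_bdd_angular]. Qed.

Lemma integrable_aeM u v : ae_bdd mu D u -> ae_bdd mu D v ->
  mu.-integrable D (EFin \o (fun z => u z * v z)).
Proof. by move=> bu bv; apply: ae_bdd_integrable => //; exact: ae_bddM. Qed.

Lemma ae_bdd_D v : bdd_meas setT v -> ae_bdd mu D v.
Proof. by move=> bv; apply: bdd_meas_ae; exact: bdd_D. Qed.

Lemma form_sB u v w : Wh u -> Wh v -> Wh w ->
  form_s Om sigma_s theta (fun z => u z - v z) w =
  form_s Om sigma_s theta u w - form_s Om sigma_s theta v w.
Proof.
move=> Wu Wv Ww; have bu := bdd_W_h Wu; have bv := bdd_W_h Wv; have bw := bdd_W_h Ww.
have bw' := ae_bdd_D bw.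
have iu := integrable_aeM (ae_bdd_scatter bu) bw'.
have iv := integrable_aeM (ae_bdd_scatter bv) bw'.
have iuv := integrable_aeM (ae_bdd_scatter (bdd_measB bu bv)) bw'.
rewrite /form_s /ip -RintegralB//; apply: ae_eq_Rintegral => //.
- by apply/measurable_EFinP; case/integrableP: iuv.
- by apply: measurable_funB; apply/measurable_EFinP; [case/integrableP: iu|case/integrableP: iv].
apply: filterS (ae_unit_mass Htheta) => z hz [_ sz].
rewrite /scatter -[X in _ * X * _]/(angular theta (fun x => u x - v x) z).
by rewrite (angularB Htheta sz hz bu bv) mulrBr mulrBl.
Qed.

Lemma form_tB u v w : Wh u -> Wh v -> Wh w ->
  form_t Om n sigma_t (fun z => u z - v z) w =
  form_t Om n sigma_t u w - form_t Om n sigma_t v w.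
Proof.
move=> Wu Wv Ww; have bu := bdd_W_h Wu; have bv := bdd_W_h Wv; have bw := bdd_W_h Ww.
rewrite /form_t ip_streamingB//.
(* Here the derivative falls on the fixed [w], so linearity of the integral is enough. *)
have -> : ip Om (odd_part (fun z => u z - v z)) (streaming Om (even_part w)) =
   ip Om (odd_part u) (streaming Om (even_part w)) -
   ip Om (odd_part v) (streaming Om (even_part w)).
  have i v' : Wh v' -> mu.-integrable D (EFin \o (fun z => odd_part v' z * streaming Om (even_part w) z)).
    by move=> Wv'; under eq_fun do rewrite mulrC; apply: integrable_streamingM; exact: bdd_odd.
  rewrite /ip -RintegralB//; try exact: i.
  by apply: eq_Rintegral => z _; rewrite odd_partB mulrBl.
have -> : ip Om (fun z => sigma_t z.1 * (u z - v z)) w =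
   ip Om (fun z => sigma_t z.1 * u z) w - ip Om (fun z => sigma_t z.1 * v z) w.
  have i v' : Wh v' -> mu.-integrable D (EFin \o (fun z => sigma_t z.1 * v' z * w z)).
    move=> Wv'; apply: integrable_aeM; last exact: ae_bdd_D.
    by apply: ae_bddM; [exact: ae_bdd_sigma_t|apply: ae_bdd_D; exact: bdd_W_h].
  rewrite /ip -RintegralB//; try exact: i.
  by apply: eq_Rintegral => z _; ring.
have i v' : Wh v' -> (phase_surface d).-integrable (phase_boundary Om : set (surface_type d * E))
    (EFin \o (fun z => `|dot z.2 (n z.1)| * (even_part v' z * even_part w z))).
  move=> Wv'; apply: (integrable_boundary d0 HOm HTR Hn (F := fun z => even_part v' z * even_part w z)).
  by apply: bdd_measM; exact: bdd_even.
have -> : \int[phase_surface d]_(z in phase_boundary Om)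
      (`|dot z.2 (n z.1)| * (even_part (fun z => u z - v z) z * even_part w z)) =
   \int[phase_surface d]_(z in phase_boundary Om)
      (`|dot z.2 (n z.1)| * (even_part u z * even_part w z)) -
   \int[phase_surface d]_(z in phase_boundary Om)
      (`|dot z.2 (n z.1)| * (even_part v z * even_part w z)).
  rewrite -RintegralB//; [|exact: measurable_phase_boundary|exact: i|exact: i].
  by apply: eq_Rintegral => z _; rewrite even_partB; ring.
have regroup (x x' y y' z z' t t' : R) : (x - x') - (y - y') + (z - z') + (t - t') =
    (x - y + z + t) - (x' - y' + z' + t') by ring.
exact: regroup.
Qed.

(** The inner product behind [norm_t], without the square roots of [sigma_t]. *)
Definition energy u v : R := \int[mu]_(z in D) (sigma_t z.1 * u z * v z).

Lemma integrable_energy u v : bdd_meas setT u -> bdd_meas setT v ->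
  mu.-integrable D (EFin \o (fun z => sigma_t z.1 * u z * v z)).
Proof.
move=> bu bv; apply: integrable_aeM; last exact: ae_bdd_D.
by apply: ae_bddM; [exact: ae_bdd_sigma_t|exact: ae_bdd_D].
Qed.

Lemma energy_ge0 v : bdd_meas setT v -> 0 <= energy v v.
Proof.
move=> bv; apply: ae_ge0_Rintegral => //.
  by apply/measurable_EFinP; case/integrableP: (integrable_energy bv bv).
have [M hM] := optical_ae_D; apply: filterS hM => z hz Dz.
have [_ t0 _ _] := hz Dz; rewrite -mulrA mulr_ge0//; first exact: ltW.
by rewrite -expr2 sqr_ge0.
Qed.

Lemma norm_tE v : bdd_meas setT v -> norm_t Om sigma_t v = Num.sqrt (energy v v).
Proof.
move=> bv; rewrite /norm_t; congr Num.sqrt.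
(* [Num.sqrt] is 0 on negative numbers, and [sigma_t] is positive only almost everywhere. *)
have sE z : (Num.sqrt (sigma_t z.1) * v z) ^+ 2 = Num.max 0 (sigma_t z.1) * v z ^+ 2.
  rewrite exprMn; congr (_ * _); have [t0|t0] := leP 0 (sigma_t z.1).
    by rewrite sqr_sqrtr.
  by rewrite ltr0_sqrtr// expr0n.
under eq_Rintegral do rewrite sE.
apply: ae_eq_Rintegral => //.
- apply: measurable_funM; last by apply: measurable_funX; case: (bdd_D bv).
  apply: measurable_maxr; first exact: measurable_cst.
  by case: ae_bdd_sigma_t.
- by apply/measurable_EFinP; case/integrableP: (integrable_energy bv bv).
have [M hM] := optical_ae_D; apply: filterS hM => z hz Dz.
by have [_ t0 _ _] := hz Dz; rewrite max_r ?ltW// expr2 mulrA.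
Qed.

Lemma form_t_coercive w : Wh w -> energy w w <= form_t Om n sigma_t w w.
Proof.
move=> Ww; rewrite /form_t.
have -> : ip Om (odd_part w) (streaming Om (even_part w)) =
          ip Om (streaming Om (even_part w)) (odd_part w).
  by apply: eq_Rintegral => z _; rewrite mulrC.
rewrite subrr add0r lerDl; apply: Rintegral_ge0 => z _.
by rewrite mulr_ge0// -expr2 sqr_ge0.
Qed.

Lemma energy_angular v : bdd_meas setT v ->
  \int[mu]_(z in D) (sigma_t z.1 * angular theta v z ^+ 2) <= energy v v.
Proof.
move=> bv; have [[_ mt] _ _ _ _] := Hsigma.
have mOm := measurable_domain HP.
(* A version of [sigma_t] that is measurable and nonnegative on the whole space and differs from it
   in [Om] only on a null set. *)
pose tau (r : E) : R := `|(sigma_t \_ Om) r|.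
have mtau : measurable_fun setT tau.
  by apply: measurableT_comp => //; exact: (measurable_restrictT _ mOm).1.
have tauE : {ae mu, forall z, D z -> sigma_t z.1 = tau z.1}.
  have [M hM] := optical_ae_D; apply: filterS hM => z hz Dz.
  have [_ t0 _ _] := hz Dz; rewrite /tau patchE mem_set ?gtr0_norm//.
  by case: Dz.
have mtau' : measurable_fun D (fun z => tau z.1).
  by apply: measurable_funTS; apply: (measurableT_comp mtau); exact: measurable_fst.
have ba := ae_bdd_angular bv; have bt := ae_bdd_sigma_t; have bv' := ae_bdd_D bv.
have btau : ae_bdd mu D (fun z => tau z.1).
  split=> //; have [_ [M hM]] := bt; exists M.
  by apply: filterS2 hM tauE => z hz e Dz; rewrite -(e Dz); exact: hz.
have ba2 := ae_bddM ba ba; have bv2 := ae_bddM bv' bv'.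
have i1 := integrable_aeM btau ba2; have i2 := integrable_aeM btau bv2.
have mi f : mu.-integrable D (EFin \o f) -> measurable_fun D f.
  by case/integrableP => ? _; exact/measurable_EFinP.
have -> : \int[mu]_(z in D) (sigma_t z.1 * angular theta v z ^+ 2) =
          \int[mu]_(z in D) (tau z.1 * (angular theta v z * angular theta v z)).
  apply: ae_eq_Rintegral => //.
  - exact: (mi _ (integrable_aeM bt ba2)).
  - exact: mi.
  - by apply: filterS tauE => z e Dz; rewrite (e Dz) expr2.
have -> : energy v v = \int[mu]_(z in D) (tau z.1 * (v z * v z)).
  apply: ae_eq_Rintegral => //.
  - exact: (mi _ (integrable_energy bv bv)).
  - exact: mi.
  - by apply: filterS tauE => z e Dz; rewrite (e Dz) mulrA.
apply: fine_le; [exact: integrable_fin_num|exact: integrable_fin_num|].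
exact: (angular_contraction Htheta mOm mtau (fun r => normr_ge0 _) bv).
Qed.

(** With [p] the angular average of [u] and [y] the value of [v], [sigma_s p y <= sigma_t (rho^2 p^2
    + y^2) / 2] pointwise. Keeping [rho] with the averaged factor leaves the other one with weight
    one half, ready to be absorbed. *)
Lemma form_s_le u v : bdd_meas setT u -> bdd_meas setT v ->
  form_s Om sigma_s theta u v <= 2^-1 * (rho ^+ 2 * energy u u + energy v v).
Proof.
move=> bu bv; have bs := ae_bdd_sigma_s; have bt := ae_bdd_sigma_t.
have ba := ae_bdd_angular bu; have bv' := ae_bdd_D bv.
have ba2 : ae_bdd mu D (fun z => angular theta u z ^+ 2) by exact: (ae_bddM ba ba).
have i1 : mu.-integrable D
    (EFin \o (fun z => 2^-1 * rho ^+ 2 * (sigma_t z.1 * angular theta u z ^+ 2))).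
  have bc : ae_bdd mu D (cst (2^-1 * rho ^+ 2)) by apply: bdd_meas_ae; exact: bdd_meas_cst.
  exact: (integrable_aeM bc (ae_bddM bt ba2)).
have i2 : mu.-integrable D (EFin \o (fun z => 2^-1 * (sigma_t z.1 * v z * v z))).
  have bc : ae_bdd mu D (cst (2^-1 : R)) by apply: bdd_meas_ae; exact: bdd_meas_cst.
  exact: (integrable_aeM bc (ae_bddM (ae_bddM bt bv') bv')).
have rho0 := scattering_ratio_ge0 Om sigma_s sigma_t.
apply: (@le_trans _ _ (\int[mu]_(z in D) (2^-1 * rho ^+ 2 * (sigma_t z.1 * angular theta u z ^+ 2) +
   2^-1 * (sigma_t z.1 * v z * v z)))).
  apply: ae_le_Rintegral => //.
  - exact: (integrable_aeM (ae_bdd_scatter bu) bv').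
  - exact: (integrableD mD i1 i2).
  have [M hM] := optical_ae_D; apply: filterS hM => z hz Dz.
  have [s0 t0 _ st] := hz Dz.
  rewrite /scatter -[X in _ * X * _]/(angular theta u z).
  set p := angular theta u z; set y := v z; set s := sigma_s z.1 in s0 st *.
  set t := sigma_t z.1 in t0 st *.
  apply: (@le_trans _ _ (rho * t * (`|p| * `|y|))).
    rewrite -mulrA -normrM; apply: le_trans (_ : s * `|p * y| <= _).
      by rewrite ler_wpM2l// ler_norm.
    by rewrite ler_wpM2r.
  have := mulr_ge0 (ltW t0) (sqr_ge0 (rho * `|p| - `|y|)).
  rewrite -[p ^+ 2]real_normK ?num_real// -[t * y * y]mulrA -expr2 -[y ^+ 2]real_normK ?num_real//.
  set P := `|p|; set Y := `|y| => hh.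
  rewrite -subr_ge0; apply: le_trans (_ : 0 <= 2^-1 * (t * (rho * P - Y) ^+ 2)) _.
    by rewrite mulr_ge0.
  by rewrite le_eqVlt; apply/orP; left; apply/eqP; field.
rewrite RintegralD// RintegralZl//; last exact: (integrable_aeM bt ba2).
rewrite RintegralZl//; last exact: integrable_energy.
rewrite -/(energy v v) [leRHS]mulrDr lerD2r -[leLHS]mulrA ler_wpM2l// ler_wpM2l ?sqr_ge0//.
exact: energy_angular.
Qed.

(* Testing with [u] itself: coercivity, the bound on [form_s] and [xy <= (x^2 + y^2) / 2]. *)
Lemma transport_contraction u w : Wh u -> bdd_meas setT w ->
  (forall v, Wh v -> form_t Om n sigma_t u v = form_s Om sigma_s theta w v) ->
  norm_t Om sigma_t u <= rho * norm_t Om sigma_t w.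
Proof.
move=> Wu bw uw; have bu := bdd_W_h Wu.
have rho0 := scattering_ratio_ge0 Om sigma_s sigma_t.
have h1 := form_t_coercive Wu; rewrite (uw u Wu) in h1.
have h2 := le_trans h1 (form_s_le bw bu).
(* Half of [energy u u] on the right is absorbed by the left, which cancels the factor one half. *)
have h3 : energy u u <= rho ^+ 2 * energy w w by lra.
rewrite !norm_tE// -[leRHS]ger0_norm ?mulr_ge0 ?sqrtr_ge0// -sqrtr_sqr.
apply: ler_wsqrtr; rewrite exprMn sqr_sqrtr//; exact: energy_ge0.
Qed.

(** Only the norm is shown to vanish: functions are pointwise representatives, so discrete solutions
    are compared up to norm zero. *)
Lemma transport_null u : Wh u ->
  (forall v, Wh v -> form_t Om n sigma_t u v = 0) -> norm_t Om sigma_t u = 0.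
Proof.
move=> Wu u0; have := form_t_coercive Wu; rewrite (u0 u Wu) => h1.
by rewrite norm_tE; [exact: ler0_sqrtr|exact: bdd_W_h].
Qed.

Lemma energyDZ u v (c : R) : bdd_meas setT u -> bdd_meas setT v ->
  energy (fun z => u z + c * v z) (fun z => u z + c * v z) =
  energy u u + 2 * c * energy u v + c ^+ 2 * energy v v.
Proof.
move=> bu bv; rewrite /energy -!RintegralZl//; try exact: integrable_energy.
have iZ (k : R) x y : bdd_meas setT x -> bdd_meas setT y ->
    mu.-integrable D (EFin \o (fun z => k * (sigma_t z.1 * x z * y z))).
  move=> bx yb; have bc : ae_bdd mu D (cst k) by apply: bdd_meas_ae; exact: bdd_meas_cst.
  apply: (integrable_aeM bc); apply: ae_bddM; last exact: ae_bdd_D.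
  by apply: ae_bddM; [exact: ae_bdd_sigma_t|exact: ae_bdd_D].
rewrite -RintegralD//; [|exact: integrable_energy|exact: iZ].
rewrite -RintegralD//; [|exact: (integrableD mD (integrable_energy bu bu) (iZ _ _ _ bu bv))|exact: iZ].
by apply: eq_Rintegral => z _; ring.
Qed.

Lemma norm_tD u v : bdd_meas setT u -> bdd_meas setT v ->
  norm_t Om sigma_t (fun z => u z + v z) <= norm_t Om sigma_t u + norm_t Om sigma_t v.
Proof.
move=> bu bv; have buv := bdd_measD bu bv; rewrite !norm_tE//.
have := energy_ge0 bu; have := energy_ge0 bv.
have E1 := energyDZ 1 bu bv.
have /= := fun c => energy_ge0 (bdd_measD bu (bdd_measZ c bv)).
move=> pos.
have {}pos c : 0 <= energy u u + 2 * c * energy u v + c ^+ 2 * energy v v.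
  by rewrite -energyDZ.
rewrite (_ : (fun z => u z + v z) = (fun z => u z + 1 * v z)); last first.
  by apply/funext => z; rewrite mul1r.
rewrite E1; move: pos.
set A := energy u u; set B := energy u v; set C := energy v v => pos C0 A0.
have CS : B <= Num.sqrt A * Num.sqrt C.
  have [C00|C1] := eqVneq C 0.
    rewrite C00 sqrtr0 mulr0 leNgt; apply/negP => B0.
    (* When [C = 0] the quadratic is affine in [c], and this choice gives it the value -1. *)
    have := pos (- (A + 1) / (2 * B)); rewrite C00 mulr0 addr0.
    rewrite [2 * _ * B]mulrAC mulrC divfK; last by rewrite mulf_neq0// gt_eqF.
    lra.
  have Cp : 0 < C by rewrite lt_neqAle eq_sym C1.
  rewrite -sqrtrM//; apply: le_trans (ler_norm _) _; rewrite -sqrtr_sqr.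
  apply: ler_wsqrtr; rewrite -subr_ge0 -(pmulr_rge0 _ (_ : 0 < C^-1)) ?invr_gt0//.
  (* The minimizer of the quadratic, where its value is [A - B^2 / C]. *)
  apply: le_trans (pos (- B / C)) _.
  by rewrite le_eqVlt; apply/orP; left; apply/eqP; field.
rewrite -[leRHS]ger0_norm ?addr_ge0 ?sqrtr_ge0// -sqrtr_sqr; apply: ler_wsqrtr.
rewrite sqrrD !sqr_sqrtr// mulr2n; lra.
Qed.

End discrete_forms.

(** * Convergence of the iteration *)

Theorem theorem5p1 (R : realType) (d : nat) (d_gt0 : (0 < d)%N)
    (Om : set 'rV[R]_d) (HOm : lipschitz_domain Om)
    (n : 'rV[R]_d -> 'rV[R]_d) (Hn : outward_normal_field Om n)
    (sigma_a sigma_s sigma_t : 'rV[R]_d -> R)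
    (Hsigma : optical_data Om sigma_s sigma_t sigma_a)
    (rho : R) (rhoE : rho = scattering_ratio Om sigma_s sigma_t)
    (rho_lt1 : rho < 1)
    (theta : R -> R) (Htheta : phase_function d theta)
    (q q_bd : 'rV[R]_d * 'rV[R]_d -> R) (Hq : sources Om n q q_bd)
    (kappa h : R) (kappa_gt0 : 0 < kappa) (h_gt0 : 0 < h)
    (NR : nat) (TR : 'I_NR -> 'M[R]_(d.+1, d))
    (HTR : space_mesh Om kappa h TR)
    (NS : nat) (TS : 'I_NS -> 'M[R]_d)
    (HTS : sphere_mesh kappa h TS) (HTS_sym : symmetric_mesh TS)
    (Wh : set ('rV[R]_d * 'rV[R]_d -> R)) (WhE : Wh = W_h Om TR TS)
    (Rh : ('rV[R]_d * 'rV[R]_d -> R) -> ('rV[R]_d * 'rV[R]_d -> R))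
    (HRh : residual_operator Om n sigma_s sigma_t theta q q_bd Wh Rh)
    (uh : 'rV[R]_d * 'rV[R]_d -> R)
    (Huh : solves Om n sigma_s sigma_t theta q q_bd Wh uh uh)
    (u u_half u_c : nat -> 'rV[R]_d * 'rV[R]_d -> R)
    (WhN : nat -> set ('rV[R]_d * 'rV[R]_d -> R))
    (HWhN : forall k, linear_subspace Wh (WhN k))
    (Hu0 : Wh (u 0%N))
    (Hhalf : forall k,
       solves Om n sigma_s sigma_t theta q q_bd Wh (u_half k) (u k))
    (Hargmin : forall k, WhN k (u_c k) /\
       forall w, WhN k w ->
         norm_t Om sigma_t (Rh (u_half k \+ u_c k)) ^+ 2
           <= norm_t Om sigma_t (Rh (u_half k \+ w)) ^+ 2)
    (Hstep : forall k, u k.+1 = u_half k \+ u_c k) :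
  (forall k, norm_t Om sigma_t (uh \- u k)
     <= rho ^+ k / (1 - rho) * norm_t Om sigma_t (Rh (u 0%N))) /\
  (forall k, norm_t Om sigma_t (Rh (u k.+1))
     <= rho * norm_t Om sigma_t (Rh (u k))).
Proof.
have [a [b [rad [HP simplexE _]]]] := space_mesh_polytopal d_gt0 HOm HTR.
subst Wh rho.
set rho := scattering_ratio Om sigma_s sigma_t in rho_lt1 *.
set Wh := W_h Om TR TS in HRh Huh HWhN Hu0 Hhalf *.
pose t := form_t Om n sigma_t; pose s := form_s Om sigma_s theta.
pose l := form_l Om n q q_bd; pose nt := norm_t Om sigma_t.
have rho0 : 0 <= rho by exact: scattering_ratio_ge0.
have Wlin c v w : Wh v -> Wh w -> Wh (fun z => c * v z + w z).
  exact: W_h_lin.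
have WB v w : Wh v -> Wh w -> Wh (fun z => v z - w z).
  move=> Wv Ww; rewrite (_ : (fun _ => _) = (fun z => (-1) * w z + v z)).
    exact: Wlin.
  by apply/funext => z; rewrite mulN1r addrC.
have WD v w : Wh v -> Wh w -> Wh (fun z => v z + w z).
  move=> Wv Ww; rewrite (_ : (fun _ => _) = (fun z => 1 * v z + w z)).
    exact: Wlin.
  by apply/funext => z; rewrite mul1r.
have bW v : Wh v -> bdd_meas setT v.
  exact: (bdd_W_h HTS HP simplexE).
have tB u' v w : Wh u' -> Wh v -> Wh w -> t (fun z => u' z - v z) w = t u' w - t v w.
  exact: (form_tB d_gt0 HOm Hn Hsigma HTR HTS HP simplexE).
have sB u' v w : Wh u' -> Wh v -> Wh w -> s (fun z => u' z - v z) w = s u' w - s v w.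
  exact: (form_sB Hsigma Htheta HTS HP simplexE).
have contr u' w : Wh u' -> Wh w -> (forall v, Wh v -> t u' v = s w v) ->
    nt u' <= rho * nt w.
  move=> Wu' Ww; apply: (transport_contraction Hsigma Htheta HTS HP simplexE) => //.
  exact: bW.
have ntD v w : Wh v -> Wh w -> nt (fun z => v z + w z) <= nt v + nt w.
  by move=> Wv Ww; apply: (norm_tD Hsigma HP); exact: bW.
have uW k : Wh (u k).
  elim: k => [//|k ih]; rewrite Hstep.
  have [Whalf _] := Hhalf k; have [WNc _] := Hargmin k.
  by apply: WD => //; have [sub _ _] := HWhN k; exact: sub.
have RW k : Wh (Rh (u k)) by have [] := HRh _ (uW k).
have RE k v : Wh v -> t (Rh (u k)) v = l v - t (u k) v + s (u k) v.
  by move=> Wv; have [_] := HRh _ (uW k); apply.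
have residual k : nt (Rh (u k.+1)) <= rho * nt (Rh (u k)).
  have [Whalf halfE] := Hhalf k; have [_ cmin] := Hargmin k.
  have [RhalfW RhalfE] := HRh _ Whalf.
  apply: (@le_trans _ _ (nt (Rh (u_half k)))).
    have [_ zero _] := HWhN k.
    have := cmin _ zero; rewrite Hstep.
    rewrite (_ : u_half k \+ cst 0 = u_half k); last first.
      by apply/funext => z /=; rewrite addr0.
    by rewrite ler_pXn2r// nnegrE sqrtr_ge0.
  pose bz z := u_half k z - u k z.
  have Wb : Wh bz by exact: WB.
  apply: (@le_trans _ _ (rho * nt bz)).
    apply: contr => // v Wv.
    rewrite [LHS](RhalfE v Wv) (halfE v Wv) /bz sB// -/s -/l opprD addrC.
    by rewrite [- _ - _]addrC addNKr.
  rewrite ler_wpM2l//.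
  (* The increment [bz] and the residual solve the same discrete transport problem; the triangle
     inequality absorbs their difference of norm zero. *)
  pose e z := bz z - Rh (u k) z.
  have We : Wh e by exact: WB.
  have e0 : nt e = 0.
    apply: (transport_null (n := n) Hsigma HTS HP simplexE We) => v Wv.
    rewrite -/t /e tB// /bz tB// RE//.
    by rewrite [t (u_half k) v](halfE v Wv) -/s -/l; ring.
  rewrite (_ : bz = fun z => e z + Rh (u k) z); last first.
    by apply/funext => z; rewrite /e subrK.
  by apply: le_trans (ntD _ _ We (RW k)) _; rewrite e0 add0r.
split=> // k.
have {}residual : nt (Rh (u k)) <= rho ^+ k * nt (Rh (u 0%N)).
  elim: k => [|k ih]; first by rewrite expr0 mul1r.
  by apply: le_trans (residual k) _; rewrite exprS -mulrA ler_wpM2l.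
have [Wuh uhE] := Huh.
pose e z := uh z - u k z.
have We : Wh e by exact: WB.
pose f z := e z - Rh (u k) z.
have Wf : Wh f by exact: WB.
have fe : nt f <= rho * nt e.
  apply: contr => // v Wv; rewrite /f tB// /e tB// RE// sB//.
  by rewrite [t uh v](uhE v Wv) -/s -/l; ring.
have tri : nt e <= nt f + nt (Rh (u k)).
  rewrite {1}(_ : e = fun z => f z + Rh (u k) z); first exact: ntD.
  by apply/funext => z; rewrite /f subrK.
rewrite -[norm_t Om sigma_t _]/(nt e) mulrAC ler_pdivlMr ?subr_gt0//.
apply: le_trans residual; lra.
Qed.
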